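(* Let $\mathfrak{g}=\bigoplus_{i=1}^{+\infty}\mathfrak{g}_i$ be an infinite-dimensional $\mathbb{N}$-graded Lie algebra over $\mathbb{R}$ such that $$[\mathfrak{g}_1,\mathfrak{g}_i]=\mathfrak{g}_{i+1},\qquad \dim\mathfrak{g}_i+\dim\mathfrak{g}_{i+1}\le 3,\qquad i\in\mathbb{N}.$$ Then $\mathfrak{g}$ is isomorphic (as a Lie algebra) to one and only one Lie algebra from the following list: $$\mathfrak{n}_1^{+},\quad \mathfrak{n}_1^{-},\quad \mathfrak{n}_2,\quad \mathfrak{n}_2^3,\quad \mathfrak{m}_0,\quad \mathfrak{m}_0^{S}\ \text{ with } \emptyset\neq S\subset\{3,5,7,\dots,2m+1,\dots\},$$ where in particular distinct subsets $S$ give non-isomorphic Lie algebras. The classification over $\mathbb{C}$ differs from the real one only in that $\mathfrak{n}_1^{+}$ and $\mathfrak{n}_1^{-}$ become isomorphic over $\mathbb{C}$. That is, every infinite-dimensional $\mathbb{N}$-graded Lie algebra over $\mathbb{C}$ with the two properties displayed above is isomorphic to one and only one of the Lie algebras $\mathfrak{n}_1^{+}\otimes_{\mathbb{R}}\mathbb{C}\cong\mathfrak{n}_1^{-}\otimes_{\mathbb{R}}\mathbb{C}$, $\mathfrak{n}_2$, $\mathfrak{n}_2^3$, $\mathfrak{m}_0$, $\mathfrak{m}_0^S$ ($\emptyset\ne S\subset\{3,5,7,\dots\}$), the last four types being defined over $\mathbb{C}$ by the same bases and relations as over $\mathbb{R}$.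
   Context: $\mathbb{N}=\{1,2,3,\dots\}$. A Lie algebra $\mathfrak{g}$ is $\mathbb{N}$-graded if it is a direct sum of linear subspaces $\mathfrak{g}=\bigoplus_{i\in\mathbb{N}}\mathfrak{g}_i$ with $[\mathfrak{g}_i,\mathfrak{g}_j]\subset\mathfrak{g}_{i+j}$ for all $i,j\in\mathbb{N}$. In the definitions below, brackets of basis vectors that are neither listed nor determined by skew-symmetry from listed ones are zero; $\mathbb{K}=\mathbb{R}$ or $\mathbb{C}$ is the ground field. $\mathfrak{n}_1^{\pm}$ (real Lie algebras): let $\mathfrak{s}^{\pm}$ be the real Lie algebra with basis $u,v,w$ and brackets $[u,v]=w$, $[v,w]=\pm u$, $[w,u]=v$ (so $\mathfrak{s}^{+}=\mathfrak{so}(3,\mathbb{R})$ and $\mathfrak{s}^{-}=\mathfrak{so}(1,2)$). Equip $\mathfrak{s}^{\pm}\otimes\mathbb{R}[t]$ with the bracket $[a\otimes P,b\otimes Q]=[a,b]\otimes PQ$. Then $\mathfrak{n}_1^{\pm}$ is the Lie subalgebra of $\mathfrak{s}^{\pm}\otimes\mathbb{R}[t]$ that is the linear span of $u\otimes t^{2k+1}$, $v\otimes t^{2k+1}$, $w\otimes t^{2k+2}$, $k\ge 0$. $\mathfrak{n}_2$: basis $e_i$, $i\in\mathbb{N}$, with $[e_q,e_l]=d_{q,l}\,e_{q+l}$, where $d_{q,l}$ depends only on the residues of $q$ and $l$ modulo $8$. Listing, for each residue of $q$, the values of $d_{q,l}$ for $l\equiv 0,1,2,3,4,5,6,7 \pmod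 8$ in this order: $q\equiv 0$: $(0,1,-2,-1,0,1,2,-1)$; $q\equiv 1$: $(-1,0,1,1,-3,-2,0,1)$; $q\equiv 2$: $(2,-1,0,0,0,1,-1,0)$; $q\equiv 3$: $(1,-1,0,0,3,-1,1,-2)$; $q\equiv 4$: $(0,3,0,-3,0,3,0,-3)$; $q\equiv 5$: $(-1,2,-1,1,-3,0,0,-1)$; $q\equiv 6$: $(-2,0,1,-1,0,0,0,1)$; $q\equiv 7$: $(1,-1,0,2,3,1,-1,0)$. $\mathfrak{n}_2^3$: the one-dimensional central extension of $\mathfrak{n}_2$ with basis $z,e_1,e_2,e_3,\dots$, the same brackets of the $e_i$ as in $\mathfrak{n}_2$ except that $[e_2,e_3]=z$ (and $[e_3,e_2]=-z$), and $[z,e_i]=0$ for all $i\in\mathbb{N}$. $\mathfrak{m}_0$: basis $e_i$, $i\in\mathbb{N}$, with $[e_1,e_i]=e_{i+1}$ for all $i\ge 2$. $\mathfrak{m}_0^S$, for $S\subset\{3,5,7,\dots\}$ (finite or infinite): basis $e_i$, $i\in\mathbb{N}$, together with $z_r$, $r\in S$, and relations $[e_1,e_i]=e_{i+1}$ for $i\ge2$, and $[e_l,e_{r-l+2}]=(-1)^{l+1}z_r$ for $2\le l\le\frac{r+1}{2}$, $r\in S$ (the $z_r$ are central).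
   Formalization: In the table of n_2 the values d_{5,7} = -1 and d_{7,5} = 1 are replaced by d_{5,7} = 1 and d_{7,5} = -1: as printed, the Jacobi identity fails on e_1, e_4, e_7 (the sum is -6), so the printed n_2 is not a Lie algebra; the other entries force the corrected value. *)

(* Defs.v *)
From HB Require Import structures.
From mathcomp Require Import all_boot all_order all_algebra.
From mathcomp Require Import finmap.
From mathcomp.multinomials Require Import monalg.
From mathcomp Require Import complex ring.
From mathcomp Require Import boolp classical_sets reals.

Set Implicit Arguments.
Unset Strict Implicit.
Unset Printing Implicit Defensive.

Import Order.TTheory GRing.Theory Num.Theory.

Local Open Scope classical_set_scope.
Local Open Scope ring_scope.

HB.mixin Record Lmodule_isLieAlgebra (K : fieldType) V of GRing.Lmodule K V := {
  lie : V -> V -> V;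
  lie_linearl : forall y, linear (lie^~ y);
  lie_linearr : forall x, linear (lie x);
  liexx : forall x, lie x x = 0;
  lie_jacobi : forall x y z,
    lie x (lie y z) + lie y (lie z x) + lie z (lie x y) = 0
}.

#[short(type="lieAlgType")]
HB.structure Definition LieAlgebra (K : fieldType) :=
  { V of GRing.Lmodule K V & Lmodule_isLieAlgebra K V }.

Section LieTheory.
Variables (K : fieldType) (L : lieAlgType K).
Implicit Types x y z : L.

HB.instance Definition _ x :=
  GRing.isLinear.Build K L L *:%R (lie x) (@lie_linearr K L x).

Lemma lieDl x y z : lie (x + y) z = lie x z + lie y z.
Proof. by have := lie_linearl (s := L) z 1 x y; rewrite !scale1r. Qed.

Lemma lieC x y : lie x y = - lie y x.
Proof.
apply/eqP; rewrite -addr_eq0; apply/eqP.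
by have := liexx (x + y); rewrite lieDl !linearD /= !liexx add0r addr0.
Qed.

Lemma lieNl x y : lie (- x) y = - lie x y.
Proof. by rewrite lieC linearN /= opprK lieC. Qed.

Lemma lieZl a x y : lie (a *: x) y = a *: lie x y.
Proof. by rewrite lieC linearZ /= -scalerN -lieC. Qed.

End LieTheory.

Definition lie_iso (K : fieldType) (L M : lieAlgType K) : Prop :=
  exists f : {linear L -> M},
    bijective f /\ forall x y, f (lie x y) = lie (f x) (f y).

Section LinearAlgebra.
Variables (K : fieldType) (V : lmodType K).

Definition lin_span (A : set V) : set V :=
  [set x | exists (n : nat) (c : 'I_n -> K) (a : 'I_n -> V),
     (forall i, A (a i)) /\ x = \sum_(i < n) c i *: a i].

Definition has_dim (A : set V) (d : nat) : Prop :=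
  exists e : 'I_d -> V,
    A = lin_span (range e) /\
    (forall c : 'I_d -> K, \sum_(i < d) c i *: e i = 0 -> forall i, c i = 0).

Definition infinite_dimensional : Prop := forall d, ~ has_dim setT d.

Definition subspace (A : set V) : Prop :=
  A 0 /\ forall (a : K) x y, A x -> A y -> A (a *: x + y).

(* The index 0 is never used: the components are [g i] for [0 < i]. *)
Definition direct_sum_decomposition (g : nat -> set V) : Prop :=
  [/\ forall i, (0 < i)%N -> subspace (g i),
      forall x, exists (n : nat) (c : nat -> V),
        (forall i, (0 < i)%N -> g i (c i)) /\ x = \sum_(1 <= i < n) c i
    & forall (n : nat) (c : nat -> V),
        (forall i, (0 < i)%N -> g i (c i)) -> \sum_(1 <= i < n) c i = 0 ->
        forall i, (0 < i < n)%N -> c i = 0].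

Lemma lin_span_subspace (A : set V) : subspace (lin_span A).
Proof.
split; first by exists 0%N, (fun=> 0), (fun=> 0); split; [case|rewrite big_ord0].
move=> a _ _ [n [c [u [uA ->]]]] [m [d [v [vA ->]]]].
exists (n + m)%N,
  (fun i => match split i with inl j => a * c j | inr j => d j end),
  (fun i => match split i with inl j => u j | inr j => v j end).
split; first by move=> i; case: split.
rewrite big_split_ord scaler_sumr; congr (_ + _); apply: eq_bigr => i _.
  by rewrite (unsplitK (inl i)) scalerA.
by rewrite (unsplitK (inr i)).
Qed.

Lemma lin_span_min (A B : set V) : subspace B -> A `<=` B -> lin_span A `<=` B.
Proof.
move=> [B0 BD] AB _ [n [c [u [uA ->]]]].
apply: big_ind => // [x y Bx By|i _].
  by rewrite -[x]scale1r; apply: BD.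
by rewrite -[_ *: _]addr0; apply: BD => //; apply/AB/uA.
Qed.

Lemma sub_lin_span (A : set V) : A `<=` lin_span A.
Proof.
move=> x Ax; exists 1%N, (fun=> 1), (fun=> x); split=> //.
by rewrite big_ord1 scale1r.
Qed.

End LinearAlgebra.

Section Grading.
Variables (K : fieldType) (L : lieAlgType K).

Definition lie_product (A B : set L) : set L :=
  lin_span [set lie x y | x in A & y in B].

Definition N_grading (g : nat -> set L) : Prop :=
  direct_sum_decomposition g /\
  forall i j, (0 < i)%N -> (0 < j)%N -> lie_product (g i) (g j) `<=` g (i + j)%N.

End Grading.

(* Lie algebras given by a basis and structure constants: [t i j] is the
   bracket of the basis vectors [<< i >>] and [<< j >>]. *)
Section Tables.
Variables (K : fieldType) (I : choiceType).

Definition table_lie (t : I -> I -> {malg K[I]}) (x y : {malg K[I]}) :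
    {malg K[I]} :=
  \sum_(i <- msupp x) \sum_(j <- msupp y) (x@_i * y@_j) *: t i j.

Record lieTable := LieTable {
  table :> I -> I -> {malg K[I]};
  tablexx : forall i, table i i = 0;
  tableC : forall i j, table i j = - table j i;
  table_jacobi : forall i j k,
    table_lie table << i >> (table j k) + table_lie table << j >> (table k i)
      + table_lie table << k >> (table i j) = 0
}.

Section RawTheory.
Variable t : I -> I -> {malg K[I]}.
Implicit Types x y z : {malg K[I]}.

Lemma table_lieEw (A B : {fset I}) x y :
  (msupp x `<=` A)%fset -> (msupp y `<=` B)%fset ->
  table_lie t x y = \sum_(i <- A) \sum_(j <- B) (x@_i * y@_j) *: t i j.
Proof.
move=> sA sB; rewrite /table_lie (big_fset_incl _ sA); last first.
  by move=> i _ /mcoeff_outdom xi; apply: big1 => j _; rewrite xi mul0r scale0r.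
apply: eq_bigr => i _; apply: big_fset_incl sB _ => j _ /mcoeff_outdom yj.
by rewrite yj mulr0 scale0r.
Qed.

Lemma table_lie_linearl y : linear (table_lie t ^~ y).
Proof.
move=> a x x'.
pose A := (msupp x `|` msupp x' `|` msupp (a *: x + x'))%fset.
have s1 : (msupp x `<=` A)%fset.
  by apply: fsubset_trans (fsubsetUl _ _); apply: fsubsetUl.
have s2 : (msupp x' `<=` A)%fset.
  by apply: fsubset_trans (fsubsetUl _ _); apply: fsubsetUr.
have s3 : (msupp (a *: x + x') `<=` A)%fset by apply: fsubsetUr.
rewrite (table_lieEw s1 (fsubset_refl _)) (table_lieEw s2 (fsubset_refl _)).
rewrite (table_lieEw s3 (fsubset_refl _)) scaler_sumr -big_split /=.
apply: eq_bigr => i _; rewrite scaler_sumr -big_split /=.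
by apply: eq_bigr => j _; rewrite mcoeffD mcoeffZ mulrDl scalerDl scalerA mulrA.
Qed.

Lemma table_lie_linearr x : linear (table_lie t x).
Proof.
move=> a y y'.
pose B := (msupp y `|` msupp y' `|` msupp (a *: y + y'))%fset.
have s1 : (msupp y `<=` B)%fset.
  by apply: fsubset_trans (fsubsetUl _ _); apply: fsubsetUl.
have s2 : (msupp y' `<=` B)%fset.
  by apply: fsubset_trans (fsubsetUl _ _); apply: fsubsetUr.
have s3 : (msupp (a *: y + y') `<=` B)%fset by apply: fsubsetUr.
rewrite (table_lieEw (fsubset_refl _) s1) (table_lieEw (fsubset_refl _) s2).
rewrite (table_lieEw (fsubset_refl _) s3) scaler_sumr -big_split /=.
apply: eq_bigr => i _; rewrite scaler_sumr -big_split /=.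
apply: eq_bigr => j _; rewrite mcoeffD mcoeffZ mulrDr scalerDl scalerA.
by rewrite mulrCA.
Qed.

HB.instance Definition _ x :=
  GRing.isLinear.Build K _ _ *:%R (table_lie t x) (@table_lie_linearr x).

Definition table_lier y x := table_lie t x y.
HB.instance Definition _ y :=
  GRing.isLinear.Build K _ _ *:%R (table_lier y) (@table_lie_linearl y).

Lemma table_lieUU i j : table_lie t << i >> << j >> = t i j.
Proof.
rewrite /table_lie !msuppU oner_eq0 !big_seq_fset1 !mcoeffUU mulr1.
by rewrite scale1r.
Qed.

Lemma table_lieUZ i c j : table_lie t << i >> (c *: << j >>) = c *: t i j.
Proof. by rewrite linearZ /= table_lieUU. Qed.

Lemma malg_ZE x : x = \sum_(i <- msupp x) x@_i *: << i >>.
Proof.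
rewrite {1}[x]monalgE; apply: eq_bigr => i _.
by apply/malgP => k; rewrite mcoeffZ !mcoeffU -mulr_natr; case: eqP;
   rewrite ?mulr1 ?mulr0.
Qed.

End RawTheory.

Lemma malg_linear0 (f : {malg K[I]} -> {malg K[I]}) :
  linear f -> (forall i, f << i >> = 0) -> forall x, f x = 0.
Proof.
move=> f_lin fU x.
pose fL := GRing.isLinear.Build K _ _ *:%R f f_lin.
pose F : {linear {malg K[I]} -> {malg K[I]}} := HB.pack f fL.
rewrite -[f]/(F : _ -> _) [x]malg_ZE linear_sum big1 // => i _.
by rewrite linearZ /= fU scaler0.
Qed.

Definition table_algebra (t : lieTable) : Type := {malg K[I]}.

Variable t : lieTable.

Lemma table_liexx x : table_lie t x x = 0.
Proof.
rewrite /table_lie; elim: (msupp x : seq I) => [|a s IH]; first by rewrite big_nil.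
rewrite big_cons; under [X in _ + X]eq_bigr do rewrite big_cons.
rewrite big_split /= IH addr0 big_cons tablexx scaler0 add0r -big_split /=.
by apply: big1 => i _; rewrite tableC scalerN mulrC addNr.
Qed.

Lemma table_lieD x y z :
  table_lie t (x + y) z = table_lie t x z + table_lie t y z.
Proof. by have := table_lie_linearl t z 1 x y; rewrite !scale1r. Qed.

Lemma table_lieZ a x z : table_lie t (a *: x) z = a *: table_lie t x z.
Proof. exact: (linearZ_LR (table_lier t z)). Qed.

Lemma table_lie_jacobi x y z :
  table_lie t x (table_lie t y z) + table_lie t y (table_lie t z x)
    + table_lie t z (table_lie t x y) = 0.
Proof.
have lin (f g h : {malg K[I]} -> {malg K[I]}) : linear f -> linear g ->
    linear h -> linear (fun u => f u + g u + h u).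
  move=> lf lg lh a u v; rewrite lf lg lh !scalerDr.
  by rewrite (addrACA (a *: f u)) (addrACA (a *: f u + _)).
pose J u v w := table_lie t u (table_lie t v w)
  + table_lie t v (table_lie t w u) + table_lie t w (table_lie t u v).
have Jl v w : linear (fun u => J u v w).
  apply: lin => a u u'; first exact: table_lie_linearl.
    by rewrite !linearP.
  by rewrite table_lieD table_lieZ linearP.
have rot (a b c : {malg K[I]}) : a + b + c = b + c + a by rewrite -addrA addrC.
have Jrot u v w : J u v w = J v w u.
  exact: rot.
rewrite -/(J x y z).
apply: (malg_linear0 (f := fun u => J u y z)) => // i.
rewrite Jrot; apply: (malg_linear0 (f := fun u => J u z << i >>)) => // j.
rewrite Jrot; apply: (malg_linear0 (f := fun u => J u << i >> << j >>)) => // k.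
by rewrite /J !table_lieUU table_jacobi.
Qed.

HB.instance Definition _ := GRing.Lmodule.copy (table_algebra t) {malg K[I]}.
HB.instance Definition _ := Lmodule_isLieAlgebra.Build K (table_algebra t)
  (table_lie_linearl t) (table_lie_linearr t) table_liexx table_lie_jacobi.

End Tables.

Section M0.
Variable K : fieldType.

(* The basis vectors e_1, e_2, ... are indexed by [nat]: e_i is [<< i.-1 >>]. *)
Definition m0_e (i : nat) : {malg K[nat]} := << i.-1 >>.

Definition m0_bracket (q l : nat) : {malg K[nat]} :=
  if (q == 1) && (2 <= l)%N then m0_e l.+1
  else if (l == 1) && (2 <= q)%N then - m0_e q.+1
  else 0.

Let t (i j : nat) := m0_bracket i.+1 j.+1.

Fact m0_xx i : t i i = 0.
Proof. by rewrite /t; case: i. Qed.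

Fact m0_C i j : t i j = - t j i.
Proof.
by rewrite /t; case: i j => [|i] [|j] //=; rewrite /m0_bracket /= ?oppr0 ?opprK.
Qed.

Fact m0_jacobi i j k :
  table_lie t << i >> (t j k) + table_lie t << j >> (t k i)
    + table_lie t << k >> (t i j) = 0.
Proof.
have E a b : table_lie t << a >> << b >> = t a b by apply: table_lieUU.
have E0 a : table_lie t << a >> 0 = 0 by apply: linear0.
have EN a b : table_lie t << a >> (- << b >>) = - t a b.
  by rewrite linearN /= E.
have t0S a : t 0 a.+1 = << a.+2 >> by [].
have tS0 a : t a.+1 0 = - << a.+2 >> by [].
have t00 : t 0 0 = 0 by [].
have tSS a b : t a.+1 b.+1 = 0 by [].
case: i j k => [|i] [|j] [|k]; rewrite ?(t0S, tS0, t00, tSS, E, E0, EN);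
  by rewrite ?(oppr0, addr0, add0r, subrr, addNr).
Qed.

Definition m0 : lieAlgType K :=
  table_algebra (LieTable m0_xx m0_C m0_jacobi).

End M0.

Section N2.

(* Row q, column l, modulo 8. The printed table has -1 at (5,7) and 1 at
   (7,5), which contradicts the Jacobi identity for e_1, e_4, e_7; given the
   other entries, that identity forces 1 and -1. *)
Definition n2_d (q l : nat) : int :=
  nth 0 (nth [::] [::
    [::  0;  1; -2; -1;  0;  1;  2; -1];
    [:: -1;  0;  1;  1; -3; -2;  0;  1];
    [::  2; -1;  0;  0;  0;  1; -1;  0];
    [::  1; -1;  0;  0;  3; -1;  1; -2];
    [::  0;  3;  0; -3;  0;  3;  0; -3];
    [:: -1;  2; -1;  1; -3;  0;  0;  1];
    [:: -2;  0;  1; -1;  0;  0;  0;  1];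
    [::  1; -1;  0;  2;  3; -1; -1;  0]] (q %% 8)%N) (l %% 8)%N.

Fact n2_dC q l : n2_d q l = - n2_d l q.
Proof.
rewrite /n2_d; move: (q %% 8)%N (l %% 8)%N (ltn_pmod q (isT : 0 < 8)%N)
  (ltn_pmod l (isT : 0 < 8)%N).
by do 8 (case=> [|+]; first by do 8 (case=> [|+] //)).
Qed.

Fact n2_d_jacobi i j k :
  n2_d j k * n2_d i (j + k)%N + n2_d k i * n2_d j (k + i)%N
    + n2_d i j * n2_d k (i + j)%N = 0.
Proof.
have red a b c : n2_d a (b + c)%N = n2_d (a %% 8)%N (b %% 8 + c %% 8)%N.
  by rewrite /n2_d modn_mod modnDm.
have red2 a b : n2_d a b = n2_d (a %% 8)%N (b %% 8)%N by rewrite /n2_d !modn_mod.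
rewrite (red i) (red j) (red k) (red2 j k) (red2 k i) (red2 i j).
have H : all (fun i => all (fun j => all (fun k =>
    n2_d j k * n2_d i (j + k)%N + n2_d k i * n2_d j (k + i)%N
      + n2_d i j * n2_d k (i + j)%N == 0) (iota 0 8)) (iota 0 8)) (iota 0 8).
  by vm_compute.
have mem a : (a %% 8)%N \in iota 0 8 by rewrite mem_iota ltn_pmod.
by apply/eqP; move/allP/(_ _ (mem i))/allP/(_ _ (mem j))/allP/(_ _ (mem k)): H.
Qed.

Variable K : fieldType.

Definition n2_e (i : nat) : {malg K[nat]} := << i.-1 >>.

Definition n2_bracket (q l : nat) : {malg K[nat]} :=
  (n2_d q l)%:~R *: n2_e (q + l)%N.

Let t (i j : nat) := n2_bracket i.+1 j.+1.

Fact n2_C i j : t i j = - t j i.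
Proof. by rewrite /t /n2_bracket n2_dC rmorphN scaleNr addnC. Qed.

Fact n2_xx i : t i i = 0.
Proof.
have d0 : all (fun q => n2_d q q == 0) (iota 0 8) by [].
rewrite /t /n2_bracket.
have -> : n2_d i.+1 i.+1 = n2_d (i.+1 %% 8)%N (i.+1 %% 8)%N.
  by rewrite /n2_d !modn_mod.
by move/allP/(_ (i.+1 %% 8)%N): d0; rewrite mem_iota ltn_pmod // => /(_ isT) /eqP->;
   rewrite scale0r.
Qed.

Fact n2_jacobi i j k :
  table_lie t << i >> (t j k) + table_lie t << j >> (t k i)
    + table_lie t << k >> (t i j) = 0.
Proof.
have E a b c : table_lie t << a >> (t b c) =
    (n2_d b.+1 c.+1 * n2_d a.+1 (b.+1 + c.+1)%N)%:~R *:
      n2_e (a.+1 + b.+1 + c.+1)%N.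
  rewrite {2}/t /n2_bracket /n2_e table_lieUZ /t /n2_bracket scalerA -rmorphM /=.
  by rewrite addnS /= -addnS -addnA.
rewrite !E (_ : j.+1 + k.+1 + i.+1 = i.+1 + j.+1 + k.+1 :> nat)%N; last first.
  by rewrite addnC addnA.
rewrite (_ : k.+1 + i.+1 + j.+1 = i.+1 + j.+1 + k.+1 :> nat)%N; last first.
  by rewrite -addnA addnC.
by rewrite -!scalerDl -!rmorphD /= n2_d_jacobi scale0r.
Qed.

Definition n2 : lieAlgType K := table_algebra (LieTable n2_xx n2_C n2_jacobi).

End N2.

Section N23.
Variable K : fieldType.

(* [None] indexes z and [Some i.-1] indexes e_i. *)
Definition n23_e (i : nat) : {malg K[option nat]} := << Some i.-1 >>.
Definition n23_z : {malg K[option nat]} := << None >>.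

Definition n23_bracket (q l : nat) : {malg K[option nat]} :=
  if (q == 2) && (l == 3) then n23_z
  else if (q == 3) && (l == 2) then - n23_z
  else (n2_d q l)%:~R *: n23_e (q + l).

Definition n23_fun (x y : option nat) : {malg K[option nat]} :=
  if (x, y) is (Some i, Some j) then n23_bracket i.+1 j.+1 else 0.

Let w (q l : nat) : int :=
  ((q == 2) && (l == 3))%:R - ((q == 3) && (l == 2))%:R.

Fact n23_bracketE q l : n23_bracket q l =
  (n2_d q l)%:~R *: n23_e (q + l) + (w q l)%:~R *: n23_z.
Proof.
rewrite /n23_bracket /w; case: ifP => [/andP[/eqP-> /eqP->]|_].
  by rewrite scale0r add0r scale1r.
case: ifP => [/andP[/eqP-> /eqP->]|_]; last by rewrite subrr scale0r addr0.
by rewrite scale0r add0r sub0r mulrNz scaleN1r.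
Qed.

Fact n23_C x y : n23_fun x y = - n23_fun y x.
Proof.
case: x y => [i|] [j|]; rewrite /n23_fun ?oppr0 // !n23_bracketE opprD -!scaleNr.
rewrite -!mulrNz -n2_dC addnC; congr (_ + _%:~R *: _).
by rewrite /w opprB andbC [in LHS](andbC (i.+1 == 3)).
Qed.

Fact n23_xx x : n23_fun x x = 0.
Proof.
case: x => [i|] //; rewrite /n23_fun; have := n2_xx K i.
rewrite /n2_bracket /n2_e n23_bracketE => /(congr1 (mcoeff (i.+1 + i.+1).-1)).
rewrite mcoeffZ mcoeffUU mcoeff0 mulr1 => ->; rewrite scale0r add0r.
by rewrite /w andbC subrr scale0r.
Qed.

Fact n23_jacobi x y z :
  table_lie n23_fun << x >> (n23_fun y z) + table_lie n23_fun << y >> (n23_fun z x)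
    + table_lie n23_fun << z >> (n23_fun x y) = 0.
Proof.
have t0 a : table_lie n23_fun << a >> 0 = 0 by apply: linear0.
have nf a b : n23_fun (Some a) (Some b) = n23_bracket a.+1 b.+1 by [].
have nN a : n23_fun None a = 0 by [].
have nfN a : n23_fun a None = 0 by case: a.
have tN b c : table_lie n23_fun << None >> (n23_fun b c) = 0.
  case: b c => [b|] [c|]; rewrite ?(nfN, nN) ?t0 // nf n23_bracketE linearD !linearZ /=.
  by rewrite !table_lieUU !nN !scaler0 addr0.
have E a b c : table_lie n23_fun << Some a >> (n23_fun (Some b) (Some c)) =
    (n2_d b.+1 c.+1 * n2_d a.+1 (b.+1 + c.+1)%N)%:~R *:
      n23_e (a.+1 + b.+1 + c.+1)%N
    + (n2_d b.+1 c.+1 * w a.+1 (b.+1 + c.+1)%N)%:~R *: n23_z.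
  rewrite nf n23_bracketE linearD !linearZ /= !table_lieUU nfN nf.
  rewrite scaler0 addr0 n23_bracketE scalerDr !scalerA -!rmorphM /=.
  by rewrite addnS /= -addnS -addnA.
case: x y z => [i|] [j|] [k|]; rewrite ?(nfN, nN) ?t0 ?tN ?addr0 //.
rewrite !E (_ : j.+1 + k.+1 + i.+1 = i.+1 + j.+1 + k.+1 :> nat)%N; last first.
  by rewrite addnC addnA.
rewrite (_ : k.+1 + i.+1 + j.+1 = i.+1 + j.+1 + k.+1 :> nat)%N; last first.
  by rewrite -addnA addnC.
have add3 (a b a' b' a2 b2 : {malg K[option nat]}) :
    (a + b) + (a' + b') + (a2 + b2) = (a + a' + a2) + (b + b' + b2).
  by rewrite (addrACA a) (addrACA (a + a')).
rewrite add3 -!scalerDl -!rmorphD /= n2_d_jacobi scale0r.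
rewrite add0r (_ : _ + _ + _ = 0) ?scale0r //.
have w0 a b : (a + b != 5)%N -> w a b = 0.
  move=> ab; rewrite /w; case: andP => [[/eqP a2 /eqP b3]|_].
    by rewrite a2 b3 in ab.
  by case: andP => [[/eqP a3 /eqP b2]|_] //; rewrite a3 b2 in ab.
have [|ne5] := eqVneq (i.+1 + j.+1 + k.+1)%N 5; last first.
  rewrite !w0 ?mulr0 // ?addnA //; first by rewrite -addnA addnC.
  by rewrite addnC addnA.
by case: i j k => [|[|[|i]]] [|[|[|j]]] [|[|[|k]]] s5;
   [> (by []) || by rewrite !(addSn, addnS) in s5 ..].
Qed.

Definition n23 : lieAlgType K :=
  table_algebra (LieTable n23_xx n23_C n23_jacobi).

End N23.

Record oddSet := OddSet {
  oset :> set nat;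
  oset_odd : oset `<=` [set r | odd r && (3 <= r)%N]
}.

Section M0S.
Variables (K : fieldType) (S : oddSet).

Definition m0S_basis : choiceType := (nat + {r : nat | r \in oset S})%type.

Definition m0S_e (i : nat) : {malg K[m0S_basis]} := << inl i.-1 >>.

(* z_r if r belongs to S, and 0 otherwise *)
Definition m0S_z (r : nat) : {malg K[m0S_basis]} :=
  if insub r is Some s then << inr s >> else 0.

Definition m0S_bracket (q l : nat) : {malg K[m0S_basis]} :=
  let r := (q + l - 2)%N in
  if (q == 1) && (2 <= l)%N then m0S_e l.+1
  else if (l == 1) && (2 <= q)%N then - m0S_e q.+1
  else if (2 <= q <= r.+1./2)%N then (-1) ^+ q.+1 *: m0S_z r
  else if (2 <= l <= r.+1./2)%N then - ((-1) ^+ l.+1 *: m0S_z r)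
  else 0.

Definition m0S_fun (x y : m0S_basis) : {malg K[m0S_basis]} :=
  if (x, y) is (inl i, inl j) then m0S_bracket i.+1 j.+1 else 0.

Fact m0S_bracketE q l : (2 <= q)%N -> (2 <= l)%N ->
  m0S_bracket q l = (-1) ^+ q.+1 *: m0S_z (q + l - 2).
Proof.
move=> q2 l2; rewrite /m0S_bracket q2 l2 /= !andbT.
rewrite !gtn_eqF //= /m0S_z; case: insubP => [s /set_mem/(@oset_odd S) /= + _|_].
  case/andP; case: q l q2 l2 => [|[|q]] [|[|l]] // _ _.
  rewrite !addSn !addnS !subSS subn0 /= !negbK => qlo _.
  have half a b : (a.+2 <= (a + b).+3./2)%N = (a < b)%N.
    by rewrite geq_half_double !doubleS !ltnS -addnn ltn_add2l.
  rewrite half; case: ltngtP => [//|lq|qEl].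
    rewrite addnC half lq -scaleNr; congr (_ *: _).
    rewrite -(signr_odd _ q.+3) -(signr_odd _ l.+3) /= !negbK.
    by move: qlo; rewrite oddD; do 2 case: odd; rewrite //= ?expr0 ?expr1 ?opprK.
  by move: qlo; rewrite qEl addnn odd_double.
by case: ifP => _; last case: ifP => _; rewrite ?scaler0 ?oppr0.
Qed.

Fact m0S_C x y : m0S_fun x y = - m0S_fun y x.
Proof.
have H l : m0S_bracket l.+2 1 = - m0S_bracket 1 l.+2 by [].
case: x y => [i|x] [j|y]; rewrite /m0S_fun ?oppr0 //.
case: i j => [|i] [|j]; rewrite ?H ?opprK //; first by rewrite oppr0.
rewrite !m0S_bracketE // [in RHS]addnC -scaleNr.
rewrite /m0S_z; case: insubP => [s /set_mem/(@oset_odd S) /= + _|_]; last first.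
  by rewrite !scaler0.
rewrite !addSn !addnS !subSS subn0 => /andP[+ _]; rewrite /= negbK oddD => ij.
congr (_ *: _); rewrite -(signr_odd _ i.+3) -(signr_odd _ j.+3) /= !negbK.
by move: ij; do 2 case: odd; rewrite //= ?expr0 ?expr1 ?opprK.
Qed.

Fact m0S_xx x : m0S_fun x x = 0.
Proof.
case: x => [[|i]|x] //; rewrite /m0S_fun m0S_bracketE // /m0S_z.
case: insubP => [s /set_mem/(@oset_odd S) /= + _|_]; last by rewrite scaler0.
by rewrite !addSn !addnS !subSS subn0 /= negbK addnn odd_double.
Qed.

Fact m0S_jacobi x y z :
  table_lie m0S_fun << x >> (m0S_fun y z) + table_lie m0S_fun << y >> (m0S_fun z x)
    + table_lie m0S_fun << z >> (m0S_fun x y) = 0.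
Proof.
have E a b : table_lie m0S_fun << a >> << b >> = m0S_fun a b.
  exact: table_lieUU.
have E0 a : table_lie m0S_fun << a >> 0 = 0 by apply: linear0.
have EN a u : table_lie m0S_fun << a >> (- u) = - table_lie m0S_fun << a >> u.
  exact: linearN.
have rN a s : m0S_fun a (inr s) = 0 by case: a.
have lN a s : m0S_fun (inr s) a = 0 by [].
have Ez a r : table_lie m0S_fun << a >> (m0S_z r) = 0.
  by rewrite /m0S_z; case: insubP => [s _ _|_]; rewrite ?E0 // E rN.
have t0S a : m0S_fun (inl 0) (inl a.+1) = << inl a.+2 >> by [].
have tS0 a : m0S_fun (inl a.+1) (inl 0) = - << inl a.+2 >> by [].
have t00 : m0S_fun (inl 0) (inl 0) = 0 by [].
have tSS a b : m0S_fun (inl a.+1) (inl b.+1) = (-1) ^+ a.+1 *: m0S_z (a + b).+2.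
  rewrite /m0S_fun m0S_bracketE // !addSn !addnS !subSS subn0.
  by rewrite !exprS !mulN1r opprK.
have ESS u a b : table_lie m0S_fun << u >> (m0S_fun (inl a.+1) (inl b.+1)) = 0.
  by rewrite tSS linearZ /= Ez scaler0.
have Er s u v : table_lie m0S_fun << inr s >> (m0S_fun u v) = 0.
  case: u v => [[|a]|u] [[|b]|v];
  by rewrite ?(ESS, lN, rN, t00, t0S, tS0, EN, E, E0, oppr0).
have main a b : table_lie m0S_fun << inl a.+1 >> << inl b.+2 >> =
                table_lie m0S_fun << inl b.+1 >> << inl a.+2 >>.
  rewrite !E !(m0S_C (inl b.+1)) !tSS -scaleNr addnS addSn /m0S_z.
  case: insubP => [s /set_mem/(@oset_odd S) /= + _|_]; last by rewrite !scaler0.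
  move=> /andP[+ _]; rewrite !negbK oddD => ab; congr (_ *: _).
  rewrite -(signr_odd _ a.+1) -(signr_odd _ a.+2) /= !negbK.
  by case: odd; rewrite //= ?expr0 ?expr1 ?opprK.
have EB u a : table_lie m0S_fun << u >> (m0S_fun (inl a.+1) (inl 0)) =
    - table_lie m0S_fun << u >> << inl a.+2 >> by rewrite tS0 EN.
have EB' u a : table_lie m0S_fun << u >> (m0S_fun (inl 0) (inl a.+1)) =
    table_lie m0S_fun << u >> << inl a.+2 >> by rewrite t0S.
have ET u : table_lie m0S_fun << u >> (m0S_fun (inl 0) (inl 0)) = 0.
  by rewrite t00 E0.
clear E EN Ez t0S tS0 t00 tSS.
set F := m0S_fun in EB EB' ET ESS E0 main Er lN rN *; clearbody F.
case: x => [x|x]; last by rewrite Er lN rN !E0 !addr0.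
case: y => [y|y]; last by rewrite Er lN rN !E0 !addr0.
case: z => [z|z]; last by rewrite Er lN rN !E0 !addr0.
case: x y z => [|x] [|y] [|z].
- by rewrite !ET !addr0.
- by rewrite EB EB' [X in _ + X]ET addr0 subrr.
- by rewrite EB EB' [X in _ + X + _]ET addr0 addrC subrr.
- by rewrite ESS EB EB' main add0r addrC subrr.
- by rewrite EB EB' [X in X + _ + _]ET add0r subrr.
- by rewrite ESS EB EB' main addr0 subrr.
- by rewrite ESS EB EB' main addr0 addrC subrr.
- by rewrite !ESS !addr0.
Qed.

Definition m0S : lieAlgType K := table_algebra (LieTable m0S_xx m0S_C m0S_jacobi).

End M0S.

Lemma lin_span_lie (K : fieldType) (L : lieAlgType K) (A : set L) :
  (forall x y, A x -> A y -> lin_span A (lie x y)) ->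
  forall x y, lin_span A x -> lin_span A y -> lin_span A (lie x y).
Proof.
have [S0 SD] := lin_span_subspace A => AA x y xA.
apply: (lin_span_min (B := fun y => lin_span A (lie x y))) => {y} [|y yA].
  by split=> [|a y z ly lz]; rewrite ?linear0 // linearP; apply: SD.
move: x xA; apply: (lin_span_min (B := fun x => lin_span A (lie x y))) => [|x xA].
  by split=> [|a x z lx lz]; [rewrite lieC linear0 oppr0|rewrite lie_linearl; apply: SD].
exact: AA.
Qed.

Record lieSubalgebra (K : fieldType) (L : lieAlgType K) := LieSubalgebra {
  subalgebra_set :> set L;
  subalgebra_subspace : subspace subalgebra_set;
  subalgebra_lie : forall x y,
    subalgebra_set x -> subalgebra_set y -> subalgebra_set (lie x y)
}.

Section Subalgebra.
Variables (K : fieldType) (L : lieAlgType K) (A : lieSubalgebra L).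

Definition subalgebra_pred : {pred L} := fun x => `[< subalgebra_set A x >].

Fact subalgebra_predP x : reflect (subalgebra_set A x) (x \in subalgebra_pred).
Proof. exact: asboolP. Qed.

Fact subalgebra_submod_closed : submod_closed subalgebra_pred.
Proof.
have [A0 AD] := subalgebra_subspace A.
split=> [|a x y]; first exact/subalgebra_predP.
by move=> /subalgebra_predP Ax /subalgebra_predP Ay; apply/subalgebra_predP/AD.
Qed.

HB.instance Definition _ :=
  GRing.isSubmodClosed.Build K L subalgebra_pred subalgebra_submod_closed.

Record subalgebra := Subalgebra {
  subalgebra_val :> L;
  subalgebra_valP : subalgebra_val \in subalgebra_pred
}.

HB.instance Definition _ := [isSub for subalgebra_val].
HB.instance Definition _ := [Choice of subalgebra by <:].
HB.instance Definition _ := [SubChoice_isSubLmodule of subalgebra by <:].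

Fact sub_lie_subproof (x y : subalgebra) :
  lie (\val x) (\val y) \in subalgebra_pred.
Proof.
by apply/subalgebra_predP/subalgebra_lie; apply/subalgebra_predP/subalgebra_valP.
Qed.

Definition sub_lie (x y : subalgebra) : subalgebra :=
  Subalgebra (sub_lie_subproof x y).

Fact sub_lie_linearl y : linear (sub_lie ^~ y).
Proof.
move=> a x x'; apply: val_inj.
rewrite [RHS](linearP (\val : subalgebra -> L)) /=.
have /= -> := linearP (\val : subalgebra -> L) a x x'.
exact: lie_linearl.
Qed.

Fact sub_lie_linearr x : linear (sub_lie x).
Proof.
move=> a y y'; apply: val_inj.
rewrite [RHS](linearP (\val : subalgebra -> L)) /=.
have /= -> := linearP (\val : subalgebra -> L) a y y'.
exact: lie_linearr.
Qed.

Fact sub_liexx x : sub_lie x x = 0.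
Proof.
by apply: val_inj; rewrite [RHS](linear0 (\val : subalgebra -> L)) /= liexx.
Qed.

Fact sub_lie_jacobi x y z :
  sub_lie x (sub_lie y z) + sub_lie y (sub_lie z x) + sub_lie z (sub_lie x y) = 0.
Proof.
apply: val_inj; rewrite [RHS](linear0 (\val : subalgebra -> L)).
rewrite (linearD (\val : subalgebra -> L)) (linearD (\val : subalgebra -> L)) /=.
exact: lie_jacobi.
Qed.

HB.instance Definition _ := Lmodule_isLieAlgebra.Build K subalgebra
  sub_lie_linearl sub_lie_linearr sub_liexx sub_lie_jacobi.

End Subalgebra.

(* The Lie algebra s (x) K[t], where s has basis u, v, w and brackets
   [u, v] = w, [v, w] = eps u, [w, u] = v; the triple (P, Q, T) stands for
   u (x) P + v (x) Q + w (x) T. *)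
Definition s_current (K : fieldType) (eps : K) : Type :=
  ({poly K} * {poly K} * {poly K})%type.

Section N1.
Variables (K : fieldType) (eps : K).
Local Notation s_current := (s_current eps).

HB.instance Definition _ := GRing.Lmodule.copy s_current
  ({poly K} * {poly K} * {poly K})%type.

Definition s_lie (x y : s_current) : s_current :=
  let: (P1, Q1, T1) := x in let: (P2, Q2, T2) := y in
  (eps *: (Q1 * T2 - T1 * Q2), T1 * P2 - P1 * T2, P1 * Q2 - Q1 * P2).

Fact s_lie_linearl y : linear (s_lie ^~ y).
Proof.
case: y => [[P Q] T] a [[P1 Q1] T1] [[P2 Q2] T2] /=.
congr (_, _, _) => /=; rewrite -!mul_polyC; ring.
Qed.

Fact s_lie_linearr x : linear (s_lie x).
Proof.
case: x => [[P Q] T] a [[P1 Q1] T1] [[P2 Q2] T2] /=.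
congr (_, _, _) => /=; rewrite -!mul_polyC; ring.
Qed.

Fact s_liexx x : s_lie x x = 0.
Proof.
by case: x => [[P Q] T]; congr (_, _, _) => /=; rewrite -?mul_polyC; ring.
Qed.

Fact s_lie_jacobi x y z :
  s_lie x (s_lie y z) + s_lie y (s_lie z x) + s_lie z (s_lie x y) = 0.
Proof.
move: x y z => [[P1 Q1] T1] [[P2 Q2] T2] [[P3 Q3] T3].
by congr (_, _, _) => /=; rewrite -!mul_polyC; ring.
Qed.

HB.instance Definition _ := Lmodule_isLieAlgebra.Build K s_current
  s_lie_linearl s_lie_linearr s_liexx s_lie_jacobi.

Definition n1_gens : set s_current :=
  [set x | exists k : nat,
     [\/ x = ('X^(2 * k + 1), 0, 0), x = (0, 'X^(2 * k + 1), 0)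
       | x = (0, 0, 'X^(2 * k + 2))]].

Fact n1_gens_lie (x y : s_current) :
  n1_gens x -> n1_gens y -> lin_span n1_gens (lie x y).
Proof.
have [S0 SD] := lin_span_subspace n1_gens.
have SZ a z : n1_gens z -> lin_span n1_gens (a *: z).
  by move=> nz; rewrite -[_ *: _]addr0; apply: SD => //; apply: sub_lin_span.
have Su a k : lin_span n1_gens (a *: 'X^(2 * k + 1), 0, 0).
  have := SZ a ('X^(2 * k + 1), 0, 0) (ex_intro _ k (Or31 _ _ erefl)).
  by congr (lin_span _ (_, _, _)); rewrite ?scaler0.
have Sv a k : lin_span n1_gens (0, a *: 'X^(2 * k + 1), 0).
  have := SZ a (0, 'X^(2 * k + 1), 0) (ex_intro _ k (Or32 _ _ erefl)).
  by congr (lin_span _ (_, _, _)); rewrite ?scaler0.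
have Sw a k : lin_span n1_gens (0, 0, a *: 'X^(2 * k + 2)).
  have := SZ a (0, 0, 'X^(2 * k + 2)) (ex_intro _ k (Or33 _ _ erefl)).
  by congr (lin_span _ (_, _, _)); rewrite ?scaler0.
have o k l : (2 * k + 1 + (2 * l + 2) = 2 * (k + l + 1) + 1)%N.
  by rewrite !mulnDr addnACA -!addnA.
have o' k l : (2 * k + 2 + (2 * l + 1) = 2 * (k + l + 1) + 1)%N.
  by rewrite addnC o (addnC l).
have e k l : (2 * k + 1 + (2 * l + 1) = 2 * (k + l) + 2)%N.
  by rewrite mulnDr addnACA.
move=> [k [->|->|->]] [l [->|->|->]];
  rewrite /lie /= ?(mul0r, mulr0, subr0, sub0r, oppr0, scaler0, addr0); try exact: S0.
- by rewrite -exprD e -[X in (_, _, X)]scale1r; apply: Sw.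
- by rewrite -exprD o -scaleN1r; apply: Sv.
- by rewrite -exprD e -scaleN1r; apply: Sw.
- by rewrite -exprD o; apply: Su.
- by rewrite -exprD o' -[X in (_, X, _)]scale1r; apply: Sv.
- by rewrite scalerN -scaleNr -exprD o'; apply: Su.
Qed.

Definition n1_subalgebra : lieSubalgebra s_current :=
  LieSubalgebra (lin_span_subspace n1_gens) (lin_span_lie n1_gens_lie).

Definition n1 : lieAlgType K := subalgebra n1_subalgebra.

End N1.

(* L (x)_R R[i] = L (+) iL; the pair (x, y) stands for x + iy. *)
Section Complexification.
Variables (R : rcfType) (L : lieAlgType R).
Local Open Scope complex_scope.

Definition complexification : Type := (L * L)%type.

HB.instance Definition _ := GRing.Zmodule.on complexification.

Definition cscale (c : R[i]) (p : complexification) : complexification :=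
  let: a +i* b := c in (a *: p.1 - b *: p.2, a *: p.2 + b *: p.1).

Definition clie (p q : complexification) : complexification :=
  (lie p.1 q.1 - lie p.2 q.2, lie p.1 q.2 + lie p.2 q.1).

Fact cscaleA c d p : cscale c (cscale d p) = cscale (c * d) p.
Proof.
have rot (A B C D : L) : A + B + (C + D) = A + D + (B + C).
  by rewrite -!addrA; congr (_ + _); rewrite addrA addrC.
case: c d p => [a b] [c d] [x y]; congr (_, _);
  by rewrite /= !(scalerBr, scalerDr, scalerBl, scalerDl, scalerA, opprD) rot.
Qed.

Fact cscale1 : left_id 1 cscale.
Proof. by case=> x y; rewrite /cscale /= !scale1r !scale0r subr0 addr0. Qed.

Fact cscaleDr : right_distributive cscale +%R.
Proof.
case=> a b [x y] [x' y']; congr (_, _); rewrite /= !scalerDr ?opprD.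
  by rewrite addrACA.
by rewrite addrACA.
Qed.

Fact cscaleDl p : {morph cscale^~ p : c d / c + d}.
Proof.
move: p => [x y] [a b] [c d]; congr (_, _); rewrite /= !scalerDl ?opprD.
  by rewrite addrACA.
by rewrite addrACA.
Qed.

HB.instance Definition _ := GRing.Zmodule_isLmodule.Build R[i] complexification
  cscaleA cscale1 cscaleDr cscaleDl.

Fact clie_linearl q : linear (clie ^~ q).
Proof.
have H (A B C D E F : L) :
    A + B + C + (D + E + F) = A + D + (E + B) + (C + F).
  by rewrite addrACA [X in X + _]addrACA (addrC B).
move: q => [u v] [a b] [x y] [x' y']; congr (_, _);
  by rewrite /= !(lieDl, lieNl, lieZl, scalerDr, scalerN, opprD) H.
Qed.

Fact clie_linearr p : linear (clie p).
Proof.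
have C q : clie p q = - clie q p.
  case: p q => [x y] [u v]; rewrite /clie /=.
  by congr (_, _); rewrite /= (lieC x) (lieC y) ?opprD // addrC.
by move=> a q r; rewrite C clie_linearl opprD -scalerN -!C.
Qed.

Fact cliexx p : clie p p = 0.
Proof.
by congr (_, _); rewrite /= ?liexx ?subrr // lieC addNr.
Qed.

Fact clie_jacobi p q r :
  clie p (clie q r) + clie q (clie r p) + clie r (clie p q) = 0.
Proof.
move: p q r => [p1 p2] [q1 q2] [r1 r2]; congr (_, _);
  rewrite /= !(linearD, linearN) /= ?opprD.
  rewrite (AC ((2*2)*(2*2)*(2*2)) ((1*5*9)*(2*8*11)*(3*6*12)*(4*7*10))) /=.
  by rewrite -!opprD !lie_jacobi oppr0 !addr0.
rewrite (AC ((2*2)*(2*2)*(2*2)) ((1*6*11)*(2*7*9)*(3*5*10)*(4*8*12))) /=.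
by rewrite -!opprD !lie_jacobi oppr0 !addr0.
Qed.

HB.instance Definition _ := Lmodule_isLieAlgebra.Build R[i] complexification
  clie_linearl clie_linearr cliexx clie_jacobi.

End Complexification.

Variant real_label :=
  | Rn1plus | Rn1minus | Rn2 | Rn23 | Rm0
  | Rm0S (A : oddSet) (_ : A !=set0).

Definition real_algebra (R : realType) (k : real_label) : lieAlgType R :=
  match k with
  | Rn1plus => n1 1
  | Rn1minus => n1 (-1)
  | Rn2 => n2 R
  | Rn23 => n23 R
  | Rm0 => m0 R
  | @Rm0S A _ => m0S R A
  end.

Variant complex_label :=
  | Cn1 | Cn2 | Cn23 | Cm0
  | Cm0S (A : oddSet) (_ : A !=set0).

Definition complex_algebra (R : realType) (k : complex_label) : lieAlgType R[i] :=
  match k with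
  | Cn1 => complexification (n1 (1 : R))
  | Cn2 => n2 R[i]
  | Cn23 => n23 R[i]
  | Cm0 => m0 R[i]
  | @Cm0S A _ => m0S R[i] A
  end.

(* Main.v *)
(* Let [w] span [g_2].  The map [(x, y) |-> [x, [y, w]]] is a symmetric form on
   [g_1].  If it is nondegenerate (with one-dimensional values), its
   diagonalisation [diag(1, eps)] gives the defining relations of n_1, whose
   other brackets follow by induction on the degree.  Otherwise [g_1] is spanned
   by some [X] and [a] with [[a, [X, a]]] central; put [e_(n+2) = ad_X^n a] and
   [c_n = [a, e_(n+2)]].  If all [c_n] are central, they are the elements [z_r]
   of m_0^S up to sign.  If [c_n] is the first noncentral one, then [n] is odd,
   and after adding a multiple of [a] to [X] the sequence [e] stops one step
   later; comparing two expressions of [[a, ad_X^k c_n]] shows that this kills a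
   component [g_i] unless [n = 3].  For [n = 3], all brackets of weight [N] of
   n_2 are determined by Jacobi identities with [e_1] and [e_2], except at the
   weights 5 and 7 of the Serre relations, and the former relation may fail by a
   central element.

   The algebras are told apart by the centrality of [[L, L], [L, L]], by the
   identity [[[x, [x, [x, y]]], [x, y]] = 0] of three-dimensional cross
     products,
   by their centers, by elements with [ad(x)^3 = 0], and by the layers of the
   lower central series that contain new central elements. *)
Require Import Defs.
From HB Require Import structures.
From mathcomp Require Import all_boot all_order all_algebra.
From mathcomp Require Import finmap.
From mathcomp.multinomials Require Import monalg.
From mathcomp Require Import complex ring lra zify.
From mathcomp Require Import boolp classical_sets reals.

Set Implicit Arguments.
Unset Strict Implicit.
Unset Printing Implicit Defensive.

Import Order.TTheory GRing.Theory Num.Theory.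

Local Open Scope classical_set_scope.
Local Open Scope ring_scope.
Local Open Scope complex_scope.

(** * Linear combinations and bases *)

(** Algebras are recognised through tables of structure constants: a basis with the expected
    brackets is built in L, and two algebras with the same table are isomorphic. This works over
    every field of characteristic 0; the real and complex lists differ only because the parameter
    eps of n_1 counts modulo squares. Infinite dimension serves to show that no component vanishes.
    The bound dim g_i + dim g_(i+1) <= 3 gives finite dimensional components, two generators, and
    above all that one of two neighbouring components lies in a line; this is applied in degrees 3,
    4 and then n + 2, n + 3, where n is the index of the first noncentral c_n. The obstacle for n_2
    is that each weight N carries its own linear system of Jacobi identities. Those with e_1 and e_2
    express every bracket of weight N by [e_1, e_(N-1)] and [e_2, e_(N-2)]. That these two are
    proportional takes a few identities depending on N modulo 8, except when 8 divides N: there the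
    recursion is followed up to the index N - 1. *)

Section ModuleEquality.
Variables (K : fieldType) (V : lmodType K).

Inductive mexp :=
  | MVar of nat | MZero | MAdd of mexp & mexp | MOpp of mexp
  | MScale of K & mexp.

Fixpoint meval (env : seq V) e : V :=
  match e with
  | MVar i => nth 0 env i
  | MZero => 0
  | MAdd e f => meval env e + meval env f
  | MOpp e => - meval env e
  | MScale k e => k *: meval env e
  end.

(** The comparison is [eqn] rather than [==] so that [cbn] reduces the coefficients to plain ring
    expressions in [module_coefs]. *)
Fixpoint mcoef (i : nat) e : K :=
  match e with
  | MVar j => if eqn i j then 1 else 0
  | MZero => 0
  | MAdd e f => mcoef i e + mcoef i f
  | MOpp e => - mcoef i e
  | MScale k e => k * mcoef i e
  end.

Lemma mevalE env e :
  meval env e = \sum_(i < size env) mcoef i e *: nth 0 env i.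
Proof.
elim: e => [j||e IHe f IHf|e IHe|k e IHe] /=.
- case: (ltnP j (size env)) => [lj|gj].
    rewrite (bigD1 (Ordinal lj)) //= -[eqn j j]/(j == j) eqxx scale1r.
    rewrite big1 ?addr0 // => i; rewrite -val_eqE -[eqn i j]/(val i == j) /=.
    by move=> /negPf->; rewrite scale0r.
  rewrite nth_default // big1 // => i _; rewrite -[eqn i j]/(val i == j).
  by rewrite ltn_eqF ?scale0r // (leq_trans (ltn_ord i)).
- by rewrite big1 // => i _; rewrite scale0r.
- by rewrite IHe IHf -big_split; apply: eq_bigr => i _; rewrite scalerDl.
- by rewrite IHe -sumrN; apply: eq_bigr => i _; rewrite scaleNr.
- by rewrite IHe scaler_sumr; apply: eq_bigr => i _; rewrite scalerA.
Qed.

Fixpoint mcoefs_eq (n : nat) e f : Prop :=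
  if n is n'.+1 then mcoef n' e = mcoef n' f /\ mcoefs_eq n' e f else True.

Lemma meval_eq env e f : mcoefs_eq (size env) e f -> meval env e = meval env f.
Proof.
rewrite !mevalE; elim: (size env) (nth 0 env) => [|n IHn] v /=.
  by rewrite !big_ord0.
by case=> enf Hn; rewrite !big_ord_recr /= enf IHn.
Qed.

(** One step of a proof by linear combination: [k] times a known equation is added to the goal. Once
    all the equations have been used, [module] checks that an identity remains. *)
Lemma lincomb (k : K) (u v x y : V) :
  u = v -> x = y + k *: (u - v) -> x = y.
Proof. by move=> ->; rewrite subrr scaler0 addr0. Qed.

End ModuleEquality.

Arguments lincomb {K V} k {u v x y}.

Ltac mod_index x env :=
  lazymatch env with
  | x :: _ => constr:(O)
  | _ :: ?env' => let n := mod_index x env' in constr:(S n)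
  end.

(** The inner [match] backtracks: if [mod_index] fails, [t] is a new atom and is added to [env]. *)
Ltac mod_atoms env t :=
  lazymatch t with
  | 0 => env
  | ?u + ?v => let env' := mod_atoms env u in mod_atoms env' v
  | - ?u => mod_atoms env u
  | _ *: ?u => mod_atoms env u
  | _ => match env with
         | _ => let n := mod_index t env in env
         | _ => constr:(t :: env)
         end
  end.

Ltac mod_reify K env t :=
  lazymatch t with
  | 0 => constr:(@MZero K)
  | ?u + ?v => let e := mod_reify K env u in let f := mod_reify K env v in
               constr:(@MAdd K e f)
  | - ?u => let e := mod_reify K env u in constr:(@MOpp K e)
  | ?k *: ?u => let e := mod_reify K env u in constr:(@MScale K k e)
  | _ => let n := mod_index t env in constr:(@MVar K n)
  end.

(* Proves an equality of linear combinations in a module by comparing the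
   coefficients of its atoms with [ring]. *)
Ltac module_coefs :=
  lazymatch goal with
  | |- @eq ?T ?s ?t =>
    let env0 := constr:(@nil T) in
    let env1 := mod_atoms env0 s in
    let env := mod_atoms env1 t in
    let H := constr:(fun e f => @meval_eq _ _ env e f) in
    lazymatch type of H with
    | forall e : mexp ?K, _ =>
      let e := mod_reify K env s in
      let f := mod_reify K env t in
      apply: (@meval_eq _ _ env e f)
    end
  end; cbn [size mcoefs_eq mcoef eqn]; repeat (apply: conj); try exact: Logic.I.

Ltac module := module_coefs; try (by []); ring.

Section LieIso.
Variable K : fieldType.
Implicit Types L M N : lieAlgType K.

Lemma lie_iso_sym L M : lie_iso L M -> lie_iso M L.
Proof.
move=> [f [[g fK gK] fM]].
have g_lin : linear g.
  by move=> a x y; apply: (can_inj fK); rewrite gK linearP !gK.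
pose gL := GRing.isLinear.Build K M L *:%R g g_lin.
pose G : {linear M -> L} := HB.pack g gL.
exists G; split; first by exists f.
by move=> x y; apply: (can_inj fK); rewrite fM /= !gK.
Qed.

Lemma lie_iso_trans L M N : lie_iso L M -> lie_iso M N -> lie_iso L N.
Proof.
move=> [f [fb fM]] [g [gb gM]]; exists (g \o f)%FUN.
by split=> [|x y] /=; [apply: bij_comp | rewrite fM gM].
Qed.

Lemma lie_suml L (I : Type) (s : seq I) (F : I -> L) y :
  lie (\sum_(i <- s) F i) y = \sum_(i <- s) lie (F i) y.
Proof.
rewrite lieC linear_sum -sumrN; apply: eq_bigr => i _.
by rewrite [RHS]lieC.
Qed.

Lemma lie_sumr L (I : Type) (s : seq I) (F : I -> L) y :
  lie y (\sum_(i <- s) F i) = \sum_(i <- s) lie y (F i).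
Proof. exact: linear_sum. Qed.

End LieIso.

Section Bases.
Variables (K : fieldType) (V : lmodType K) (I : choiceType) (b : I -> V).

Definition independent := forall (s : seq I) (c : I -> K), uniq s ->
  \sum_(i <- s) c i *: b i = 0 -> forall i, i \in s -> c i = 0.

Definition ext (m : {malg K[I]}) : V := \sum_(i <- msupp m) m@_i *: b i.

Definition spanning := forall x, exists m, x = ext m.

Lemma extEw (A : {fset I}) m :
  (msupp m `<=` A)%fset -> ext m = \sum_(i <- A) m@_i *: b i.
Proof.
move=> sA; apply: big_fset_incl sA _ => i _ /mcoeff_outdom->.
by rewrite scale0r.
Qed.

Lemma ext_linear : linear ext.
Proof.
move=> a m m'; pose A := (msupp m `|` msupp m' `|` msupp (a *: m + m'))%fset.
have s1 : (msupp m `<=` A)%fset.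
  by apply: fsubset_trans (fsubsetUl _ _); apply: fsubsetUl.
have s2 : (msupp m' `<=` A)%fset.
  by apply: fsubset_trans (fsubsetUl _ _); apply: fsubsetUr.
have s3 : (msupp (a *: m + m') `<=` A)%fset by apply: fsubsetUr.
rewrite (extEw s1) (extEw s2) (extEw s3) scaler_sumr -big_split /=.
by apply: eq_bigr => i _; rewrite mcoeffD mcoeffZ scalerDl scalerA.
Qed.

HB.instance Definition _ := GRing.isLinear.Build K _ _ *:%R ext ext_linear.

Lemma extU i : ext << i >> = b i.
Proof. by rewrite /ext msuppU oner_eq0 big_seq_fset1 mcoeffUU scale1r. Qed.

Lemma ext_bij : spanning -> independent -> bijective ext.
Proof.
move=> sb fb.
have inj : injective ext.
  apply: raddf_inj => m m0; apply/malgP => i; rewrite mcoeff0.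
  have [im|/mcoeff_outdom//] := boolP (i \in msupp m).
  exact: fb (fset_uniq _) m0 i im.
have sur x : exists m, ext m == x by have [m ->] := sb x; exists m.
exists (fun x => xchoose (sur x)) => [m|x].
  by apply: inj; apply/eqP/(xchooseP (sur (ext m))).
by apply/eqP/(xchooseP (sur x)).
Qed.

End Bases.

Section TableBases.
Variables (K : fieldType) (I : choiceType) (t : I -> I -> {malg K[I]}).

(** [t] is a bare function rather than a [lieTable]: its identities are inherited from [L], so no
    Jacobi identity has to be checked for [n1_table]. *)
Definition has_table (L : lieAlgType K) : Prop := exists b : I -> L,
  [/\ spanning b, independent b & forall i j, lie (b i) (b j) = ext b (t i j)].

Lemma ext_table_lie (L : lieAlgType K) (b : I -> L) m m' :
  (forall i j, lie (b i) (b j) = ext b (t i j)) ->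
  ext b (table_lie t m m') = lie (ext b m) (ext b m').
Proof.
move=> bt; rewrite linear_sum lie_suml; apply: eq_bigr => i _.
rewrite linear_sum lie_sumr; apply: eq_bigr => j _.
by rewrite linearZ /= -bt lieZl linearZ /= scalerA mulrC.
Qed.

Lemma has_table_iso (L M : lieAlgType K) :
  has_table L -> has_table M -> lie_iso L M.
Proof.
move=> [b [sb fb bt]] [b' [sb' fb' bt']].
have [g gK Kg] := ext_bij sb fb.
have g_lin : linear g.
  by move=> a x y; apply: (can_inj gK); rewrite Kg linearP /= !Kg.
pose gL := GRing.isLinear.Build K L {malg K[I]} *:%R g g_lin.
pose G : {linear L -> {malg K[I]}} := HB.pack g gL.
exists (ext b' \o G)%FUN; split.
  by apply: bij_comp (ext_bij sb' fb') _; exists (ext b).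
move=> x y; rewrite /= -{1}(Kg x) -{1}(Kg y) -(ext_table_lie _ _ bt) gK.
exact: ext_table_lie.
Qed.

End TableBases.

Lemma table_algebra_has_table (K : fieldType) (I : choiceType)
  (t : lieTable K I) : has_table t (table_algebra t).
Proof.
have fr : independent (fun i : I => << i >> : {malg K[I]}).
  move=> s c us s0 i si; have := congr1 (mcoeff i) s0.
  rewrite mcoeff0 raddf_sum /= (bigD1_seq i) //= mcoeffZ mcoeffUU mulr1.
  rewrite big1 ?addr0 // => j /negPf ji; rewrite mcoeffZ mcoeffU ji mulr0 //.
exists (fun i : I => << i >> : {malg K[I]}); split=> // [x|i j].
  by exists x; apply: malg_ZE.
by rewrite /lie /= table_lieUU {1}[t i j]malg_ZE.
Qed.

(** * Graded Lie algebras with two generators *)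

Section Combinations.
Variables (K : fieldType) (V : lmodType K).
Implicit Types A B : set V.

Lemma subspaceD A x y : subspace A -> A x -> A y -> A (x + y).
Proof. by case=> _ AD Ax Ay; rewrite -[x]scale1r; apply: AD. Qed.

Lemma subspaceZ A a x : subspace A -> A x -> A (a *: x).
Proof. by case=> A0 AD Ax; rewrite -[_ *: _]addr0; apply: AD. Qed.

Lemma subspaceN A x : subspace A -> A x -> A (- x).
Proof. by move=> sA Ax; rewrite -scaleN1r; apply: subspaceZ. Qed.

Lemma subspace_sum A (I : eqType) (s : seq I) (P : pred I) (F : I -> V) :
  subspace A -> (forall i, i \in s -> P i -> A (F i)) ->
  A (\sum_(i <- s | P i) F i).
Proof.
move=> sA AF; rewrite big_seq_cond; apply: big_ind => [|x y|i].
- by case: sA.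
- exact: subspaceD.
- by move=> /andP[]; apply: AF.
Qed.

Definition line A := exists e, forall x, A x -> exists c : K, x = c *: e.

Lemma has_dim_line A d : has_dim A d -> (d <= 1)%N -> line A.
Proof.
case: d => [|[|//]] [e [-> _]] _.
  exists 0 => _ [n [c [u [uA ->]]]]; exists 0; rewrite scaler0 big1 // => i _.
  by have [[]] := uA i.
exists (e ord0) => _ [n [c [u [uA ->]]]]; exists (\sum_(i < n) c i).
rewrite scaler_suml; apply: eq_bigr => i _.
by have [j _ <-] := uA i; rewrite (ord1 j).
Qed.

Lemma line_dependent A x y : line A -> A x -> A y -> x != 0 ->
  exists c : K, y = c *: x.
Proof.
move=> [e Ae] /Ae[a ->] /Ae[c ->]; rewrite scaler_eq0 negb_or => /andP[a0 _].
by exists (c / a); rewrite scalerA divfK.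
Qed.

(** A dependent spanning family is shortened by a vector that the others express, until it is a
    basis. *)
Lemma has_dim_of_span (s : seq V) :
  (forall x, lin_span [set y | y \in s] x) -> exists d, has_dim [set: V] d.
Proof.
have [n] := ubnP (size s); elim: n s => // n IHn s /ltnSE sn span_s.
pose e (i : 'I_(size s)) := nth 0 s i.
have es i : e i \in s by apply: mem_nth.
have se : [set: V] = lin_span (range e).
  apply/seteqP; split=> // x _; apply: lin_span_min (span_s x).
    exact: lin_span_subspace.
  move=> y ys; apply: sub_lin_span.
  have iy : (index y s < size s)%N by rewrite index_mem.
  by exists (Ordinal iy) => //; apply: nth_index.
have [fe|] := pselect (forall c : 'I_(size s) -> K,
    \sum_(i < size s) c i *: e i = 0 -> forall i, c i = 0).
  by exists (size s), e.
move/existsNP => [c] /not_implyP[c0] /existsNP[i /eqP ci].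
pose s' := [seq e j | j <- enum 'I_(size s) & j != i].
have ej j : j != i -> lin_span [set y | y \in s'] (e j).
  by move=> ji; apply/sub_lin_span/map_f; rewrite mem_filter ji mem_enum.
apply: (IHn s').
  have : (size [seq j <- enum 'I_(size s) | j != i] < size s)%N.
    rewrite -[X in (_ < X)%N](size_enum_ord (size s)) size_filter ltn_neqAle.
    rewrite count_size andbT -all_count; apply/allPn; exists i.
      by rewrite mem_enum.
    by rewrite /= eqxx.
  by rewrite size_map => /leq_trans; apply.
move=> x; apply: lin_span_min (span_s x); first exact: lin_span_subspace.
move=> y ys; have iy : (index y s < size s)%N by rewrite index_mem.
have <- : e (Ordinal iy) = y by apply: nth_index.
have [->|/ej//] := eqVneq (Ordinal iy) i.
have -> : e i = \sum_(j < size s | j != i) (- (c i)^-1 * c j) *: e j.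
  move: c0; rewrite (bigD1 i) //= => /(canRL (addrK _)).
  rewrite sub0r => /(congr1 ( *:%R (c i)^-1)).
  rewrite scalerA mulVf // scale1r => ->; rewrite -scaleN1r scalerA.
  rewrite scaler_sumr; apply: eq_bigr => j _; rewrite scalerA; congr (_ *: _).
  by rewrite mulrN1.
apply: subspace_sum => [|j _ ji]; first exact: lin_span_subspace.
by apply: subspaceZ; [apply: lin_span_subspace | apply: ej].
Qed.

Variables (I : choiceType) (b : I -> V).

Definition combs (s : seq I) : set V :=
  [set x | exists c : I -> K, x = \sum_(i <- s) c i *: b i].

Lemma combs_subspace s : subspace (combs s).
Proof.
split; first by exists (fun=> 0); rewrite big1 // => i _; rewrite scale0r.
move=> a _ _ [c ->] [d ->]; exists (fun i => a * c i + d i).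
rewrite scaler_sumr -big_split; apply: eq_bigr => i _.
by rewrite scalerDl scalerA.
Qed.

Lemma combs_mem s i : uniq s -> i \in s -> combs s (b i).
Proof.
move=> us si; exists (fun j => (j == i)%:R); rewrite (bigD1_seq i) //= eqxx.
by rewrite scale1r big1 ?addr0 // => j /negPf->; rewrite scale0r.
Qed.

Lemma ext_combs s x : combs s x -> exists m, x = ext b m.
Proof.
move=> [c ->]; exists (\sum_(i <- s) c i *: << i >>); rewrite linear_sum.
by apply: eq_bigr => i _; rewrite linearZ /= extU.
Qed.

End Combinations.

Definition central (K : fieldType) (L : lieAlgType K) (y : L) :=
  forall x, lie x y = 0.

Section Graded.
Variables (K : fieldType) (L : lieAlgType K) (g : nat -> set L).
Hypothesis g_graded : N_grading g.

Lemma g_subspace i : (0 < i)%N -> subspace (g i).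
Proof. by case: g_graded => [[+ _ _] _]; apply. Qed.

Lemma g_lie i j x y : (0 < i)%N -> (0 < j)%N -> g i x -> g j y ->
  g (i + j)%N (lie x y).
Proof.
move=> i0 j0 gx gy; have [_ H] := g_graded; apply: (H _ _ i0 j0).
by apply: sub_lin_span; exists x => //; exists y.
Qed.

Lemma g_ind (P : set L) : subspace P ->
  (forall i x, (0 < i)%N -> g i x -> P x) -> forall x, P x.
Proof.
move=> sP gP x; have [[_ dec _] _] := g_graded.
have [n [c [gc ->]]] := dec x.
by apply: subspace_sum => // i; rewrite mem_index_iota => /andP[i0 _] _;
  apply: (gP i); auto.
Qed.

Section GradedBasis.
Variables (I : choiceType) (b : I -> L) (deg : I -> nat) (D : nat -> seq I).
Hypothesis D_uniq : forall n, uniq (D n).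
Hypothesis D_deg : forall n i, (i \in D n) = (deg i == n).
Hypothesis deg_gt0 : forall i, (0 < deg i)%N.

Lemma graded_spanning :
  (forall n, (0 < n)%N -> g n `<=` combs b (D n)) -> spanning b.
Proof.
move=> gD; apply: g_ind => [|n x n0 /(gD n n0)/ext_combs//].
split; first by exists 0; rewrite linear0.
by move=> a _ _ [m ->] [m' ->]; exists (a *: m + m'); rewrite linearP.
Qed.

Lemma graded_independent : (forall i, g (deg i) (b i)) ->
  (forall n c, (0 < n)%N -> \sum_(i <- D n) c i *: b i = 0 ->
     forall i, i \in D n -> c i = 0) ->
  independent b.
Proof.
move=> gb indD s c us s0.
pose F n := \sum_(i <- s | deg i == n) c i *: b i.
have gF n : (0 < n)%N -> g n (F n).
  move=> n0; apply: subspace_sum => [|i _ /eqP<-]; first exact: g_subspace.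
  by apply: subspaceZ => //; apply: g_subspace.
pose N := (\max_(i <- s) deg i).+1.
have sumF : \sum_(1 <= n < N) F n = 0.
  rewrite -[RHS]s0 (exchange_big_dep predT) //= [RHS]big_seq [LHS]big_seq.
  apply: eq_bigr => i si; rewrite (big_rem (deg i)) /=; last first.
    by rewrite mem_index_iota deg_gt0 ltnS leq_bigmax_seq.
  rewrite eqxx big1_seq ?addr0 // => n /andP[/eqP<-].
  by rewrite mem_rem_uniqF ?iota_uniq.
have [[_ _ indg] _] := g_graded.
move=> i si; have iN : (0 < deg i < N)%N by rewrite deg_gt0 ltnS leq_bigmax_seq.
have := indg N F gF sumF _ iN.
(* The coefficients are extended by 0 from [s] to the whole degree, since [indD] speaks of all of
   [D (deg i)]. *)
have -> : F (deg i) = \sum_(j <- D (deg i)) (if j \in s then c j else 0) *: b j.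
  rewrite /F [RHS](bigID (fun j => j \in s)) /= [X in _ = _ + X]big1 ?addr0;
    last first.
    by move=> j /negPf->; rewrite scale0r.
  transitivity (\sum_(j <- D (deg i) | j \in s) c j *: b j); last first.
    by apply: eq_bigr => j ->.
  rewrite -big_filter -[RHS]big_filter; apply: perm_big; apply: uniq_perm.
  - exact: filter_uniq.
  - exact: filter_uniq.
  - by move=> j; rewrite !mem_filter D_deg andbC.
move=> /(indD _ (fun j => if j \in s then c j else 0) (deg_gt0 i))/(_ i).
by rewrite si D_deg eqxx => /(_ isT).
Qed.

End GradedBasis.

Hypothesis g_gen :
  forall i, (0 < i)%N -> lie_product (g 1%N) (g i) = g i.+1.

Lemma g_succ_sub (i : nat) (P : set L) : (0 < i)%N -> subspace P ->
  (forall x y, g 1%N x -> g i y -> P (lie x y)) -> g i.+1 `<=` P.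
Proof.
move=> i0 sP H; rewrite -g_gen //; apply: lin_span_min => // _ [x gx [y gy <-]].
exact: H.
Qed.

Lemma gen_ind (P : set L) : subspace P -> g 1%N `<=` P ->
  (forall x y, g 1%N x -> P y -> P (lie x y)) -> forall x, P x.
Proof.
move=> sP P1 PM; apply: g_ind => // i x; elim: i x => // -[|i] IHi x _.
  exact: P1.
by apply: g_succ_sub => // {}x y gx /IHi Py; apply: PM => //; apply: Py.
Qed.

Lemma gen_combs (I : choiceType) (b : I -> L) (D : nat -> seq I) :
  g 1%N `<=` combs b (D 1%N) ->
  (forall n i j, (0 < n)%N -> i \in D 1%N -> j \in D n ->
     combs b (D n.+1) (lie (b i) (b j))) ->
  forall n, (0 < n)%N -> g n `<=` combs b (D n).
Proof.
move=> g1 bD; elim=> // -[|n] IHn _ //.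
have sC s := combs_subspace b s.
apply: g_succ_sub => // x y /g1[c ->] /(IHn isT)[d ->].
rewrite lie_suml; apply: subspace_sum => // i iD _; rewrite lie_sumr.
apply: subspace_sum => // j jD _; rewrite lieZl linearZ.
by do 2 apply: subspaceZ => //; apply: bD.
Qed.

Hypothesis L_inf : infinite_dimensional L.
Hypothesis g_width : forall i, (0 < i)%N -> exists d d' : nat,
  [/\ has_dim (g i) d, has_dim (g i.+1) d' & (d + d' <= 3)%N].

(** As everything is generated in degree 1, a zero component makes all later ones zero, and L would
    be spanned by bases of the finitely many earlier ones. *)
Lemma g_neq0 n : (0 < n)%N -> exists2 x, g n x & x != 0.
Proof.
move=> n0; have [//|gn0] := pselect (exists2 x, g n x & x != 0); exfalso.
have gz m x : (n <= m)%N -> g m x -> x = 0.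
  elim: m x => [|m IHm] x; first by rewrite leqn0 => /eqP n00; rewrite n00 in
    n0.
  rewrite leq_eqVlt => /predU1P[<- gx|nm].
    by apply: contrapT => /eqP x0; apply: gn0; exists x.
  apply: (@g_succ_sub _ [set x | x = 0]); first exact: leq_trans n0 nm.
    by split=> // a {}x y -> ->; rewrite scaler0 addr0.
  by move=> {}x y _ /(IHm _ nm)->; rewrite linear0.
have [s gs] : exists s : seq L, forall i, (0 < i < n)%N ->
    g i `<=` lin_span [set y | y \in s].
  elim: (n) => [|m [s IHm]]; first by exists [::] => i; rewrite ltn0 andbF.
  have [->|m0] := posnP m; first by exists [::] => i; rewrite ltnS; case: i.
  have [d [_ [[e [gm _]] _ _]]] := g_width m0.
  exists (s ++ codom e) => i /andP[i0]; rewrite ltnS leq_eqVlt =>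
    /predU1P[->|im].
    rewrite gm; apply: lin_span_min; first exact: lin_span_subspace.
    by move=> _ [j _ <-]; apply: sub_lin_span; rewrite /= mem_cat codom_f orbT.
  move=> x /(IHm i); rewrite i0 im => /(_ isT).
  apply: lin_span_min; first exact: lin_span_subspace.
  by move=> y ys; apply: sub_lin_span; rewrite /= mem_cat ys.
have [|d] := @has_dim_of_span _ L s; last exact: L_inf.
apply: g_ind; first exact: lin_span_subspace.
move=> i x i0 gx; have [lt_in|ni] := ltnP i n; first by apply: (gs i); rewrite
  ?i0.
by rewrite (gz i x) //; case: (lin_span_subspace [set y | y \in s]).
Qed.

Lemma g_line i : (0 < i)%N -> line (g i) \/ line (g i.+1).
Proof.
move=> i0; have [d [d' [gd gd' dd']]] := g_width i0.
have [d1|d1] := leqP d 1; first by left; apply: has_dim_line gd _.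
right; apply: has_dim_line gd' _; lia.
Qed.

(** Independence of [x] and [y] is not part of the definition, so a smaller [g 1] may at first be
    padded with 0; it follows afterwards from [gen_lie_neq0]. *)
Definition generators (x y : L) :=
  forall u, g 1%N u <-> exists a c : K, u = a *: x + c *: y.

Lemma generators_exist : exists x y, generators x y.
Proof.
have [d [d' [[e [g1 _]] gd' dd']]] := g_width (ltn0Sn 0).
(* With [d = 3] the width would force [g 2] to be zero. *)
have d2 : (d <= 2)%N.
  rewrite leqNgt; apply/negP => d3; have [x gx /eqP[]] := g_neq0 (ltn0Sn 1).
  have d'0 : d' = 0%N by lia.
  have [f [g2 _]] := gd'; subst d'; move: gx; rewrite g2 => -[n [c [u [uA
    ->]]]].
  by rewrite big1 // => i _; have [[]] := uA i.
have g1P u : g 1%N u <-> exists c : 'I_d -> K, u = \sum_(i < d) c i *: e i.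
  rewrite g1; split; last first.
    move=> [c ->]; apply: subspace_sum => [|i _ _]; first exact:
      lin_span_subspace.
    by apply: subspaceZ; [apply: lin_span_subspace|apply: sub_lin_span; exists
      i].
  apply: (lin_span_min (B := [set u | exists c, u = \sum_(i < d) c i *: e i])).
    split; first by exists (fun=> 0); rewrite big1 // => i _; rewrite scale0r.
    move=> a _ _ [c ->] [c' ->]; exists (fun i => a * c i + c' i).
    rewrite scaler_sumr -big_split; apply: eq_bigr => i _.
    by rewrite scalerDl scalerA.
  move=> _ [i _ <-]; exists (fun j => (j == i)%:R); rewrite (bigD1 i) //= eqxx.
  by rewrite scale1r big1 ?addr0 // => j /negPf->; rewrite scale0r.
case: d => [|[|[|//]]] in e g1 dd' d2 g1P *.
- exists 0, 0 => u; rewrite g1P; split=> [[c ->]|[a [c ->]]].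
    by exists 0, 0; rewrite big_ord0 !scaler0 addr0.
  by exists (fun=> 0); rewrite big_ord0 !scaler0 addr0.
- exists (e ord0), 0 => u; rewrite g1P; split=> [[c ->]|[a [c ->]]].
    by exists (c ord0), 0; rewrite big_ord1 scaler0 addr0.
  by exists (fun=> a); rewrite big_ord1 scaler0 addr0.
- exists (e ord0), (e ord_max) => u; rewrite g1P; split=> [[c ->]|[a [c ->]]].
    by exists (c ord0), (c ord_max); rewrite big_ord_recl big_ord1 -(_ :
      ord_max = lift ord0 ord0) //; apply: val_inj.
  exists (fun i => if i == ord0 then a else c); rewrite big_ord_recl big_ord1
    /=.
  by rewrite -(_ : ord_max = lift ord0 ord0) //; apply: val_inj.
Qed.

Section Generators.
Variables x y : L.
Hypothesis xy_gen : generators x y.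

Lemma gen_l : g 1%N x.
Proof. by apply/xy_gen; exists 1, 0; rewrite scale1r scale0r addr0. Qed.

Lemma gen_r : g 1%N y.
Proof. by apply/xy_gen; exists 0, 1; rewrite scale1r scale0r add0r. Qed.

Lemma gen_succ (i : nat) (P : set L) : (0 < i)%N -> subspace P ->
  (forall z, g i z -> P (lie x z)) -> (forall z, g i z -> P (lie y z)) ->
  g i.+1 `<=` P.
Proof.
move=> i0 sP Px Py; apply: g_succ_sub => // _ z /xy_gen[a [c ->]] gz.
by rewrite lieDl !lieZl; apply: subspaceD => //; apply: subspaceZ; auto.
Qed.

Lemma gen_g2 : g 2%N `<=` [set u | exists c, u = c *: lie x y].
Proof.
have sP : subspace [set u | exists c, u = c *: lie x y].
  split; first by exists 0; rewrite scale0r.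
  by move=> a _ _ [c ->] [d ->]; exists (a * c + d); rewrite scalerDl scalerA.
apply: gen_succ => // z /xy_gen[a [c ->]].
  by exists c; rewrite linearD !linearZ /= liexx scaler0 add0r.
by exists (- a); rewrite linearD !linearZ /= liexx scaler0 addr0 (lieC y)
  scalerN scaleNr.
Qed.

Lemma gen_lie_neq0 : lie x y != 0.
Proof.
apply/eqP => xy0; have [z /gen_g2[c ->]] := g_neq0 (ltn0Sn 1).
by rewrite xy0 scaler0 eqxx.
Qed.

(** By the Jacobi identity the centralizer of [z] is closed under brackets, so it is everything once
    it contains both generators. *)
Lemma centralP z : lie x z = 0 -> lie y z = 0 -> central z.
Proof.
move=> xz yz; apply: gen_ind.
- split; first by rewrite lieC linear0 oppr0.
  by move=> a u v /= uz vz; rewrite lieDl lieZl uz vz scaler0 addr0.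
- by move=> _ /xy_gen[a [c ->]]; rewrite /= lieDl !lieZl xz yz !scaler0 addr0.
- move=> u v /xy_gen[a [c def_u]] /= vz.
  have uz : lie u z = 0 by rewrite def_u lieDl !lieZl xz yz !scaler0 addr0.
  have := lie_jacobi u v z; rewrite vz linear0 add0r (lieC z u) uz oppr0
    linear0.
  by rewrite add0r lieC => /eqP; rewrite oppr_eq0 => /eqP.
Qed.

End Generators.
End Graded.

(** * The algebras n_1 *)

Section LieIdentities.
Variables (K : fieldType) (L : lieAlgType K).
Implicit Types x y z : L.

Lemma lie_der x y z : lie x (lie y z) = lie (lie x y) z + lie y (lie x z).
Proof.
have := lie_jacobi x y z; rewrite (lieC z x) linearN (lieC z (lie x y)) /= => J.
apply: (lincomb 1 J); module.
Qed.

Lemma lieA x y z : lie (lie x y) z = lie x (lie y z) - lie y (lie x z).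
Proof. by rewrite lie_der addrK. Qed.

Lemma lieDr x y z : lie x (y + z) = lie x y + lie x z.
Proof. exact: linearD. Qed.

Lemma lieNr x y : lie x (- y) = - lie x y.
Proof. exact: linearN. Qed.

Lemma lieZr a x y : lie x (a *: y) = a *: lie x y.
Proof. exact: linearZ. Qed.

Lemma lie0r x : lie x 0 = 0.
Proof. exact: linear0. Qed.

Lemma lie0l x : lie 0 x = 0.
Proof. by rewrite lieC linear0 oppr0. Qed.

End LieIdentities.

Lemma int_neq0 (K : fieldType) (z : int) :
  [pchar K] =i pred0 -> z != 0 -> z%:~R != 0 :> K.
Proof.
move=> /pcharf0P K0; case: z => n n0; first by rewrite -[_%:~R]/(n%:R) K0.
by rewrite NegzE mulrNz oppr_eq0 -[_%:~R]/(n.+1%:R) K0.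
Qed.

Lemma natr_inj (K : fieldType) : [pchar K] =i pred0 ->
  injective (fun n : nat => n%:R : K).
Proof.
move=> /pcharf0P K0 m n; wlog mn : m n / (m <= n)%N => [H|] emn.
  by have [/H|/ltnW/H] := leqP m n; [apply | move=> ->].
apply/eqP; rewrite eqn_leq mn -subn_eq0 -K0 natrB // emn subrr eqxx //.
Qed.

Section CurrentTable.
Variables (K : fieldType) (eps : K).

(* [inl (inl k)], [inl (inr k)] and [inr k] index u (x) t^(2k+1),
   v (x) t^(2k+1) and w (x) t^(2k+2). *)
Definition n1_index : choiceType := (nat + nat + nat)%type.

Definition n1_table (i j : n1_index) : {malg K[n1_index]} :=
  match i, j with
  | inl (inl p), inl (inr q) => << inr (p + q)%N >>
  | inl (inr p), inl (inl q) => - << inr (p + q)%N >>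
  | inr p, inl (inl q) => << inl (inr (p + q).+1) >>
  | inl (inl p), inr q => - << inl (inr (p + q).+1) >>
  | inl (inr p), inr q => eps *: << inl (inl (p + q).+1) >>
  | inr p, inl (inr q) => - (eps *: << inl (inl (p + q).+1) >>)
  | _, _ => 0
  end.

Definition n1_family (V : lmodType K) (u v w : nat -> V) (i : n1_index) : V :=
  match i with inl (inl k) => u k | inl (inr k) => v k | inr k => w k end.

Lemma n1_family_table (L : lieAlgType K) (u v w : nat -> L) :
  (forall p q, lie (u p) (u q) = 0) -> (forall p q, lie (v p) (v q) = 0) ->
  (forall p q, lie (w p) (w q) = 0) ->
  (forall p q, lie (u p) (v q) = w (p + q)%N) ->
  (forall p q, lie (w p) (u q) = v (p + q).+1) ->
  (forall p q, lie (v p) (w q) = eps *: u (p + q).+1) ->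
  forall i j, lie (n1_family u v w i) (n1_family u v w j) =
    ext (n1_family u v w) (n1_table i j).
Proof.
move=> uu vv ww uv wu vw [[p|p]|p] [[q|q]|q] /=;
  rewrite ?linear0 ?linearN ?linearZ /= ?extU //=.
- by rewrite lieC wu addnC.
- by rewrite lieC uv addnC.
- by rewrite lieC vw addnC scalerN.
Qed.

Hypothesis eps0 : eps != 0.
Hypothesis K0 : [pchar K] =i pred0.

(** Meant for the brackets of one weight: [a], [b], [c] will be [u_i, u_j], [v_i, v_j], [w_i, w_j],
    tied together by Jacobi identities. The first relation makes [c] affine in its index; the
    antisymmetry conditions at the two ends then kill first the slope and next the common value of
    [a] and [b]. *)
Lemma cyclic_affine_eq0 (V : lmodType K) (k : nat) (a b c : nat -> V) :
  (0 < k)%N ->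
  (forall p q, (p + q <= k)%N -> a (p + q).+1 = b p + c q) ->
  (forall p q, (p + q <= k)%N -> b (p + q).+1 = c p + a q) ->
  c k = - c 0%N -> a k.+1 = - a 0%N ->
  [/\ forall i, (i <= k.+1)%N -> a i = 0, forall i, (i <= k.+1)%N -> b i = 0
    & forall i, (i <= k)%N -> c i = 0].
Proof.
move=> k0 R1 R2 ck ak.
have cS q : (q < k)%N -> c q.+1 = c q + (b 1%N - b 0%N).
  move=> qk; have := R1 1%N q; rewrite add1n => /(_ qk) h1.
  have := R1 0%N q.+1; rewrite add0n h1 => /(_ qk) h2.
  apply: (lincomb (-1) h2); module.
have cE q : (q <= k)%N -> c q = c 0%N + q%:R *: (b 1%N - b 0%N).
  elim: q => [|q IHq] qk; first by module.
  by rewrite cS // IHq ?(ltnW qk) // -[q.+1]addn1 natrD; module.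
have r1 := R1 0%N 0%N isT; have r2 := R2 0%N 0%N isT.
have r3 := R1 1%N 0%N k0; have r4 := R2 1%N 0%N k0.
have r5 := R1 0%N 1%N k0; have r6 := R2 0%N 1%N k0.
rewrite ?(add0n, addn0) in r1 r2 r3 r4 r5 r6.
(* The two expressions of b_2, reduced by those of a_1, b_1 and c_1, differ by twice this
   equation. *)
have c0 : c 0%N = b 1%N - b 0%N.
  have two : (2%:R : K) != 0 by rewrite (pcharf0P _).1.
  apply: (scalerI two); apply: (lincomb (-1) r6); apply: (lincomb 1 r4).
  apply: (lincomb 1 (cS 0%N k0)).
  apply: (lincomb (-1) r1).
  apply: (lincomb (-1) r2); module.
(* With d the slope, c_k = (k + 1) d, so c_k = - c_0 reads (k + 2) d = 0. *)
have d0 : b 1%N - b 0%N = 0.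
  have two : ((k + 2)%:R : K) != 0 by rewrite (pcharf0P _).1 // addn2.
  apply: (scalerI two); rewrite scaler0.
  have := ck; rewrite cE // c0 => h; apply: (lincomb 1 h).
  by rewrite natrD; module.
have cz i : (i <= k)%N -> c i = 0.
  by move=> /cE->; rewrite c0 d0 scaler0 addr0.
have aE i : (i <= k)%N -> a i.+1 = b 0%N.
  by move=> ik; rewrite -[i in LHS]add0n R1 ?add0n // cz // addr0.
have bE i : (i <= k)%N -> b i.+1 = a 0%N.
  by move=> ik; rewrite -[i in LHS]addn0 R2 ?addn0 // cz // add0r.
have b0a0 : b 0%N = a 0%N by rewrite -(bE 0%N) //; apply/esym/subr0_eq.
have a0 : a 0%N = 0.
  have two : (2%:R : K) != 0 by rewrite (pcharf0P _).1.
  apply: (scalerI two); move: ak; rewrite aE // b0a0 => h.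
  by apply: (lincomb 1 h); module.
split=> [[|i]|[|i]|] //.
- by move=> ik; rewrite aE // b0a0.
- by rewrite b0a0.
- by move=> ik; rewrite bE.
Qed.

Section Brackets.
Variables (L : lieAlgType K) (u v w : nat -> L).
Hypothesis wE : forall k, lie (u 0%N) (v k) = w k.
Hypothesis vE : forall k, lie (w k) (u 0%N) = v k.+1.
Hypothesis uE : forall k, lie (v 0%N) (w k) = eps *: u k.+1.
Hypothesis uu1 : lie (u 0%N) (u 1%N) = 0.
Hypothesis vv1 : lie (v 0%N) (v 1%N) = 0.
Hypothesis uv1 : lie (u 1%N) (v 0%N) = w 1%N.

(** Induction over even weights. Giving u_p and v_p weight 2p + 1 and w_p weight 2p + 2, the four
    statements cover the weights up to 2k + 2, whence the strict bound for [w]. Brackets of odd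
    weight follow from them; writing one factor as a bracket then links those of the next even
    weight into the system of [cyclic_affine_eq0]. *)
Lemma n1_brackets_upto k :
  [/\ forall p q, (p + q <= k)%N -> lie (u p) (u q) = 0,
      forall p q, (p + q <= k)%N -> lie (v p) (v q) = 0,
      forall p q, (p + q <= k)%N -> lie (u p) (v q) = w (p + q)%N
    & forall p q, (p + q < k)%N -> lie (w p) (w q) = 0].
Proof.
elim: k => [|k [uu vv uv ww]].
  by split=> [[|p] [|q]|[|p] [|q]|[|p] [|q]|] //; rewrite ?liexx.
have wu p q : (p + q <= k)%N -> lie (w p) (u q) = v (p + q).+1.
  move=> pqk; rewrite -wE lieA (uu 0%N q) ?(leq_trans _ pqk) ?leq_addl //.
  by rewrite linear0 subr0 (lieC (v p)) uv 1?addnC // linearN -lieC vE.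
have vw p q : (p + q <= k)%N -> lie (v p) (w q) = eps *: u (p + q).+1.
  move=> pqk; have := uv q 0%N; rewrite addn0 => <-; last first.
    by rewrite (leq_trans _ pqk) ?leq_addl.
  rewrite lie_der (vv p 0%N) ?addn0 ?(leq_trans _ pqk) ?leq_addr //.
  by rewrite linear0 addr0 (lieC (v p)) uv 1?addnC // lieNl -lieC uE.
have uvS p q : (p + q <= k)%N -> lie (u p) (v q.+1) = w (p + q).+1.
  move=> pqk; rewrite -vE lie_der (uu p 0%N); last first.
    by rewrite addn0 (leq_trans _ pqk) ?leq_addr.
  by rewrite linear0 addr0 (lieC (u p)) wu 1?addnC // lieNl -lieC wE.
(* Weight 4 is too small for the cyclic system and is supplied by [uu1], [vv1] and [uv1]. *)
have [k0|k0] := posnP k.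
  have le1 (p q : nat) : (p + q <= k.+1)%N ->
      p = 0%N /\ q = 0%N \/ p = 0%N /\ q = 1%N \/ p = 1%N /\ q = 0%N by lia.
  split=> p q pq.
  - by case: (le1 _ _ pq) => [|[]][-> ->]; rewrite ?liexx // lieC uu1 oppr0.
  - by case: (le1 _ _ pq) => [|[]][-> ->]; rewrite ?liexx // lieC vv1 oppr0.
  - by case: (le1 _ _ pq) => [|[]][-> ->].
  - have [-> ->] : p = 0%N /\ q = 0%N by lia.
    exact: liexx.
(* The factor [eps] gives both cyclic relations unit coefficients. *)
pose a i := eps *: lie (u i) (u (k.+1 - i)%N).
pose b i := lie (v i) (v (k.+1 - i)%N).
pose c i := lie (w i) (w (k - i)%N).
have R1 p q : (p + q <= k)%N -> a (p + q).+1 = b p + c q.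
  move=> pqk; rewrite /a subSS -lieZl -vw // lieA wu; last by lia.
  rewrite (lieC (v p) (u _)) uv; last by lia.
  rewrite linearN opprK /b /c; congr (lie _ (v _) + lie _ (w _)); lia.
have R2 p q : (p + q <= k)%N -> b (p + q).+1 = c p + a q.
  move=> pqk; rewrite /b subSS -wu // lieA uv; last by lia.
  rewrite (lieC (w p) (v _)) vw; last by lia.
  rewrite linearN opprK linearZ /a /c.
  congr (lie _ (w _) + _ *: lie _ (u _)); lia.
have ck : c k = - c 0%N by rewrite /c subnn subn0 lieC.
have ak : a k.+1 = - a 0%N by rewrite /a subnn subn0 lieC scalerN.
have [az bz cz] := cyclic_affine_eq0 k0 R1 R2 ck ak.
split=> p q; rewrite leq_eqVlt ?ltnS.
- case/predU1P=> [pqk|]; last exact: uu.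
  apply: (scalerI eps0); rewrite scaler0 -(az p); last by lia.
  by rewrite /a -pqk addKn.
- case/predU1P=> [pqk|]; last exact: vv.
  by rewrite -(bz p) /b -?pqk ?addKn ?leq_addr.
- case/predU1P=> [|]; last exact: uv.
  case: q => [|q]; last by rewrite !addnS => -[pqk]; apply: uvS; rewrite pqk.
  rewrite addn0 => ->; apply: (scalerI eps0).
  have := vw k 0%N; rewrite addn0 leqnn => /(_ isT); rewrite -lieZl => <-.
  rewrite lieA (vv k 0%N) ?addn0 // linear0 subr0 (lieC (w 0%N)) uE linearN
    linearZ /=.
  case: (k) k0 uvS => // k' _ uvS.
  by rewrite (lieC (v _)) uvS ?addn1 // add1n scalerN opprK.
- case/predU1P=> [[pqk]|]; last exact: ww.
  by rewrite -(cz p) /c -?pqk ?addKn ?leq_addr.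
Qed.

Lemma n1_brackets i j :
  lie (n1_family u v w i) (n1_family u v w j) =
  ext (n1_family u v w) (n1_table i j).
Proof.
have H p q := n1_brackets_upto (p + q).+1.
have le p q : (p + q <= (p + q).+1)%N by [].
have uu p q : lie (u p) (u q) = 0 by have [+ _ _ _] := H p q; apply.
have uv p q : lie (u p) (v q) = w (p + q)%N by have [_ _ + _] := H p q; apply.
have vv p q : lie (v p) (v q) = 0 by have [_ + _ _] := H p q; apply.
apply: n1_family_table => // p q.
- by have [_ _ _] := H p q; apply.
- rewrite -wE lieA uu linear0 subr0 (lieC (v p)) uv addnC.
  by rewrite linearN -lieC vE.
- rewrite -(addn0 q) -uv lie_der vv linear0 addr0 addn0 (lieC (v p)) uv addnC.
  by rewrite lieNl -lieC uE.
Qed.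

End Brackets.
End CurrentTable.

Definition n1_deg (i : n1_index) : nat :=
  match i with inl (inl k) | inl (inr k) => k.*2.+1 | inr k => k.*2.+2 end.

Definition n1_deg_seq (n : nat) : seq n1_index :=
  if odd n then [:: inl (inl n./2); inl (inr n./2)]
  else if n is m.+2 then [:: inr m./2] else [::].

Lemma n1_deg_seq_uniq n : uniq (n1_deg_seq n).
Proof. by rewrite /n1_deg_seq; case: ifP => // _; case: n => [|[|n]]. Qed.

Lemma n1_deg_seqP n i : (i \in n1_deg_seq n) = (n1_deg i == n).
Proof.
apply/idP/eqP; rewrite /n1_deg_seq.
  case: ifP => n_odd; first by rewrite !inE => /orP[] /eqP-> /=; lia.
  by case: n n_odd => [|[|n]] //= n_odd; rewrite inE => /eqP-> /=; lia.
case: i => [[k|k]|k] /= <-; rewrite /= odd_double /= ?uphalf_double ?doubleK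
  !inE eqxx ?orbT //.
Qed.

Section N1Recognition.
Variables (K : fieldType) (L : lieAlgType K) (g : nat -> set L).
Hypotheses (K0 : [pchar K] =i pred0) (g_graded : N_grading g).
Hypothesis g_gen :
  forall i, (0 < i)%N -> lie_product (g 1%N) (g i) = g i.+1.
Hypothesis L_inf : infinite_dimensional L.
Hypothesis g_width : forall i, (0 < i)%N -> exists d d' : nat,
  [/\ has_dim (g i) d, has_dim (g i.+1) d' & (d + d' <= 3)%N].

(** [W], [V] and [U] are defined by the recursion that [wE], [vE] and [uE] demand, so only the three
    brackets of weight 4 remain to be derived from the hypotheses. *)
Lemma n1_recognition (eps : K) (u v : L) : eps != 0 -> generators g u v ->
  lie u (lie (lie u v) v) = 0 ->
  lie v (lie (lie u v) v) = eps *: lie u (lie (lie u v) u) ->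
  has_table (n1_table eps) L.
Proof.
move=> eps0 uv_gen B12 B22.
pose W k := iter k (fun x => lie u (lie x u)) (lie u v).
pose V k := if k is k'.+1 then lie (W k') u else v.
pose U k := if k is k'.+1 then eps^-1 *: lie v (W k') else u.
have wE k : lie (U 0%N) (V k) = W k by case: k.
have vE k : lie (W k) (U 0%N) = V k.+1 by [].
have uE k : lie (V 0%N) (W k) = eps *: U k.+1.
  by rewrite /= scalerA divff // scale1r.
have uu1 : lie (U 0%N) (U 1%N) = 0.
  by rewrite /= linearZ /= (lieC v) linearN /= B12 oppr0 scaler0.
have vv1 : lie (V 0%N) (V 1%N) = 0.
  have := lie_jacobi u v (lie u v); rewrite liexx addr0.
  by rewrite (lieC v (lie u v)) linearN /= B12 oppr0 add0r.
have uv1 : lie (U 1%N) (V 0%N) = W 1%N.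
  rewrite /= lieZl (lieC v (lie u v)) lieNl -lieC B22 scalerA mulVf //.
  by rewrite scale1r.
have br := n1_brackets eps0 K0 wE vE uE uu1 vv1 uv1.
pose b := n1_family U V W.
have gu := gen_l uv_gen; have gv := gen_r uv_gen.
have gb i : g (n1_deg i) (b i).
  have gW k : g k.*2.+2 (W k).
    elim: k => [|k IHk]; first exact: (g_lie g_graded (ltn0Sn 0) (ltn0Sn 0)).
    have -> : k.+1.*2.+2 = (1 + (k.*2.+2 + 1))%N by lia.
    have k1 : (0 < k.*2.+2 + 1)%N by lia.
    exact: (g_lie g_graded (ltn0Sn 0) k1 gu (g_lie g_graded (ltn0Sn _) (ltn0Sn
      0) IHk gu)).
  case: i => [[[|k]|[|k]]|k] //=; rewrite doubleS.
    apply: subspaceZ; first exact: (g_subspace g_graded).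
    exact: (g_lie g_graded (ltn0Sn 0) (ltn0Sn _) gv (gW k)).
  by rewrite -addn1; apply: (g_lie g_graded).
have cD i : combs b (n1_deg_seq (n1_deg i)) (b i).
  by apply: combs_mem; rewrite ?n1_deg_seq_uniq ?n1_deg_seqP.
have gD n : (0 < n)%N -> g n `<=` combs b (n1_deg_seq n).
  apply: (gen_combs g_gen) => [x /uv_gen[a [c ->]]|{}n i j n0].
    apply: subspaceD; [exact: combs_subspace|..];
      (apply: subspaceZ; first exact: combs_subspace).
      exact: (cD (inl (inl 0%N))).
    exact: (cD (inl (inr 0%N))).
  rewrite !n1_deg_seqP /b br => i1 /eqP<-.
  have [C0 _] := combs_subspace b (n1_deg_seq (n1_deg j).+1).
  have C k a : n1_deg k = (n1_deg j).+1 ->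
      combs b (n1_deg_seq (n1_deg j).+1) (a *: b k).
    by move=> <-; apply: subspaceZ; [apply: combs_subspace|apply: cD].
  have C1 k : n1_deg k = (n1_deg j).+1 ->
      combs b (n1_deg_seq (n1_deg j).+1) (b k).
    by move=> /(C _ 1); rewrite scale1r.
  have CN k : n1_deg k = (n1_deg j).+1 ->
      combs b (n1_deg_seq (n1_deg j).+1) (- b k).
    by move=> /(C _ (-1)); rewrite scaleN1r.
  case: i i1 => [[[|//]|[|//]]|//] _; case: j n0 C0 C C1 CN => [[k|k]|k] _ C0
    C C1 CN /=;
    rewrite ?linear0 ?linearN ?linearZ /= ?extU //.
  - exact: (C1 (inr k)).
  - by apply: (CN (inl (inr k.+1))); rewrite /= doubleS.
  - exact: (CN (inr k)).
  - by apply: (C (inl (inl k.+1))); rewrite /= doubleS.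
have W0 k : W k != 0.
  have [x gx x0] := g_neq0 g_graded g_gen L_inf g_width (ltn0Sn k.*2.+1).
  have [c xE] := gD _ (ltn0Sn _) x gx.
  rewrite /n1_deg_seq /= odd_double /= doubleK big_seq1 in xE.
  by apply: contraNneq x0 => W0; rewrite xE /= W0 scaler0.
exists b; split => //.
  apply: (graded_spanning g_graded) gD.
apply: (graded_independent g_graded n1_deg_seq_uniq n1_deg_seqP _ gb).
  by case=> [[k|k]|k].
move=> n c n0; rewrite /n1_deg_seq.
case: ifP => n_odd; last first.
  case: n n0 n_odd => [|[|n]] //= _ _; rewrite big_seq1 /= => /eqP.
  by rewrite scaler_eq0 (negPf (W0 _)) orbF => /eqP cn i; rewrite inE => /eqP->.
set k := n./2; rewrite big_cons big_seq1 /= => cuv.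
(* In odd degree, [lie u] and [lie v] turn a relation x U + y V = 0 into y W = 0 and - x W = 0. *)
have uU : lie u (U k) = 0 by have /= := br (inl (inl 0%N)) (inl (inl k));
  rewrite linear0.
have uV : lie u (V k) = W k by have /= := br (inl (inl 0%N)) (inl (inr k));
  rewrite extU.
have vV : lie v (V k) = 0 by have /= := br (inl (inr 0%N)) (inl (inr k));
  rewrite linear0.
have vU : lie v (U k) = - W k by have /= := br (inl (inr 0%N)) (inl (inl k));
  rewrite linearN /= extU.
have := congr1 (lie u) cuv; rewrite linearD !linearZ /= uU uV !linear0 add0r.
move=> /eqP; rewrite scaler_eq0 (negPf (W0 k)) orbF => /eqP cv.
have := congr1 (lie v) cuv; rewrite linearD !linearZ /= vU vV !linear0 addr0.
move=> /eqP; rewrite scaler_eq0 oppr_eq0 (negPf (W0 k)) orbF => /eqP cu i.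
by rewrite !inE => /orP[] /eqP->.
Qed.

End N1Recognition.

(** * The symmetric form on degree one *)

Section FirstStep.
Variables (K : fieldType) (L : lieAlgType K) (g : nat -> set L).
Hypotheses (K0 : [pchar K] =i pred0) (g_graded : N_grading g).
Hypothesis g_gen :
  forall i, (0 < i)%N -> lie_product (g 1%N) (g i) = g i.+1.
Hypothesis L_inf : infinite_dimensional L.
Hypothesis g_width : forall i, (0 < i)%N -> exists d d' : nat,
  [/\ has_dim (g i) d, has_dim (g i.+1) d' & (d + d' <= 3)%N].

Lemma generatorsC (x y : L) : generators g x y -> generators g y x.
Proof.
by move=> gxy u; rewrite gxy; split=> -[a [c ->]]; exists c, a; rewrite addrC.
Qed.

Lemma generators_change (x y : L) a c : c != 0 ->
  generators g x y -> generators g x (a *: x + c *: y).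
Proof.
move=> c0 gxy u; rewrite gxy; split=> -[d [e ->]].
  exists (d - e / c * a), (e / c); rewrite scalerDr !scalerA divfK //.
  module.
exists (d + e * a), (e * c); module.
Qed.

(** Gram-Schmidt for the form with entries [a], [b], [c]: the vector - b p + a q is orthogonal to
    [p], and the determinant a c - b^2 becomes [eps]. *)
Lemma nondegenerate_n1 (p q e : L) (a b c : K) : generators g p q ->
  lie p (lie p (lie p q)) = a *: e -> lie p (lie q (lie p q)) = b *: e ->
  lie q (lie q (lie p q)) = c *: e -> a != 0 -> a * c != b ^+ 2 ->
  exists2 eps, eps != 0 & has_table (n1_table eps) L.
Proof.
move=> gpq B11 B12 B22 a0 acb.
(* Symmetry of the form: with w = [p, q], exchanging [p] and [q] costs [[q, p], w] = - [w, w] =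
   0. *)
have B21 : lie q (lie p (lie p q)) = b *: e.
  by rewrite lie_der (lieC q p) lieNl liexx oppr0 add0r.
exists (a * c - b ^+ 2); first by rewrite subr_eq0.
have uv : lie p (- b *: p + a *: q) = a *: lie p q.
  by rewrite linearD !linearZ /= liexx scaler0 add0r.
apply: (n1_recognition K0 g_graded g_gen L_inf g_width (u := p)
          (v := - b *: p + a *: q)); rewrite ?subr_eq0 //.
- exact: generators_change.
- rewrite uv lieZl linearZ /= (lieC (lie p q)) linearN lieDl !lieZl linearD
  !linearZ /=.
  by rewrite B11 B12; module.
- rewrite uv !lieZl !linearZ /= !(lieC (lie p q)) !linearN /= !(lieDl, lieZl)
  !(linearD, linearZ) /=.
  by rewrite B11 B12 B22 B21; module.
Qed.

Lemma first_step :
  (exists X a : L, generators g X a /\ central (lie a (lie X a))) \/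
  (exists2 eps, eps != 0 & has_table (n1_table eps) L).
Proof.
have [p [q gpq]] := generators_exist g_graded g_gen L_inf g_width.
have gp := gen_l gpq; have gq := gen_r gpq.
have gw : g 2%N (lie p q) by apply: (g_lie g_graded (ltn0Sn 0) (ltn0Sn 0)).
have gS n x y : (0 < n)%N -> g 1%N x -> g n y -> g n.+1 (lie x y).
  by move=> n0 gx gy; rewrite -add1n; apply: (g_lie g_graded).
have c0 : central (0 : L) by move=> x; rewrite linear0.
have [[e g3e]|[e g4e]] := g_line g_width (ltn0Sn 2).
  (* As [g 3] lies in a line, some generator commutes with [p, q]; it is the one to be called [a] in
     the statement. *)
  left; have [a pw] := g3e _ (gS _ _ _ (ltn0Sn 1) gp gw).
  have [c qw] := g3e _ (gS _ _ _ (ltn0Sn 1) gq gw).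
  have [cz|cn] := eqVneq c 0; first by exists p, q; rewrite qw cz scale0r.
  exists q, (- a *: q + c *: p); split.
    by apply: generators_change => //; apply: generatorsC.
  rewrite linearD !linearZ /= liexx scaler0 add0r (lieC q) !linearN linearZ /=.
  rewrite lieDl !lieZl pw qw (_ : - _ = 0) //; module.
have [a B11] := g4e _ (gS _ _ _ (ltn0Sn 2) gp (gS _ _ _ (ltn0Sn 1) gp gw)).
have [b B12] := g4e _ (gS _ _ _ (ltn0Sn 2) gp (gS _ _ _ (ltn0Sn 1) gq gw)).
have [c B22] := g4e _ (gS _ _ _ (ltn0Sn 2) gq (gS _ _ _ (ltn0Sn 1) gq gw)).
have B21 : lie q (lie p (lie p q)) = b *: e.
  by rewrite lie_der (lieC q p) lieNl liexx oppr0 add0r.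
have wC : lie q p = - lie p q by rewrite lieC.
have [acb|acb] := eqVneq (a * c) (b ^+ 2).
  (* Degenerate form: the second generator is taken in the radical, so that its bracket with [p, q]
     is killed by both [p] and [q]. *)
  left; have [az|an] := eqVneq a 0.
    have bz : b = 0 by apply/eqP; have /eqP := acb; rewrite az mul0r eq_sym
      expf_eq0.
    exists q, p; split; first exact: generatorsC.
    apply: (centralP g_graded g_gen gpq); rewrite wC !linearN /=.
      by rewrite B11 az scale0r oppr0.
    by rewrite B21 bz scale0r oppr0.
  exists p, (b *: p + - a *: q); split.
    by apply: generators_change => //; rewrite oppr_eq0.
  rewrite linearD !linearZ /= liexx scaler0 add0r.
  apply: (centralP g_graded g_gen gpq); rewrite !linearZ /= lieDl !lieZl
    linearD !linearZ /=.
    by rewrite B11 B12; module.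
  rewrite B21 B22; transitivity ((a * (a * c - b ^+ 2)) *: e); first by module.
  by rewrite acb subrr mulr0 scale0r.
right; have [az|an] := eqVneq a 0; last exact: nondegenerate_n1 B11 B12 B22 an
  acb.
have [cz|cn] := eqVneq c 0; last first.
  apply: (nondegenerate_n1 (generatorsC gpq) (e := e) (a := - c) (b := - b) (c
    := - a)).
  - by rewrite wC !linearN /= B22 scaleNr.
  - by rewrite wC !linearN /= B21 scaleNr.
  - by rewrite wC !linearN /= B11 scaleNr.
  - by rewrite oppr_eq0.
  - by rewrite mulrNN sqrrN mulrC.
(* Both diagonal entries vanish; q + p then has the nonzero value 2 b on the diagonal. *)
have b0 : b != 0 by apply: contraNneq acb => ->; rewrite az mul0r expr0n.
have gpq' : generators g q (1 *: q + 1 *: p).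
  by apply: generators_change; [exact: oner_neq0 | exact: generatorsC].
rewrite !scale1r in gpq'; have := generatorsC gpq' => {}gpq'.
have w' : lie (q + p) q = lie p q by rewrite lieDl liexx add0r.
have two : (2%:R : K) != 0 by rewrite (pcharf0P _).1.
apply: (nondegenerate_n1 gpq' (e := e) (a := 2%:R * b) (b := b) (c := 0)).
- rewrite w' !lieDl !linearD /= B11 B12 B21 B22 az cz; module.
- rewrite w' !lieDl /= B12 B22 cz; module.
- by rewrite w' B22 cz.
- by rewrite mulf_neq0.
- by rewrite mulr0 eq_sym expf_neq0.
Qed.

End FirstStep.

(** * Filiform sequences *)

Section Filiform.
Variables (K : fieldType) (L : lieAlgType K) (g : nat -> set L).
Hypotheses (K0 : [pchar K] =i pred0) (g_graded : N_grading g).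
Hypothesis g_gen :
  forall i, (0 < i)%N -> lie_product (g 1%N) (g i) = g i.+1.
Hypothesis L_inf : infinite_dimensional L.
Hypothesis g_width : forall i, (0 < i)%N -> exists d d' : nat,
  [/\ has_dim (g i) d, has_dim (g i.+1) d' & (d + d' <= 3)%N].

(* [fil X a n] and [fil_c X a n] are e_(n+2) and [e_2, e_(n+2)] for the
   generators e_1 = X and e_2 = a. *)
Definition fil (X a : L) (n : nat) : L := iter n (lie X) a.
Definition fil_c (X a : L) (n : nat) : L := lie a (fil X a n).

Lemma filS (X a : L) n : fil X a n.+1 = lie X (fil X a n).
Proof. by []. Qed.

(** [lie X] passes from one factor to the other with a sign, as long as the brackets met on the way
    commute with [X]. Taking [y := a] gives the brackets of the sequence with itself, and [y := c n]
    those with [c n]. *)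
Lemma fil_move (X a y : L) n :
  (forall k, (k < n)%N -> lie X (lie a (fil X y k)) = 0) ->
  forall p q, (p + q <= n)%N ->
    lie (fil X a p) (fil X y q) = (-1) ^+ p *: lie a (fil X y (p + q)).
Proof.
move=> cn; elim=> [|p IHp] q pq; first by rewrite scale1r.
rewrite [fil X a p.+1]filS lieA IHp ?(ltnW pq) //.
rewrite lieZr cn ?scaler0 ?sub0r; last by rewrite addSn in pq.
rewrite -[lie X (fil X y q)]/(fil X y q.+1) IHp; last by rewrite addnS -addSn.
by rewrite addSnnS exprS mulN1r scaleNr.
Qed.

Section Generators.
Variables X a : L.
Hypothesis Xa_gen : generators g X a.
Local Notation e := (fil X a).
Local Notation c := (fil_c X a).
Local Notation y := (fil X (c _)).

Lemma fil_g n : g n.+1 (e n).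
Proof.
elim: n => [|n IHn]; first exact: gen_r Xa_gen.
by rewrite -add1n; apply: (g_lie g_graded) => //; apply: gen_l Xa_gen.
Qed.

Lemma fil_c_g n : g n.+2 (c n).
Proof.
rewrite -add1n; apply: (g_lie g_graded) => //; first exact: gen_r Xa_gen.
exact: fil_g.
Qed.

Variable n : nat.
Hypothesis c_central : forall k, (k < n)%N -> central (c k).

Lemma fil_lie p q : (p + q <= n)%N -> lie (e p) (e q) = (-1) ^+ p *: c (p + q).
Proof. by apply: fil_move => k /c_central. Qed.

(** Up to sign, [c n] is the middle bracket of [e n./2] with itself. *)
Lemma fil_c_even : ~~ odd n -> c n = 0.
Proof.
move=> n_even; have := @fil_lie n./2 n./2; rewrite addnn even_halfK // liexx.
by move=> /(_ (leqnn n)) /esym/eqP; rewrite scaler_eq0 signr_eq0 => /eqP.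
Qed.

Hypotheses (n_odd : odd n) (n_ge3 : (3 <= n)%N).

(** One weight beyond the first noncentral [c n], each passage of [X] leaves one correction
    [lie X (c n)]. The vanishing of the middle bracket then gives [fil_c_succ]. *)
Lemma fil_lie_succ p q : (p + q = n.+1)%N ->
  lie (e p) (e q) = (-1) ^+ p *: (c n.+1 - p%:R *: lie X (c n)).
Proof.
elim: p q => [|p IHp] q pq; first by rewrite -pq scale0r subr0 scale1r.
rewrite [e p.+1]filS lieA fil_lie; last by lia.
rewrite -[lie X (e q)]/(e q.+1) IHp; last by lia.
have -> : (p + q = n)%N by lia.
by rewrite lieZr -[p.+1]addn1 natrD exprD; module.
Qed.

Lemma fil_c_succ : c n.+1 = (n.+1./2)%:R *: lie X (c n).
Proof.
have := @fil_lie_succ n.+1./2 n.+1./2; rewrite addnn even_halfK ?liexx /=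
  ?n_odd //.
move=> /(_ erefl) /esym/eqP; rewrite scaler_eq0 signr_eq0 subr_eq0.
by move=> /eqP.
Qed.

(** [c n] is the opposite of [lie (e 1) (e n.-1)], and the derivation [lie a] sends both factors to
    central elements. *)
Lemma fil_c_lie : lie a (c n) = 0.
Proof.
have := @fil_lie 1 n.-1; rewrite add1n prednK; last by lia.
move=> /(_ (leqnn n)); rewrite expr1 scaleN1r => H.
rewrite -[c n]opprK -H lieNr lie_der -[lie a (e 1)]/(c 1) -[lie a (e n.-1)]/(c
  n.-1).
rewrite (lieC (c 1)) !c_central ?oppr0 ?add0r ?lie0r ?oppr0 //=; lia.
Qed.

Lemma fil_change t k : (k <= n)%N ->
  fil (X + t *: a) a k.+1 = e k.+1 + t *: c k.
Proof.
elim: k => [|k IHk] kn; first by rewrite /= /fil_c /= lieDl lieZl.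
rewrite [LHS]filS IHk ?(ltnW kn) // lieDl lieZl !lieDr !lieZr.
by rewrite !c_central // !scaler0 !addr0.
Qed.

(** The change adds only multiples of the elements [c j] with [j <= n] to the sequence [e]. All of
    these commute with [a], the noncentral [c n] by [fil_c_lie]. *)
Lemma fil_c_change t k : (k <= n.+1)%N -> fil_c (X + t *: a) a k = c k.
Proof.
case: k => [|k] kn; first by rewrite /fil_c /= !liexx.
rewrite /fil_c fil_change // lieDr lieZr.
move: kn; rewrite leq_eqVlt => /predU1P[[->]|kn]; first by rewrite fil_c_lie
  scaler0 addr0.
by rewrite c_central // scaler0 addr0.
Qed.

Section Stopped.
Hypothesis e_stop : e n.+2 = 0.
Let s := n.+1./2.

Lemma fil_stop_lie p : lie (e p) (e n.+1) = s%:R *: fil X (c n) p.+1.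
Proof.
elim: p => [|p IHp]; first exact: fil_c_succ.
rewrite [e p.+1]filS lieA -[lie X (e n.+1)]/(e n.+2) e_stop lie0r subr0 IHp.
by rewrite lieZr.
Qed.

Lemma fil_stop_lie_pred p :
  lie (e p) (e n) = (1 - (p * s)%:R) *: fil X (c n) p.
Proof.
elim: p => [|p IHp]; first by rewrite mul0n subr0 scale1r.
rewrite [e p.+1]filS lieA -[lie X (e n)]/(e n.+1) fil_stop_lie IHp lieZr.
by rewrite -[lie X _]/(fil X (c n) p.+1) mulSn natrD; module.
Qed.

Lemma fil_stop_eq0 : fil X (c n) n = 0.
Proof.
have := fil_stop_lie_pred n; rewrite liexx => /esym/eqP; rewrite scaler_eq0.
case/orP=> /eqP // /subr0_eq /(natr_inj K0 (x1 := 1)) /esym/eqP.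
by rewrite muln_eq1 => /andP[/eqP n1]; move: n_ge3; rewrite n1.
Qed.

(** Let v be the left side. Applying [lie a] to [e_k, e_n] gives (1 - k s) v by [fil_stop_lie_pred],
    and (-1)^k v by the derivation rule and [fil_move]. Hence v = 0 unless k s is 0 or 2, according
    to the parity of k. With n >= 5 one has s >= 3, which rules this out for k > 0; with n = 3 one
    has s = 2, and k = 1 escapes. *)
Lemma fil_stop_lie0 k : (5 <= n)%N -> (k < n)%N -> lie a (fil X (c n) k) = 0.
Proof.
move=> n5; elim/ltn_ind: k => k IHk kn.
have [->|k0] := posnP k; first exact: fil_c_lie.
have M : lie (e k) (c n) = (-1) ^+ k *: lie a (fil X (c n) k).
  have := @fil_move X a (c n) k _ k 0%N; rewrite addn0; apply => // j jk.
  by rewrite IHk ?lie0r // (ltn_trans jk).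
have := congr1 (lie a) (fil_stop_lie_pred k).
rewrite lieZr lie_der -[lie a (e k)]/(c k) -[lie a (e n)]/(c n) M.
rewrite (lieC (c k)) c_central // oppr0 add0r => /eqP; rewrite -subr_eq0
  -scalerBl.
rewrite scaler_eq0 => /orP[ks|/eqP//].
exfalso; have [ks2 ks3] : (2 <= k * s)%N /\ (odd k -> (3 <= k * s)%N).
  by rewrite /s; split; nia.
have [k_odd|k_even] := boolP (odd k).
  have /(natr_inj K0) ks2' : 2%:R = (k * s)%:R :> K.
    move: ks; rewrite -(signr_odd _ k) k_odd expr1 => /eqP h.
    by rewrite -[RHS]subr0 -h; ring.
  by have := ks3 k_odd; rewrite -ks2'.
have /(natr_inj K0) ks0 : 0%:R = (k * s)%:R :> K.
  move: ks; rewrite -(signr_odd _ k) (negPf k_even) expr0 => /eqP h.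
  by rewrite -[RHS]subr0 -h; ring.
by rewrite -ks0 in ks2.
Qed.

(** Otherwise [X, c_n] spans the component of degree n + 3. As [a] kills what follows, each of the
    next components is spanned by a further power of ad X applied to c_n, and in degree 2n + 2 this
    is ad_X^n c_n = 0, although no component vanishes. *)
Lemma fil_stop_absurd : (5 <= n)%N -> line (g n.+3) -> lie X (c n) = 0.
Proof.
move=> n5 g_ln; apply: contrapT => /eqP x0.
have span k : (k < n)%N ->
    g (n.+3 + k)%N `<=` [set u | exists d, u = d *: fil X (c n) k.+1].
  have sP v : subspace [set u : L | exists d, u = d *: v].
    split; first by exists 0; rewrite scale0r.
    by move=> d _ _ [d1 ->] [d2 ->]; exists (d * d1 + d2); rewrite scalerDl
      scalerA.
  elim: k => [_ u|k IHk kn].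
    rewrite addn0 => gu; apply: (line_dependent g_ln _ gu x0).
    rewrite -add1n; apply: (g_lie g_graded) => //; last exact: fil_c_g.
    exact: gen_l Xa_gen.
  rewrite addnS; apply: (gen_succ g_gen Xa_gen) => // z /(IHk (ltnW kn))[d ->].
    by exists d; rewrite lieZr.
  by exists 0; rewrite lieZr fil_stop_lie0 // scaler0 scale0r.
have [z] := g_neq0 g_graded g_gen L_inf g_width (ltn0Sn (n.+2 + n.-1)).
rewrite -!addSn => /span[|d ->]; first lia.
by rewrite prednK ?fil_stop_eq0 ?scaler0 ?eqxx //; lia.
Qed.

End Stopped.
End Generators.

Lemma noncentral_step (X a : L) : generators g X a -> central (fil_c X a 1) ->
  (forall n, central (fil_c X a n)) \/
  exists X', [/\ generators g X' a, central (fil_c X' a 1),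
    fil_c X' a 2 = 0 & fil X' a 5 = 0].
Proof.
move=> Xa_gen c1.
have [|/existsNP exn] := pselect (forall n, central (fil_c X a n)); first by
  left.
right; have exn' : exists n, ~~ `[< central (fil_c X a n) >].
  by have [n nc] := exn; exists n; apply/asboolP.
case: (ex_minnP exn') => n /asboolP nc min_n.
have cc k : (k < n)%N -> central (fil_c X a k).
  move=> kn; apply/asboolP; apply: contraTT kn => /min_n.
  by rewrite -leqNgt.
have n_odd : odd n.
  apply: contrapT => /negP n_even; apply: nc.
  by rewrite (fil_c_even cc) // => x; rewrite lie0r.
have n3 : (3 <= n)%N.
  by case: n n_odd nc {cc min_n} => [|[|[|n]]].
have ay := fil_c_lie cc n_odd n3.
have x0 : lie X (fil_c X a n) != 0.
  by apply: contra_not_neq nc => xz; apply: (centralP g_graded g_gen Xa_gen).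
have c_succ := fil_c_succ cc n_odd n3.
have s0 : (n.+1./2)%:R != 0 :> K by rewrite (pcharf0P _).1 //; lia.
have gx : g n.+3 (lie X (fil_c X a n)).
  rewrite -add1n; apply: (g_lie g_graded) => //; last exact: fil_c_g.
  exact: gen_l Xa_gen.
have [gl|gl] := g_line g_width (ltn0Sn n.+1).
  (* If [g n.+2] lies in a line, e_(n+1) in the numbering of [fil] is a multiple of c_n, which
     commutes with [a]; then c_(n+1) = 0, against [c_succ]. *)
  have y0 : fil_c X a n != 0 by apply: contraNneq x0 => ->; rewrite lie0r.
  have [d dE] := line_dependent gl (fil_c_g Xa_gen n) (fil_g Xa_gen n.+1) y0.
  move: c_succ; rewrite {1}/fil_c dE lieZr ay scaler0 => /esym/eqP.
  by rewrite scaler_eq0 (negPf s0) (negPf x0).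
have [d dE] := line_dependent gl gx (fil_g Xa_gen n.+2) x0.
have s1 : 1 + (n.+1./2)%:R != 0 :> K by rewrite nat1r (pcharf0P _).1.
(* This [t] cancels the coefficient of [X, c_n] in the new term of index [n.+2], namely d + t (1 +
   s) with s = (n + 1) / 2. *)
pose t := - d / (1 + (n.+1./2)%:R).
have gX' : generators g (X + t *: a) a.
  apply: generatorsC; rewrite addrC -[X in generators _ _ (_ + X)]scale1r.
  by apply: generators_change (oner_neq0 _) _; apply: generatorsC.
have cE k (kn : (k <= n.+1)%N) := fil_c_change cc n_odd n3 t kn.
have X'c : lie (X + t *: a) (fil_c X a n) = lie X (fil_c X a n).
  by rewrite lieDl lieZl ay scaler0 addr0.
have stop : fil (X + t *: a) a n.+2 = 0.
  rewrite [LHS]filS (fil_change cc) // lieDr lieZr X'c lieDl lieZl.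
  rewrite -[lie X (fil X a n.+1)]/(fil X a n.+2) -[lie a _]/(fil_c X a n.+1).
  rewrite c_succ dE.
  transitivity ((d + t * (1 + (n.+1./2)%:R)) *: lie X (fil_c X a n)).
    by module.
  by rewrite divfK // subrr scale0r.
have cc' k : (k < n)%N -> central (fil_c (X + t *: a) a k).
  by move=> kn; rewrite cE; [apply: cc | lia].
have [n5|n5] := leqP 5 n.
  have := fil_stop_absurd gX' cc' n_odd n3 stop n5 gl.
  by rewrite cE // X'c => /eqP; rewrite (negPf x0).
have En : n = 3%N by case: n n5 n3 n_odd {nc min_n cc ay x0 c_succ s0 gx gl d
  dE s1 t gX' cE X'c stop cc'} => [|[|[|[|[|n]]]]].
subst n; exists (X + t *: a); split => //.
- exact: cc'.
- by rewrite cE //; apply: (fil_c_even (n := 2)) => // k k2; apply: cc; lia.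
Qed.

End Filiform.

(** * The algebras m_0^S *)

Section M0STable.
Variables (K : fieldType) (S : oddSet).

Lemma m0S_fun_t0S k :
  m0S_fun K (inl 0%N : m0S_basis S) (inl k.+1) = << inl k.+2 >>.
Proof. by []. Qed.

Lemma m0S_funSS p q : m0S_fun K (inl p.+1 : m0S_basis S) (inl q.+1) =
  (-1) ^+ p.+1 *: m0S_z K S (p + q).+2.
Proof.
rewrite /m0S_fun m0S_bracketE // !addSn !addnS !subSS subn0.
by rewrite !exprS !mulN1r opprK.
Qed.

(** [inl k] stands for e_(k+1). Both generators e_1 and e_2 have degree 1, and z_r = - [e_2, e_r]
    has degree r. *)
Definition m0S_deg (i : m0S_basis S) : nat :=
  match i with inl 0 => 1 | inl k => k | inr r => val r end.

Definition m0S_deg_seq (n : nat) : seq (m0S_basis S) :=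
  match n with
  | 0 => [::]
  | 1 => [:: inl 0%N; inl 1%N]
  | _ => inl n :: (if insub n is Some r then [:: inr r] else [::])
  end.

Lemma oset_ge3 r : r \in oset S -> odd r && (3 <= r)%N.
Proof. by move=> /set_mem/(@oset_odd S). Qed.

Lemma m0S_deg_gt0 i : (0 < m0S_deg i)%N.
Proof.
case: i => [[|k]|[r rS]] //=; have /andP[_] := oset_ge3 rS.
by apply: leq_trans.
Qed.

Lemma m0S_deg_seq_uniq n : uniq (m0S_deg_seq n).
Proof. by case: n => [|[|n]] //=; case: insub. Qed.

Lemma m0S_deg_seqP n i : (i \in m0S_deg_seq n) = (m0S_deg i == n).
Proof.
case: i => [k|r].
  case: n => [|[|n]] //=; first by case: k => [|[|k]].
    by rewrite !inE; case: k => [|[|k]].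
  rewrite inE; case: insub => [s|]; rewrite ?inE ?orbF;
    by case: k => [|k] //=; rewrite -[inl _ == _]/(k.+1 == n.+2) ?orbF.
have := m0S_deg_gt0 (inr r); case: n => [|[|n]] /=.
- by rewrite in_nil; case: (val r).
- rewrite !inE -[inr _ == inl 0%N]/false -[inr _ == inl 1%N]/false /=.
  have /andP[_ r3] := oset_ge3 (valP r); move=> _; apply/esym/negbTE.
  by rewrite neq_ltn (ltnW r3) orbT.
- move=> _; rewrite inE -[inr _ == _]/false /=.
  case: insubP => [s _ sn|nS]; first by rewrite inE -sn.
  by rewrite in_nil; apply/esym/negP => /eqP rn; rewrite -rn (valP r) in nS.
Qed.

End M0STable.

Section M0SRecognition.
Variables (K : fieldType) (L : lieAlgType K) (g : nat -> set L).
Hypotheses (K0 : [pchar K] =i pred0) (g_graded : N_grading g).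
Hypothesis g_gen :
  forall i, (0 < i)%N -> lie_product (g 1%N) (g i) = g i.+1.
Hypothesis L_inf : infinite_dimensional L.
Hypothesis g_width : forall i, (0 < i)%N -> exists d d' : nat,
  [/\ has_dim (g i) d, has_dim (g i.+1) d' & (d + d' <= 3)%N].

Lemma m0S_recognition (X a : L) : generators g X a ->
  (forall n, central (fil_c X a n)) ->
  exists S : oddSet, has_table (@m0S_fun K S) L.
Proof.
move=> Xa_gen cc; pose e := fil X a; pose c := fil_c X a.
have gX := gen_l Xa_gen; have ga := gen_r Xa_gen.
have S_odd : [set r | (2 <= r)%N /\ c (r - 2)%N <> 0] `<=`
    [set r | odd r && (3 <= r)%N].
  move=> r [r2 cr] /=; have ro : odd (r - 2).
    by apply: contrapT => /negP/fil_c_even H; apply/cr/H => k _; apply: cc.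
  lia.
pose S := OddSet S_odd; exists S.
(* The table has [e_2, e_r] = - z_r, and [fil] counts from e_2, whence the sign and the shift by
   2. *)
pose b (i : m0S_basis S) : L :=
  match i with inl 0 => X | inl k.+1 => e k | inr r => - c (val r - 2)%N end.
have bz r : ext b (m0S_z K S r.+2) = - c r.
  rewrite /m0S_z; case: insubP => [s _ sr|]; first by rewrite extU /= sr subSS
    subSS subn0.
  move=> /negP rS; rewrite linear0; apply/esym/eqP; rewrite oppr_eq0.
  apply/eqP; apply: contrapT => cr; apply: rS; rewrite inE /=; split=> //.
  by rewrite !subSS subn0.
have br i j : lie (b i) (b j) = ext b (m0S_fun K i j).
  have cr x r : lie x (- c r) = 0 by rewrite lieNr cc oppr0.
  case: i j => [i|r] [j|r']; rewrite ?[LHS]cr /= ?linear0 ?lieNl //.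
  - case: i j => [|p] [|q].
    + by rewrite liexx linear0.
    + by rewrite [m0S_fun _ _ _]m0S_fun_t0S extU.
    + by rewrite m0S_C m0S_fun_t0S linearN /= extU lieC.
    + rewrite m0S_funSS linearZ /= bz exprS mulN1r scalerN scaleNr opprK.
      by apply: (fil_lie (n := p + q)).
  - by rewrite lieC cc !oppr0.
have gb i : g (m0S_deg i) (b i).
  case: i => [[|k]|[r rS]] //=; first exact: fil_g.
  have /andP[_ r3] := oset_ge3 rS.
  have {1}-> : r = (r - 2).+2 by lia.
  by apply: subspaceN; [apply: g_subspace | apply: fil_c_g].
have cD i : combs b (m0S_deg_seq S (m0S_deg i)) (b i).
  by apply: combs_mem; rewrite ?m0S_deg_seq_uniq ?m0S_deg_seqP.
have eD k : combs b (m0S_deg_seq S k.+1) (e k) by apply: (cD (inl k.+1)).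
have sC n := combs_subspace b (m0S_deg_seq S n).
have cDn k : combs b (m0S_deg_seq S k.+2) (c k).
  have [->|/eqP ck] := eqVneq (c k) 0; first by case: (sC k.+2).
  have rS : k.+2 \in oset S by rewrite inE /= !subSS subn0; split.
  have := subspaceN (sC _) (cD (inr (exist (fun r => r \in oset S) _ rS))).
  by rewrite /= opprK !subSS subn0.
have gD n : (0 < n)%N -> g n `<=` combs b (m0S_deg_seq S n).
  apply: (gen_combs g_gen) => [x /Xa_gen[p [q ->]]|{}n i j n0].
    apply: subspaceD; [exact: sC|..]; (apply: subspaceZ; first exact: sC).
      exact: (cD (inl 0%N)).
    exact: (eD 0%N).
  rewrite (m0S_deg_seqP 1) m0S_deg_seqP => i1 /eqP jn.
  have {}i1 : b i = X \/ b i = a.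
    case: i i1 => [[|[|i]]|[r rS]] //= r1; [by left|by right|].
    by have := oset_ge3 rS; rewrite (eqP r1).
  have [C0 _] := sC n.+1.
  case: j jn => [[|k]|r] /= jn; last by rewrite lieNr cc oppr0.
    rewrite -jn; case: i1 => ->; first by rewrite liexx; case: (sC 2%N).
    by rewrite lieC; apply: subspaceN (sC _) (eD 1%N).
  by rewrite -jn; case: i1 => ->; [apply: (eD k.+1) | apply: cDn].
(* For [k > 0], if [e k] vanished, the component containing it would be central and the next one
   zero. *)
have e0 k : e k != 0.
  apply/eqP => ek; have Xa0 := gen_lie_neq0 g_graded g_gen L_inf g_width Xa_gen.
  case: k ek => [ek|k ek]; first by move: Xa0; rewrite -[a]/(e 0%N) ek lie0r
    eqxx.
  have [x gx /eqP[]] := g_neq0 g_graded g_gen L_inf g_width (ltn0Sn k.+2).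
  have ann z : g k.+2 z -> lie X z = 0 /\ lie a z = 0.
    move=> /(gD k.+2 isT)[d ->]; rewrite [m0S_deg_seq _ _]/= !lie_sumr
      !big_cons.
    rewrite -[b (inl k.+2)]/(e k.+1) ek !scaler0 !lie0r !add0r.
    by case: insub => [s|]; rewrite ?big_seq1 ?big_nil //= scalerN !lieNr
      !lieZr !cc !scaler0 !oppr0.
  apply: (gen_succ g_gen Xa_gen (i := k.+2) (P := [set x | x = 0])) gx => //.
  - by split=> // d u v -> ->; rewrite scaler0 addr0.
  - by move=> z /ann[].
  - by move=> z /ann[].
exists b; split => //.
  exact: (graded_spanning g_graded) gD.
apply: (graded_independent g_graded (@m0S_deg_seq_uniq S) (@m0S_deg_seqP S)
  (@m0S_deg_gt0 S) gb).
case=> [|[|n]] d // _; rewrite [m0S_deg_seq S _]/= big_cons => Hd.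
  rewrite big_seq1 /= in Hd.
  have := congr1 (lie a) Hd; rewrite lieDr !lieZr liexx scaler0 addr0 lie0r.
  rewrite lieC -[lie X a]/(e 1%N) scalerN => /eqP; rewrite oppr_eq0 scaler_eq0.
  rewrite (negPf (e0 _)) orbF => /eqP d0.
  have := congr1 (lie X) Hd; rewrite lieDr !lieZr liexx scaler0 add0r lie0r.
  move=> /eqP; rewrite scaler_eq0 -[lie X a]/(e 1%N) (negPf (e0 _)) orbF.
  by move=> /eqP d1 i; rewrite !inE => /orP[] /eqP->.
have d0 : d (inl n.+2) = 0.
  have := congr1 (lie X) Hd; rewrite lieDr lieZr lie_sumr big1_seq ?addr0;
    last first.
    move=> i /andP[_]; case: insub => [s|] //; rewrite inE => /eqP->.
    by rewrite lieZr lieNr cc oppr0 scaler0.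
  rewrite lie0r -[lie X _]/(e n.+2) => /eqP.
  by rewrite scaler_eq0 (negPf (e0 _)) orbF => /eqP.
move: Hd; rewrite d0 scale0r add0r; case: insubP => [s sS sn|_ _ i].
  rewrite big_seq1 /= => /eqP; rewrite scaler_eq0 oppr_eq0 => /orP[/eqP
    ds|/eqP].
    by move=> i; rewrite !inE => /orP[] /eqP->.
  by move: sS; rewrite sn inE => -[].
by rewrite inE => /eqP->.
Qed.

End M0SRecognition.

Definition oddSet0 : oddSet := @OddSet set0 (@sub0set _ _).

(** This lets m_0 be treated as m_0^S with S empty, where the index type of the z_r has no
    element. *)
Lemma m0_has_table (K : fieldType) : has_table (@m0S_fun K oddSet0) (m0 K).
Proof.
have F (r : {r : nat | r \in oset oddSet0}) : False by case: r => r /set_mem.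
pose b (i : m0S_basis oddSet0) : m0 K :=
  match i with inl k => (<< k >> : {malg K[nat]}) | inr _ => 0 end.
exists b; split.
- move=> x; exists (\sum_(k <- msupp (x : {malg K[nat]})) (x : {malg
  K[nat]})@_k *: << inl k >>).
  rewrite linear_sum {1}[x]malg_ZE; apply: eq_bigr => k _.
  by rewrite linearZ /= extU.
- move=> s d us s0 [k|r]; last by case: (F r).
  move=> ks; have := congr1 (mcoeff k) (s0 : _ = 0 :> {malg K[nat]}).
  rewrite mcoeff0 raddf_sum /= (bigD1_seq (inl k)) //= mcoeffZ mcoeffUU mulr1.
  rewrite big1 ?addr0 // => -[j|r]; last by case: (F r).
  by rewrite -[_ != _]/(j != k) mcoeffZ mcoeffU => /negPf->; rewrite mulr0.
- move=> [i|/F[]] [j|/F[]].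
  rewrite /lie /= table_lieUU /m0_bracket.
  case: i j => [|p] [|q].
  - by rewrite linear0.
  - by rewrite m0S_fun_t0S extU.
  - by rewrite m0S_C m0S_fun_t0S linearN /= extU.
  - rewrite m0S_funSS /m0S_z; case: insub => [/F[]|].
    by rewrite scaler0 linear0.
Qed.

(** * The algebras n_2 and n_2^3 *)

Lemma n2_dE q l : n2_d q l = n2_d (q %% 8) (l %% 8).
Proof. by rewrite /n2_d !modn_mod. Qed.

Lemma n2_d_mod q q' l l' : q = q' %[mod 8] -> l = l' %[mod 8] ->
  n2_d q l = n2_d q' l'.
Proof. by move=> Eq El; rewrite n2_dE Eq El -n2_dE. Qed.

Lemma n2_check (P : pred nat) : (forall q, P q = P (q %% 8)%N) ->
  all P (iota 0 8) -> forall q, P q.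
Proof. by move=> Pm /allP P8 q; rewrite Pm P8 // mem_iota ltn_mod. Qed.

(** Both brackets have weight b + 2, so each e_(b+2) is reached from a lower element by e_1 or by
    e_2 with a nonzero coefficient. *)
Lemma n2_d1_eq0 b : n2_d 1 b.+1 = 0 -> n2_d 2 b != 0.
Proof.
move=> /eqP d1; apply: (implyP _ d1); move: b {d1}; apply: n2_check => // q.
have q1 : q.+1 = (q %% 8).+1 %[mod 8] by rewrite -addn1 -modnDml addn1.
by rewrite (n2_d_mod (erefl (1 %% 8)%N) q1) (n2_d_mod (erefl (2 %% 8)%N) (esym
  (modn_mod q 8))).
Qed.

(** * Jacobi identities of n_2 in a fixed weight N *)

Section N2Jacobi.
Variables (K : fieldType) (V : lmodType K) (N : nat).
Hypotheses (K0 : [pchar K] =i pred0) (N8 : (8 <= N)%N).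
Local Notation d q l := ((n2_d q l)%:~R : K).

(** By [n2_d1_eq0], one of the two recursions reaches [Z q] with a nonzero coefficient. *)
Lemma n2_recursion_eq0 (Z : nat -> V) : Z 1%N = 0 -> Z 2%N = 0 ->
  (forall b c, (0 < b)%N -> (0 < c)%N -> (1 + b + c = N)%N ->
     d 1 b *: Z b.+1 = - (d 1 c *: Z b)) ->
  (forall b c, (0 < b)%N -> (0 < c)%N -> (2 + b + c = N)%N ->
     d 2 b *: Z b.+2 = - (d 2 c *: Z b)) ->
  forall q, (0 < q < N)%N -> Z q = 0.
Proof.
move=> Z1 Z2 R1 R2; elim/ltn_ind => -[|[|[|q]]] IHq // /andP[_ qN].
have [d1|d1] := eqVneq (n2_d 1 q.+2) 0; last first.
  apply: (scalerI (int_neq0 K0 d1)); rewrite scaler0.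
  rewrite (R1 q.+2 (N - q.+3)%N); try lia.
  by rewrite IHq ?scaler0 ?oppr0 //; lia.
have d2 := n2_d1_eq0 d1.
apply: (scalerI (int_neq0 K0 d2)); rewrite scaler0.
rewrite (R2 q.+1 (N - q.+3)%N); try lia.
by rewrite IHq ?scaler0 ?oppr0 //; lia.
Qed.

(** [X q] stands for [e_q, e_(N-q)]; the hypotheses are antisymmetry and the Jacobi identity when
    the brackets of lower weight are known. *)
Variable X : nat -> V.
Hypothesis X_anti : forall q, (0 < q < N)%N -> X q = - X (N - q)%N.
Hypothesis X_jac : forall a b c, (0 < a)%N -> (0 < b)%N -> (0 < c)%N ->
  (a + b + c = N)%N -> d b c *: X a + d c a *: X b + d a b *: X c = 0.

Lemma n2_X_jac a b s : (0 < a)%N -> (0 < b)%N -> (a + b = s)%N -> (s < N)%N ->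
  d b (N - s)%N *: X a + - (d a (N - s)%N *: X b) + - (d a b *: X s) = 0.
Proof.
move=> a0 b0 <- abN; rewrite -[RHS](X_jac a0 b0 (c := (N - (a + b))%N)); try
  lia.
rewrite (X_anti (q := (N - (a + b))%N)); last by lia.
rewrite (n2_dC (N - (a + b))%N) mulrNz scaleNr scalerN; congr (_ + - (_ *: X
  _)).
lia.
Qed.

(* At weights divisible by 8 (the imaginary roots of A_2^(2)) the Jacobi
   identities with e_1 and e_2 have this further solution; it grows linearly
   and is excluded by antisymmetry. *)
Definition n2_imag (q : nat) : int :=
  let j := (q %/ 8)%:Z in
  nth 0 [:: 4 * j; 4 * j; 2 * j + 1; 4 * j + 2; 12 * j + 6; 4 * j + 2;
            2 * j + 1; 4 * j + 4] (q %% 8).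

Lemma n2_imag_rec1 b c : (1 + b + c = 0 %[mod 8])%N ->
  n2_d 1 b * n2_imag b.+1 = - (n2_d 1 c * n2_imag b).
Proof.
move=> bc; rewrite (n2_d_mod (q := 1) (q' := 1) (l' := 7 - b %% 8) (l := c))
  //; last by lia.
rewrite /n2_imag (n2_dE 1 b) [in LHS](_ : b.+1 = b %/ 8 * 8 + (b %% 8).+1)%N;
  last by lia.
rewrite divnMDl // modnMDl; move: (b %/ 8)%N (b %% 8)%N (ltn_pmod b (isT : 0 <
  8)%N).
by move=> {bc b c} j; do 8 (case=> [_|]; first by rewrite /n2_d /= ?addn0
  ?addn1 ?intS; ring).
Qed.

Lemma n2_imag_rec2 b c : (2 + b + c = 0 %[mod 8])%N ->
  n2_d 2 b * n2_imag b.+2 = n2_d b c - n2_d 2 c * n2_imag b.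
Proof.
move=> bc; rewrite (n2_d_mod (q := 2) (q' := 2) (l' := 14 - b %% 8) (l := c))
  //; last by lia.
rewrite (n2_d_mod (q := b) (q' := b %% 8) (l' := 14 - b %% 8) (l := c))
  ?modn_mod //; last by lia.
rewrite /n2_imag (n2_dE 2 b) [in LHS](_ : b.+2 = b %/ 8 * 8 + (b %% 8).+2)%N;
  last by lia.
rewrite divnMDl // modnMDl; move: (b %/ 8)%N (b %% 8)%N (ltn_pmod b (isT : 0 <
  8)%N).
by move=> {bc b c} j; do 8 (case=> [_|]; first by rewrite /n2_d /= ?addn0
  ?addn1 ?intS; ring).
Qed.

(** One solution of the identities with e_1 and e_2 is the table itself, by [n2_d_jacobi]; [f] is
    another, normalised by [f 1 = 0]. A combination of the two that agrees with [X] at 1 and 2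
    agrees everywhere, since the difference satisfies the homogeneous recursion. *)
Lemma n2_X_solution (Y beta : V) (f : nat -> int) : f 1%N = 0 ->
  (forall b c, (1 + b + c = N)%N ->
     n2_d 1 b * f b.+1 = - (n2_d 1 c * f b)) ->
  (forall b c, (2 + b + c = N)%N ->
     n2_d 2 b * f b.+2 = n2_d b c * f 2%N - n2_d 2 c * f b) ->
  X 1%N = d 1 (N - 1)%N *: Y ->
  X 2%N = d 2 (N - 2)%N *: Y + (f 2%N)%:~R *: beta ->
  forall q, (0 < q < N)%N -> X q = d q (N - q)%N *: Y + (f q)%:~R *: beta.
Proof.
move=> f1 fR1 fR2 X1 X2.
suff Z0 : forall q, (0 < q < N)%N ->
    X q - (d q (N - q)%N *: Y + (f q)%:~R *: beta) = 0.
  by move=> q /Z0/subr0_eq.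
have step a b c : (0 < a)%N -> (0 < b)%N -> (0 < c)%N -> (a + b + c = N)%N ->
    X a = d a (N - a)%N *: Y + (f a)%:~R *: beta ->
    n2_d a b * f (a + b)%N = n2_d b c * f a - n2_d a c * f b ->
    d a b *: (X (a + b)%N - (d (a + b) (N - (a + b))%N *: Y + (f (a +
      b)%N)%:~R *: beta)) =
    - (d a c *: (X b - (d b (N - b)%N *: Y + (f b)%:~R *: beta))).
  move=> a0 b0 c0 abc Xa /(congr1 (fun z => z%:~R : K)).
  rewrite !(rmorphB, rmorphM) /= => fR.
  have := n2_X_jac a0 b0 erefl; rewrite Xa; have -> : (N - (a + b) = c)%N by
    lia.
  have -> : (N - a = b + c)%N by lia.
  have -> : (N - b = c + a)%N by lia.
  move=> /(_ ltac:(lia)) J.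
  have := n2_d_jacobi a b c; rewrite (n2_dC c a) (n2_dC c (a + b)).
  move=> /(congr1 (fun z => z%:~R : K)); rewrite !(rmorphD, rmorphM, rmorphN)
    /= => dJ.
  have dJY : (d b c * d a (b + c)) *: Y =
      (d a c * d b (c + a) + d a b * d (a + b) c) *: Y.
    congr (_ *: _); apply/eqP; rewrite -subr_eq0 -[X in _ == X]dJ.
    by apply/eqP; ring.
  have fRb : (d a b * (f (a + b)%N)%:~R) *: beta =
      (d b c * (f a)%:~R - d a c * (f b)%:~R) *: beta by rewrite fR.
  apply: (lincomb (-1) J); apply: (lincomb 1 dJY); apply: (lincomb (-1) fRb).
  module.
apply: n2_recursion_eq0.
- by rewrite X1 f1 scale0r addr0 subrr.
- by rewrite X2 subrr.
- move=> b c b0 c0 bcN; apply: step => //; first by rewrite X1 f1 scale0r addr0.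
  by rewrite f1 mulr0 sub0r; apply: fR1.
- by move=> b c b0 c0 bcN; apply: step => //; apply: fR2.
Qed.

(** At the index N - 1 the general solution is - X_1 plus a nonzero integer times X_1 + X_2, while
    antisymmetry gives - X_1. *)
Lemma n2_relation_imag : (N %% 8 = 0)%N -> X 2%N = - X 1%N.
Proof.
move=> Nr.
have d17 : n2_d 1 (N - 1) = 1 by rewrite (n2_d_mod (q' := 1) (l' := 7)) //; lia.
have d26 : n2_d 2 (N - 2) = -1 by rewrite (n2_d_mod (q' := 2) (l' := 6)) //;
  lia.
have d71 : n2_d (N - 1) 1 = -1 by rewrite n2_dC d17.
have := n2_X_solution (Y := X 1%N) (beta := X 1%N + X 2%N) (f := n2_imag).
move=> /(_ erefl) H; have {}H := H _ _ _ _ (N - 1)%N.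
have : X (N - 1)%N = - X 1%N.
  by rewrite X_anti; [congr (- X _) | ]; lia.
rewrite H; first last.
- by lia.
- by rewrite d26 (_ : n2_imag 2 = 1) //; module.
- by rewrite d17 scale1r.
- by move=> b c bcN; rewrite (@n2_imag_rec2 b c) ?bcN // mulr1.
- by move=> b c bcN; rewrite (@n2_imag_rec1 b c) ?bcN.
have -> : (N - (N - 1) = 1)%N by lia.
rewrite d71 => h.
have im0 : n2_imag (N - 1) != 0.
  rewrite /n2_imag (_ : (N - 1) %% 8 = 7)%N /=; lia.
apply/eqP; rewrite -addr_eq0 addrC; apply/eqP; apply: (scalerI (int_neq0 K0
  im0)).
by rewrite scaler0; apply: (lincomb 1 h); module.
Qed.

(** [e_1, e_(N-1)] and [e_2, e_(N-2)] must become multiples of one e_N. For each nonzero residue of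
    N modulo 8, eliminating the other [X q] from a few Jacobi identities of low index gives the
    relation, in some cases multiplied by 2, 3, 5 or 6. *)
Lemma n2_relation : d 2 (N - 2)%N *: X 1%N = d 1 (N - 1)%N *: X 2%N.
Proof.
have J a b s (a0 : (0 < a)%N) (b0 : (0 < b)%N) abs := @n2_X_jac a b s a0 b0 abs.
have [r Nr] : exists r, (N %% 8 = r)%N by exists (N %% 8)%N.
have r8 : (r < 8)%N by rewrite -Nr ltn_mod.
(* Adding 16 keeps the truncated subtraction exact and the residue unchanged. *)
have dN q l : (l <= 8)%N -> n2_d q (N - l)%N = n2_d q (r + 16 - l)%N.
  by move=> l8; apply: n2_d_mod => //; lia.
have k0 k : (k.+1%:R : K) != 0 by rewrite (pcharf0P _).1.
rewrite !dN //; case: r => [|[|[|[|[|[|[|[|//]]]]]]]] in Nr r8 dN *.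
- rewrite (n2_relation_imag Nr) /n2_d /=; module.
- have := J 2%N 3%N 5%N isT isT erefl; rewrite !dN // /n2_d /= => /(_
  ltac:(lia)) J23.
  by apply: (scalerI (k0 2)); apply: (lincomb 1 J23); module.
- have N10 : (7 < N)%N by lia.
  have := J 1%N 3%N 4%N isT isT erefl; rewrite !dN // /n2_d /= => /(_
    ltac:(lia)) J13.
  have := J 1%N 4%N 5%N isT isT erefl; rewrite !dN // /n2_d /= => /(_
    ltac:(lia)) J14.
  have := J 1%N 5%N 6%N isT isT erefl; rewrite !dN // /n2_d /= => /(_
    ltac:(lia)) J15.
  have := J 1%N 6%N 7%N isT isT erefl; rewrite !dN // /n2_d /= => /(_
    ltac:(lia)) J16.
  apply: (scalerI (k0 4)); apply: (lincomb 2 J13); apply: (lincomb 1 J14).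
  by apply: (lincomb (-1) J15); apply: (lincomb (-2) J16); module.
- have := J 1%N 2%N 3%N isT isT erefl; rewrite !dN // /n2_d /= => /(_
  ltac:(lia)) J12.
  have := J 2%N 3%N 5%N isT isT erefl; rewrite !dN // /n2_d /= => /(_
    ltac:(lia)) J23.
  apply: (scalerI (k0 1)); apply: (lincomb (-1) J12).
  by apply: (lincomb (-1) J23); module.
- have := J 2%N 3%N 5%N isT isT erefl; rewrite !dN // /n2_d /= => /(_
  ltac:(lia)) J23.
  by apply: (scalerI (k0 1)); apply: (lincomb 1 J23); module.
- have := J 2%N 4%N 6%N isT isT erefl; rewrite !dN // /n2_d /= => /(_
  ltac:(lia)) J24.
  by apply: (lincomb (-1) J24); module.
- have := J 1%N 2%N 3%N isT isT erefl; rewrite !dN // /n2_d /= => /(_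
  ltac:(lia)) J12.
  have := J 2%N 3%N 5%N isT isT erefl; rewrite !dN // /n2_d /= => /(_
    ltac:(lia)) J23.
  by apply: (lincomb (-1) J12); apply: (lincomb (-1) J23); module.
- have := J 1%N 5%N 6%N isT isT erefl; rewrite !dN // /n2_d /= => /(_
  ltac:(lia)) J15.
  have := J 1%N 6%N 7%N isT isT erefl; rewrite !dN // /n2_d /= => /(_
    ltac:(lia)) J16.
  apply: (scalerI (k0 5)); apply: (lincomb 1 J15).
  by apply: (lincomb (-2) J16); module.
Qed.

(** The value that x = [e_2, e_(N-2)] and y = [e_1, e_(N-1)] impose on e_N, read off from [y] unless
    its structure constant vanishes. *)
Definition n2_next (x y : V) : V :=
  if n2_d 1 (N - 1) != 0 then (d 1 (N - 1)%N)^-1 *: y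
  else (d 2 (N - 2)%N)^-1 *: x.

Lemma n2_X_unique q : (0 < q < N)%N ->
  X q = d q (N - q)%N *: n2_next (X 2%N) (X 1%N).
Proof.
move=> qN; rewrite (n2_X_solution (Y := n2_next (X 2%N) (X 1%N)) (beta := 0)
  (f := fun=> 0)) //.
- by rewrite scaler0 addr0.
- by move=> b c _; rewrite !mulr0 oppr0.
- by move=> b c _; rewrite !mulr0 subr0.
- rewrite /n2_next; case: eqVneq => [d1|/(int_neq0 K0) d1] /=; last first.
    by rewrite scalerA divff // scale1r.
  have d2 : n2_d 2 (N - 2) != 0.
    by apply: n2_d1_eq0; rewrite (_ : (N - 2).+1 = N - 1)%N //; lia.
  apply: (scalerI (int_neq0 K0 d2)); rewrite n2_relation d1.
  by rewrite !scale0r scaler0.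
- rewrite scaler0 addr0 /n2_next; case: eqVneq => [d1|/(int_neq0 K0) d1] /=;
  last first.
    by apply: (scalerI d1); rewrite -n2_relation !scalerA [in RHS](mulrC (d 1
      _)) mulfK.
  have d2 : n2_d 2 (N - 2) != 0.
    by apply: n2_d1_eq0; rewrite (_ : (N - 2).+1 = N - 1)%N //; lia.
  by rewrite scalerA divff ?scale1r // int_neq0.
Qed.

End N2Jacobi.

(** The grading with e_1 and e_2 in degree 1: a shift of the index by 8 raises the degree by 6, and
    degrees 1 to 6 have dimensions 2, 1, 1, 1, 2, 1. *)
Definition n2_deg (i : nat) : nat :=
  (6 * (i %/ 8) + nth 0 [:: 0; 1; 1; 2; 3; 4; 5; 5] (i %% 8))%N.

(* The indices [i.-1] of the basis vectors [e_i] of degree [n]. *)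
Definition n2_deg_seq (n : nat) : seq nat :=
  if n is m.+1 then
    let k := (8 * (m %/ 6))%N in
    nth [::] [:: [:: k; k.+1]; [:: k + 2]; [:: k + 3]; [:: k + 4];
                 [:: k + 5; (k + 5).+1]; [:: k + 7]]%N (m %% 6)
  else [::].

Lemma n2_deg_seq_uniq n : uniq (n2_deg_seq n).
Proof.
case: n => // n; rewrite /n2_deg_seq; move: (n %% 6)%N (8 * _)%N => r k.
by do 6 (case: r => [|r]; first by rewrite //= !inE; lia); rewrite nth_default.
Qed.

Lemma n2_deg_gt0 i : (0 < n2_deg i.+1)%N.
Proof.
rewrite /n2_deg; have := divn_eq i.+1 8; move: (ltn_pmod i.+1 (isT : 0 < 8)%N).
move: (_ %/ 8)%N (_ %% 8)%N => j.
by do 8 (case=> [_ /=|]; first lia).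
Qed.

Lemma n2_deg_seqP n i : (i \in n2_deg_seq n) = (n2_deg i.+1 == n).
Proof.
case: n => [|n].
  by rewrite in_nil; apply/esym; rewrite gtn_eqF // n2_deg_gt0.
rewrite /n2_deg_seq /n2_deg; have := divn_eq n 6; have := divn_eq i.+1 8.
move: (n %/ 6)%N (i.+1 %/ 8)%N (n %% 6)%N (i.+1 %% 8)%N
  (ltn_pmod n (isT : 0 < 6)%N) (ltn_pmod i.+1 (isT : 0 < 8)%N) => k j.
do 6 (case=> [|]; first by move=> s _; do 8 (case: s => [|s];
  first by move=> _; rewrite !inE /=; lia)).
by [].
Qed.

(** The degree is not additive in the index in general, as e_1 and e_2 show; it is checked residue
    by residue wherever the bracket is nonzero. *)
Lemma n2_degD q l : n2_d q l != 0 -> n2_deg (q + l) = (n2_deg q + n2_deg l)%N.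
Proof.
have qlE : (q + l = (q %/ 8 + l %/ 8) * 8 + (q %% 8 + l %% 8))%N by lia.
rewrite n2_dE /n2_deg qlE divnMDl // modnMDl.
move: (q %/ 8)%N (l %/ 8)%N (q %% 8)%N (l %% 8)%N (ltn_pmod q (isT : 0 < 8)%N)
  (ltn_pmod l (isT : 0 < 8)%N) => k j.
by do 8 (case=> [|]; first by move=> s _; do 8 (case: s => [|s]; first by
  rewrite /n2_d //= => _ _; lia)).
Qed.

Section N2Elements.
Variables (K : fieldType) (L : lieAlgType K).
Hypothesis K0 : [pchar K] =i pred0.
Variables X a : L.
Hypothesis c1 : central (fil_c X a 1).
Hypothesis c2 : fil_c X a 2 = 0.
Hypothesis e5 : fil X a 5 = 0.
Local Notation d q l := ((n2_d q l)%:~R : K).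

(** The recursion refers to the last two elements, so consecutive pairs (e_(n+1), e_(n+2)) are
    carried along. *)
Fixpoint n2_pair (n : nat) : L * L :=
  if n is m.+1 then
    let: (x, y) := n2_pair m in (y, n2_next m.+3 (lie a x) (lie X y))
  else (X, a).

Definition n2_elt (n : nat) : L := (n2_pair n.-1).1.
Local Notation E := n2_elt.

Lemma n2_elt_rec n : E n.+3 = n2_next n.+3 (lie a (E n.+1)) (lie X (E n.+2)).
Proof. by rewrite /n2_elt /=; case: n2_pair. Qed.

Definition n2_lie_ok q l := lie (E q) (E l) = d q l *: E (q + l)%N.

Lemma n2_lie_okC q l : n2_lie_ok q l -> n2_lie_ok l q.
Proof.
by rewrite /n2_lie_ok => qlE; rewrite lieC qlE (n2_dC l) addnC mulrNz scaleNr.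
Qed.

Lemma n2_lie_ok1 l : (1 < l)%N -> n2_d 1 l != 0 -> n2_lie_ok 1 l.
Proof.
case: l => [|[|l]] // _ d1; rewrite /n2_lie_ok n2_elt_rec /n2_next subn1 d1.
by rewrite scalerA divff ?scale1r // int_neq0.
Qed.

Lemma n2_lie_ok2 l : (0 < l)%N -> n2_d 1 l.+1 = 0 -> n2_lie_ok 2 l.
Proof.
case: l => // l _ d1; rewrite /n2_lie_ok n2_elt_rec /n2_next subn1 d1 eqxx /=.
by rewrite !subSS subn0 scalerA divff ?scale1r // int_neq0 // n2_d1_eq0.
Qed.

(** Here the hypotheses enter directly: [c2] is [e_2, e_4] = 0 and [e5] gives [e_1, e_6] = 0. The
    bracket [e_2, e_3] is left out because it may be a nonzero central element. *)
Lemma n2_lie_small q l : (0 < q)%N -> (0 < l)%N -> (q + l <= 7)%N ->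
  (q, l) != (2, 3)%N -> (q, l) != (3, 2)%N -> n2_lie_ok q l.
Proof.
have cc k : (k < 3)%N -> central (fil_c X a k).
  case: k => [|[|[|//]]] _ //; first by rewrite /fil_c liexx => x; rewrite
    lie0r.
  by rewrite c2 => x; rewrite lie0r.
have E3 : E 3 = fil X a 1 by rewrite n2_elt_rec /n2_next /= invr1 scale1r.
have E4 : E 4 = fil X a 2 by rewrite n2_elt_rec E3 /n2_next /= invr1 scale1r.
have d14 : d 1%N 4%N = - 3 by rewrite /n2_d /=; ring.
have d15 : d 1%N 5%N = - 2 by rewrite /n2_d /=; ring.
have E5 : E 5 = (- 3)^-1 *: fil X a 3.
  by rewrite n2_elt_rec E4 /n2_next -[(5 - 1)%N]/4%N d14.
have E6 : E 6 = (- 2)^-1 *: ((- 3)^-1 *: fil X a 4).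
  by rewrite n2_elt_rec E5 /n2_next -[(6 - 1)%N]/5%N d15 lieZr.
(* The table has 0 at (1, 6), so e_7 comes from [e_2, e_5]. *)
have E7 : E 7 = (- 3)^-1 *: fil_c X a 3.
  rewrite n2_elt_rec /n2_next -[n2_d 1 (7 - 1) != 0]/false -[n2_d 2 (7 - 2)]/1.
  by rewrite invr1 scale1r E5 lieZr.
have le_case q' l' : (0 < q')%N -> (q' <= l')%N -> (q' + l' <= 7)%N ->
    (q', l') != (2, 3)%N -> n2_lie_ok q' l'.
  move=> q0 ql ql7 n23.
  have [<-|nql] := eqVneq q' l'.
    rewrite /n2_lie_ok liexx (_ : n2_d q' q' = 0) ?scale0r //.
    by have := n2_dC q' q'; lia.
  case: q' q0 ql ql7 n23 nql => [//|[|[|[|q']]]] _ ql ql7 n23 nql; last by lia.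
  - have [->|n6] := eqVneq l' 6%N.
      rewrite /n2_lie_ok E6 !lieZr -[lie _ _]/(fil X a 5) e5 !scaler0.
      by rewrite (_ : n2_d 1 6 = 0) // scale0r.
    apply: n2_lie_ok1; first lia.
    by move: n23 nql ql ql7 n6; do 7 (case: l' => [//|l']); lia.
  - have [->|n5] := eqVneq l' 5%N; first exact: n2_lie_ok2.
    have -> : l' = 4%N.
      by move: n23 nql ql ql7 n5; do 6 (case: l' => [//|l']); lia.
    rewrite /n2_lie_ok E4 -[lie _ _]/(fil_c X a 2) c2 (_ : n2_d 2 4 = 0) //.
    by rewrite scale0r.
  - have -> : l' = 4%N by move: n23 nql ql ql7; do 5 (case: l' => [//|l']); lia.
    rewrite /n2_lie_ok E3 E4 (fil_lie cc) // E7.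
    have n3 : - 3 != 0 :> K by rewrite oppr_eq0 (pcharf0P _).1.
    rewrite expr1 -[n2_d 3 4]/(3%:Z) scalerA; congr (_ *: _).
    by field; rewrite n3.
move=> q0 l0 ql7 n23 n32; have [ql|lq] := leqP q l; first exact: le_case.
apply: n2_lie_okC; apply: le_case => //; first exact: ltnW.
  by rewrite addnC.
by apply: contraNneq n32 => -[-> ->].
Qed.

(** Induction on the weight. A Jacobi identity contains lower brackets only inside a further
    bracket, where the central [e_2, e_3] contributes nothing; hence n_2 and n_2^3 share this
    argument. *)
Lemma n2_lie q l : (0 < q)%N -> (0 < l)%N ->
  (q, l) != (2, 3)%N -> (q, l) != (3, 2)%N -> n2_lie_ok q l.
Proof.
move: {2}(q + l)%N (leqnn (q + l)) => N; elim/ltn_ind: N q l => N IHN q l qlN.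
move: qlN; rewrite leq_eqVlt => /predU1P[qlN|]; last first.
  by move=> lt_N; apply: (IHN _ lt_N).
move=> q0 l0 n23 n32.
have [N7|N8] := leqP N 7; first by apply: n2_lie_small; rewrite ?qlN.
pose Y q' := lie (E q') (E (N - q')%N).
have Yanti q' : (0 < q' < N)%N -> Y q' = - Y (N - q')%N.
  by move=> q'N; rewrite /Y lieC subKn //; lia.
have z_central x : lie x (lie (E 2) (E 3)) = 0.
  by have := c1 x; rewrite /fil_c n2_elt_rec /n2_next /= invr1 scale1r.
have lieE b c : (0 < b)%N -> (0 < c)%N -> (b + c < N)%N ->
    forall x, lie x (lie (E b) (E c)) = d b c *: lie x (E (b + c)%N).
  move=> b0 c0 bcN x.
  have [[-> ->]|bc23] := eqVneq (b, c) (2, 3)%N.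
    by rewrite z_central (_ : n2_d 2 3 = 0) // scale0r.
  have [[-> ->]|bc32] := eqVneq (b, c) (3, 2)%N.
    by rewrite (lieC (E 3)) lieNr z_central oppr0 (_ : n2_d 3 2 = 0) // scale0r.
  by rewrite (IHN _ bcN b c) // lieZr.
have Yjac b c e : (0 < b)%N -> (0 < c)%N -> (0 < e)%N -> (b + c + e = N)%N ->
    d c e *: Y b + d e b *: Y c + d b c *: Y e = 0.
  move=> b0 c0 f0 bce; have := lie_jacobi (E b) (E c) (E e).
  have h1 := lieE c e c0 f0 ltac:(lia) (E b).
  have h2 := lieE e b f0 b0 ltac:(lia) (E c).
  have h3 := lieE b c b0 c0 ltac:(lia) (E e).
  have -> : Y b = lie (E b) (E (c + e)%N) by congr (lie _ (E _)); lia.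
  have -> : Y c = lie (E c) (E (e + b)%N) by congr (lie _ (E _)); lia.
  have -> : Y e = lie (E e) (E (b + c)%N) by congr (lie _ (E _)); lia.
  move=> J; apply: (lincomb (-1) h1); apply: (lincomb (-1) h2).
  by apply: (lincomb (-1) h3); apply: (lincomb 1 J); module.
have := n2_X_unique K0 N8 Yanti Yjac (q := q); rewrite /Y -qlN addKn.
rewrite (_ : n2_next _ _ _ = E (q + l)%N); first by apply; lia.
have -> : (q + l = (q + l - 3).+3)%N by lia.
by rewrite n2_elt_rec; congr (n2_next _ (lie a (E _)) (lie X (E _))); lia.
Qed.

End N2Elements.

Arguments n2_deg_seq : simpl never.
Arguments n2_elt : simpl never.

Section N2Recognition.
Variables (K : fieldType) (L : lieAlgType K) (g : nat -> set L).
Hypotheses (K0 : [pchar K] =i pred0) (g_graded : N_grading g).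
Hypothesis g_gen :
  forall i, (0 < i)%N -> lie_product (g 1%N) (g i) = g i.+1.
Hypothesis L_inf : infinite_dimensional L.
Hypothesis g_width : forall i, (0 < i)%N -> exists d d' : nat,
  [/\ has_dim (g i) d, has_dim (g i.+1) d' & (d + d' <= 3)%N].
Variables X a : L.
Hypothesis Xa_gen : generators g X a.
Hypothesis c1 : central (fil_c X a 1).
Hypothesis c2 : fil_c X a 2 = 0.
Hypothesis e5 : fil X a 5 = 0.
Local Notation E := (n2_elt X a).
Local Notation d q l := ((n2_d q l)%:~R : K).
Local Notation z := (fil_c X a 1).

Let lieE := n2_lie K0 c1 c2 e5.

Lemma n2_elt_g i : (0 < i)%N -> g (n2_deg i) (E i).
Proof.
have gX := gen_l Xa_gen; have ga := gen_r Xa_gen.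
elim/ltn_ind: i => -[|[|[|n]]] // IHn _.
have gS k x y : g 1%N x -> (0 < k)%N -> g k y -> g k.+1 (lie x y).
  by move=> gx k0 gy; rewrite -add1n; apply: (g_lie g_graded).
have sg := g_subspace g_graded (n2_deg_gt0 _).
rewrite n2_elt_rec /n2_next subn1; case: eqVneq => d1 /=.
  have d2 := n2_d1_eq0 d1; rewrite -[n.+3]/(2 + n.+1)%N n2_degD //.
  rewrite -[in X in g X](n2_degD d2).
  apply: subspaceZ; first exact: sg.
  by rewrite n2_degD //; apply: gS (n2_deg_gt0 _) (IHn _ _ _).
apply: subspaceZ; first exact: sg.
rewrite -[n.+3]/(1 + n.+2)%N n2_degD //.
by apply: gS (n2_deg_gt0 _) (IHn _ _ _).
Qed.

Definition n23_family (i : option nat) : L :=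
  if i is Some k then E k.+1 else z.

Definition n23_deg (i : option nat) : nat :=
  if i is Some k then n2_deg k.+1 else 3.

Definition n23_deg_seq (n : nat) : seq (option nat) :=
  map Some (n2_deg_seq n) ++ (if n == 3 then [:: None] else [::]).

Lemma n23_deg_seq_uniq n : uniq (n23_deg_seq n).
Proof.
rewrite cat_uniq map_inj_uniq ?n2_deg_seq_uniq; last by move=> i j [].
by case: eqP => //= _; rewrite orbF andbT; apply/mapP => -[].
Qed.

Lemma n23_deg_seqP n i : (i \in n23_deg_seq n) = (n23_deg i == n).
Proof.
rewrite mem_cat; case: i => [i|] /=.
  rewrite mem_map; last by move=> j k [].
  by rewrite n2_deg_seqP; case: (n == 3); rewrite ?inE ?orbF.
rewrite (_ : None \in _ = false) //=; last by apply/mapP => -[].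
by rewrite (eq_sym 3); case: (n == 3).
Qed.

Lemma n23_family_g i : g (n23_deg i) (n23_family i).
Proof.
case: i => [i|] /=; first exact: n2_elt_g.
exact: (fil_c_g g_graded Xa_gen 1).
Qed.

Lemma n23_spanned n : (0 < n)%N -> g n `<=` combs n23_family (n23_deg_seq n).
Proof.
have sC m := combs_subspace n23_family (n23_deg_seq m).
have cD i : combs n23_family (n23_deg_seq (n23_deg i)) (n23_family i).
  by apply: combs_mem; rewrite ?n23_deg_seq_uniq ?n23_deg_seqP.
apply: (gen_combs g_gen) => [x /Xa_gen[p [q ->]]|{}n i j n0].
  apply: subspaceD; [exact: sC|..]; (apply: subspaceZ; first exact: sC).
    exact: (cD (Some 0%N)).
  exact: (cD (Some 1%N)).
rewrite !n23_deg_seqP => i1 /eqP<-.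
have {}i1 : i = Some 0%N \/ i = Some 1%N.
  by case: i i1 => [i|] //=; rewrite -n2_deg_seqP !inE => /orP[] /eqP->;
    [left|right].
case: j => [j|] /=; last by rewrite c1; case: (sC 4%N).
have cE q : (0 < q)%N -> n2_deg q = 1%N -> n2_lie_ok X a q j.+1 ->
    combs n23_family (n23_deg_seq (n2_deg j.+1).+1) (lie (E q) (E j.+1)).
  move=> q0 q1 ->; have [->|dq] := eqVneq (n2_d q j.+1) 0.
    by rewrite scale0r; case: (sC (n2_deg j.+1).+1).
  apply: subspaceZ; first exact: sC.
  by rewrite -add1n -q1 -n2_degD // addnS; apply: (cD (Some _)).
case: i1 => -> /=; first by apply: cE => //; apply: lieE.
have [->|j2] := eqVneq j 2%N; last first.
  by apply: cE => //; apply: lieE => //; apply: contraNneq j2 => -[->].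
have := cD None; rewrite /= /fil_c.
by rewrite n2_elt_rec /n2_next /= invr1 scale1r.
Qed.

(** The vector spans a nonzero component, except that degree 3 may also contain z; there e_4 is
    nonzero because [e_1, e_4] = - 3 e_5 is. *)
Lemma n2_elt_neq0 n i : n2_deg_seq n.+1 = [:: i] -> E i.+1 != 0.
Proof.
have main m k : m.+1 != 3 -> n2_deg_seq m.+1 = [:: k] -> E k.+1 != 0.
  move=> m3 mk; have [x gx x0] := g_neq0 g_graded g_gen L_inf g_width (ltn0Sn
    m).
  have [c] := n23_spanned (ltn0Sn m) gx.
  rewrite /n23_deg_seq mk (negPf m3) big_seq1 => xE.
  by apply: contraNneq x0 => E0; rewrite xE /= E0 scaler0.
have [->|n3] := eqVneq n 2%N; last by apply: main.
move=> [<-]; apply/eqP => E4.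
have := lieE (q := 1) (l := 4) isT isT isT isT; rewrite /n2_lie_ok E4 lie0r.
move=> /esym/eqP; rewrite scaler_eq0 (negPf (int_neq0 K0 _)) //=.
by rewrite (negPf (main 3 4 _ _)).
Qed.

(** The two basis vectors of a degree are separated by e_1 and e_2: each of these kills one of them
    and sends the other to [E p.+2] up to sign. *)
Lemma n2_pair_independent p (x y : K) : (0 < p)%N ->
  n2_d 1 p = 0 -> n2_d 1 p.+1 = 1 -> n2_d 2 p = -1 -> n2_d 2 p.+1 = 0 ->
  E p.+2 != 0 -> x *: E p + y *: E p.+1 = 0 -> x = 0 /\ y = 0.
Proof.
move=> p0 d10 d11 d20 d21 Ep xy.
have h1 : lie (E 1) (E p) = 0.
  by have := lieE (q := 1) (l := p) isT p0 isT isT; rewrite /n2_lie_ok d10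
    scale0r.
have h2 : lie (E 1) (E p.+1) = E p.+2.
  have := lieE (q := 1) (l := p.+1) isT isT isT isT.
  by rewrite /n2_lie_ok d11 scale1r add1n.
have h3 : lie (E 2) (E p) = - E p.+2.
  have p3 : (2, p)%N != (2, 3)%N by apply: contra_eqN d20 => /eqP[->].
  have := lieE (q := 2) (l := p) isT p0 p3 isT.
  by rewrite /n2_lie_ok d20 scaleN1r add2n.
have h4 : lie (E 2) (E p.+1) = 0.
  have p3 : (2, p.+1)%N != (2, 3)%N by apply: contra_eqN d20 => /eqP[->].
  have := lieE (q := 2) (l := p.+1) isT isT p3 isT.
  by rewrite /n2_lie_ok d21 scale0r.
have := congr1 (lie (E 1)) xy; rewrite lieDr !lieZr h1 h2 scaler0 add0r lie0r.
move=> /eqP; rewrite scaler_eq0 (negPf Ep) orbF => /eqP y0.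
have := congr1 (lie (E 2)) xy; rewrite lieDr !lieZr h3 h4 scaler0 addr0 lie0r.
by move=> /eqP; rewrite scaler_eq0 oppr_eq0 (negPf Ep) orbF => /eqP.
Qed.

Lemma n2_independent n (c : nat -> K) : (0 < n)%N ->
  \sum_(i <- n2_deg_seq n) c i *: E i.+1 = 0 ->
  forall i, i \in n2_deg_seq n -> c i = 0.
Proof.
case: n => // n _; have nE := divn_eq n 6.
have single i : n2_deg_seq n.+1 = [:: i] ->
    \sum_(i <- n2_deg_seq n.+1) c i *: E i.+1 = 0 ->
    forall i, i \in n2_deg_seq n.+1 -> c i = 0.
  move=> ni; have := n2_elt_neq0 ni; rewrite ni big_seq1 => Ei /eqP.
  by rewrite scaler_eq0 (negPf Ei) orbF => /eqP ci j; rewrite inE => /eqP->.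
have pair p : (p %% 8 = 0 \/ p %% 8 = 5)%N -> n2_deg_seq n.+1 = [:: p; p.+1] ->
    n2_deg_seq n.+2 = [:: p.+2] ->
    \sum_(i <- n2_deg_seq n.+1) c i *: E i.+1 = 0 ->
    forall i, i \in n2_deg_seq n.+1 -> c i = 0.
  move=> p8 -> /n2_elt_neq0 Ep; rewrite big_cons big_seq1 => cE.
  have dp q l : n2_d q (p + l) = n2_d q (p %% 8 + l).
    by apply: n2_d_mod => //; rewrite modnDml.
  have [||||cp cp1 i] := n2_pair_independent (ltn0Sn p) _ _ _ _ Ep cE.
  - by rewrite -(addn1 p) dp; case: p8 => ->.
  - by rewrite -(addn2 p) dp; case: p8 => ->.
  - by rewrite -(addn1 p) dp; case: p8 => ->.
  - by rewrite -(addn2 p) dp; case: p8 => ->.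
  by rewrite !inE => /orP[] /eqP->.
have S : n2_deg_seq n.+1 = nth [::] [:: [:: 8 * (n %/ 6); (8 * (n %/ 6)).+1];
    [:: 8 * (n %/ 6) + 2]; [:: 8 * (n %/ 6) + 3]; [:: 8 * (n %/ 6) + 4];
    [:: 8 * (n %/ 6) + 5; (8 * (n %/ 6) + 5).+1]; [:: 8 * (n %/ 6) + 7]]%N (n
      %% 6) by [].
have S' : (n %% 6 < 5)%N -> n2_deg_seq n.+2 = nth [::] [:: [:: 8 * (n %/ 6);
  (8 * (n %/ 6)).+1];
    [:: 8 * (n %/ 6) + 2]; [:: 8 * (n %/ 6) + 3]; [:: 8 * (n %/ 6) + 4];
    [:: 8 * (n %/ 6) + 5; (8 * (n %/ 6) + 5).+1]; [:: 8 * (n %/ 6) + 7]]%N (n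
      %% 6).+1.
  move=> n5; rewrite /n2_deg_seq; have -> : (n.+1 %/ 6 = n %/ 6)%N by lia.
  by have -> : (n.+1 %% 6 = (n %% 6).+1)%N by lia.
move: S S'; move: (n %% 6)%N (ltn_pmod n (isT : 0 < 6)%N) => r.
case: r => [|[|[|[|[|[|//]]]]]] _ /= S S'; try exact: single S.
  by apply: pair S _; [lia | rewrite S' // addn2].
by apply: pair S _; [lia | rewrite S' //; congr [:: _]; lia].
Qed.

Lemma n2_recognition : z = 0 ->
  has_table (fun i j => n2_bracket K i.+1 j.+1) L.
Proof.
move=> z0; pose b i := E i.+1; exists b.
have gD n : (0 < n)%N -> g n `<=` combs b (n2_deg_seq n).
  move=> n0 x /(n23_spanned n0)[c ->]; exists (fun i => c (Some i)).
  rewrite big_cat big_map /=; case: (n == 3);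
    by rewrite ?big_seq1 ?big_nil /= ?z0 ?scaler0 addr0.
split.
- exact: (graded_spanning g_graded) gD.
- apply: (graded_independent g_graded n2_deg_seq_uniq n2_deg_seqP n2_deg_gt0).
    by move=> i; apply: n2_elt_g.
  exact: n2_independent.
- move=> i j; rewrite /n2_bracket linearZ /= extU /b addSn addnS /=.
  have z23 : lie (E 2) (E 3) = 0.
    by move: z0; rewrite /fil_c n2_elt_rec /n2_next /= invr1 scale1r.
  have [[-> ->]|ij] := eqVneq (i.+1, j.+1) (2, 3)%N; first by rewrite z23
    scale0r.
  have [[-> ->]|ji] := eqVneq (i.+1, j.+1) (3, 2)%N.
    by rewrite lieC z23 oppr0 scale0r.
  by rewrite lieE //= addSn addnS.
Qed.

Lemma n23_recognition : z != 0 -> has_table (n23_fun K) L.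
Proof.
move=> z0; exists n23_family; split.
- exact: (graded_spanning g_graded) n23_spanned.
- apply: (graded_independent g_graded n23_deg_seq_uniq n23_deg_seqP _
  n23_family_g).
    by case=> [i|] //; apply: n2_deg_gt0.
  move=> n c n0; rewrite /n23_deg_seq big_cat big_map /=.
  have [->|n3] := eqVneq n 3%N; last first.
    rewrite big_nil addr0 cats0 => /(n2_independent n0) H i /mapP[j jn ->].
    exact: H jn.
  rewrite !big_seq1 /= => Ez.
  have E5 : E 5 != 0 by apply: (@n2_elt_neq0 3).
  have {}Ez : c (Some 3%N) *: E 4 + c None *: z = 0 := Ez.
  have h : lie (E 1) (E 4) = d 1%N 4%N *: E 5 by apply: lieE.
  have := congr1 (lie (E 1)) Ez.
  rewrite lieDr (lieZr _ _ (E 4)) h (lieZr _ _ z) c1 scaler0 addr0 lie0r.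
  move=> /eqP; rewrite scalerA scaler_eq0 (negPf E5) orbF mulf_eq0.
  rewrite (negPf (int_neq0 K0 _)) // orbF => /eqP c3.
  move: Ez; rewrite c3 scale0r add0r => /eqP; rewrite scaler_eq0 (negPf z0)
    orbF.
  by move=> /eqP cN i; rewrite !inE => /orP[] /eqP->.
- have cz x : lie z x = 0 by rewrite lieC c1 oppr0.
  case=> [i|] [j|]; try by rewrite ?c1 ?cz linear0.
  rewrite -[n23_fun _ _ _]/(n23_bracket K i.+1 j.+1) /n23_bracket.
  rewrite -[n23_family (Some i)]/(E i.+1) -[n23_family (Some j)]/(E j.+1).
  have z23 : lie (E 2) (E 3) = z.
    by rewrite /fil_c n2_elt_rec /n2_next /= invr1 scale1r.
  have [[-> ->]|ij] := eqVneq (i.+1, j.+1) (2, 3)%N; first by rewrite extU.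
  have [[-> ->]|ji] := eqVneq (i.+1, j.+1) (3, 2)%N.
    by rewrite lieC z23 linearN /= extU.
  have := ij; have := ji; rewrite !xpair_eqE => /negPf-> /negPf->.
  by rewrite lieE // linearZ /= extU /= addSn addnS.
Qed.

End N2Recognition.

(** * Realizations of n_1 *)

Section CurrentBasis.
Variables (K : fieldType) (eps : K).
Local Notation s_current := (s_current eps).

Definition current_family (i : n1_index) : s_current :=
  match i with
  | inl (inl k) => ('X^(2 * k + 1), 0, 0)
  | inl (inr k) => (0, 'X^(2 * k + 1), 0)
  | inr k => (0, 0, 'X^(2 * k + 2))
  end.

Lemma current_family_gens i : n1_gens (current_family i).
Proof.
by case: i => [[k|k]|k]; exists k; [apply: Or31 | apply: Or32 | apply: Or33].
Qed.

Lemma current_family_mem i :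
  current_family i \in subalgebra_pred (n1_subalgebra eps).
Proof. by apply/subalgebra_predP/sub_lin_span/current_family_gens. Qed.

Definition n1_basis (i : n1_index) : n1 eps :=
  Subalgebra (current_family_mem i).

Definition current_coef (i : n1_index) (x : s_current) : K :=
  match i with
  | inl (inl k) => x.1.1`_(2 * k + 1)
  | inl (inr k) => x.1.2`_(2 * k + 1)
  | inr k => x.2`_(2 * k + 2)
  end.

Lemma current_coefE i j : current_coef i (current_family j) = (i == j)%:R.
Proof.
case: i j => [[k|k]|k] [[l|l]|l] /=; rewrite ?coef0 ?coefXn //;
  congr ((nat_of_bool _)%:R); apply/eqP/eqP => [kl|[->]] //; congr (_ _);
  try congr (_ _); lia.
Qed.

Lemma current_coefD i x y :
  current_coef i (x + y) = current_coef i x + current_coef i y.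
Proof. by case: i => [[k|k]|k] /=; rewrite coefD. Qed.

Lemma current_coefZ i a x : current_coef i (a *: x) = a * current_coef i x.
Proof. by case: i => [[k|k]|k] /=; rewrite coefZ. Qed.

Lemma n1_has_table : has_table (n1_table eps) (n1 eps).
Proof.
have val_sum (I : eqType) (s : seq I) (c : I -> K) (F : I -> n1 eps) :
    \val (\sum_(i <- s) c i *: F i) = \sum_(i <- s) c i *: \val (F i) :>
      s_current.
  rewrite (raddf_sum (\val : subalgebra (n1_subalgebra eps) -> s_current)).
  apply: eq_bigr => i _.
  exact: (linearZ_LR (\val : subalgebra (n1_subalgebra eps) -> s_current)).
exists n1_basis; split.
- move=> x; have /subalgebra_predP := subalgebra_valP x.
  rewrite /= => xS.
  suff [m xE] : exists m, \val x = \val (ext n1_basis m) :> s_current.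
    by exists m; apply: val_inj.
  apply: (lin_span_min (B := [set y | exists m, y = \val (ext n1_basis m)])) xS.
    split; first by exists 0; rewrite linear0.
    by move=> a _ _ [m ->] [m' ->]; exists (a *: m + m'); rewrite !linearP.
  move=> y [k [->|->|->]].
  + by exists << inl (inl k) >>; rewrite extU.
  + by exists << inl (inr k) >>; rewrite extU.
  + by exists << inr k >>; rewrite extU.
- move=> s c us s0 i si; have := congr1 (current_coef i \o val) s0.
  have c0 : current_coef i 0 = 0.
    by rewrite -(scale0r (0 : s_current)) current_coefZ mul0r.
  rewrite /= val_sum => H; have {H} := etrans H c0.
  rewrite (big_morph _ (current_coefD i) c0).
  rewrite (bigD1_seq i) //= current_coefZ current_coefE eqxx mulr1 big1 ?addr0
    //.
  by move=> j ji; rewrite current_coefZ current_coefE eq_sym (negPf ji) mulr0.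
- have bE : n1_basis =1 n1_family (fun k => n1_basis (inl (inl k)))
      (fun k => n1_basis (inl (inr k))) (fun k => n1_basis (inr k)).
    by case=> [[k|k]|k].
  have -> : n1_basis = n1_family (fun k => n1_basis (inl (inl k)))
      (fun k => n1_basis (inl (inr k))) (fun k => n1_basis (inr k)) by
        apply/funext.
  apply: n1_family_table => p q; apply: val_inj.
  all: rewrite ?[RHS](linearZ (\val : n1 eps -> _)) /lie /=; congr (_, _, _).
  all: rewrite /= ?(mul0r, mulr0, subr0, sub0r, oppr0, scaler0) -?exprD //.
  all: do ?congr (_ *: _); congr ('X^_); lia.
Qed.

End CurrentBasis.

Section Rescaling.
Variables (K : fieldType) (L : lieAlgType K).

(** The vectors of type v and w are multiplied by [c]; only [v, w] acquires the factor c^2. *)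
Lemma n1_table_scale (eps c : K) : c != 0 ->
  has_table (n1_table eps) L -> has_table (n1_table (eps * c ^+ 2)) L.
Proof.
move=> c0 [b [sb ib bt]].
pose s (i : n1_index) : K := if i is inl (inl _) then 1 else c.
have s0 i : s i != 0 by case: i => [[k|k]|k]; rewrite ?oner_neq0.
exists (fun i => s i *: b i); split.
- move=> x; have [m ->] := sb x.
  exists (\sum_(i <- msupp m) (m@_i / s i) *: << i >>).
  rewrite linear_sum; apply: eq_bigr => i _.
  by rewrite linearZ /= extU scalerA divfK.
- move=> t d ut dt i ti.
  have := ib t (fun i => d i * s i) ut _ i ti.
  have -> : \sum_(i <- t) (d i * s i) *: b i = 0.
    by rewrite -[RHS]dt; apply: eq_bigr => j _; rewrite scalerA.
  by move=> /(_ erefl)/eqP; rewrite mulf_eq0 (negPf (s0 i)) orbF => /eqP.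
- move=> i j; rewrite lieZl lieZr bt.
  case: i j => [[p|p]|p] [[q|q]|q] /=;
    rewrite ?linear0 ?linearN ?linearZ /= ?extU ?scaler0 ?scalerA ?scalerN //=;
    rewrite ?scale1r ?mulr1 ?mul1r //.
  + by congr (_ *: _); ring.
  + by congr (- (_ *: _)); ring.
Qed.

End Rescaling.

Section ComplexBasis.
Variables (R : rcfType) (L : lieAlgType R).

Lemma complexification_n1_table (eps : R) : has_table (n1_table eps) L ->
  has_table (n1_table (eps%:C : R[i])) (complexification L).
Proof.
move=> [b [sb ib bt]].
pose b' (i : n1_index) : complexification L := (b i, 0).
have cE (c : R[i]) i : c *: b' i =
      ((complex.Re c *: b i : L), (complex.Im c *: b i : L)) :>
        complexification L.
  case: c => c d; rewrite /b'; congr (_, _) => /=.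
    by rewrite scaler0 subr0.
  by rewrite scaler0 add0r.
have sumE (s : seq n1_index) (c : n1_index -> R[i]) :
    \sum_(i <- s) c i *: b' i =
    ((\sum_(i <- s) complex.Re (c i) *: b i : L), (\sum_(i <- s) complex.Im (c
      i) *: b i : L))
    :> complexification L.
  elim: s => [|i s IHs]; first by rewrite !big_nil.
  by rewrite !big_cons IHs cE.
have fstE m : exists m', ((ext b m, 0) : complexification L) = ext b' m'.
  exists (\sum_(i <- msupp m) (m@_i)%:C *: << i >>); rewrite linear_sum.
  transitivity (\sum_(i <- msupp m) (m@_i)%:C *: b' i).
    by rewrite sumE /=; congr (_, _); rewrite big1 // => i _; rewrite scale0r.
  by apply: eq_bigr => i _; rewrite linearZ /= extU.
exists b'; split.
- move=> [x y]; have [mx ->] := sb x; have [my ->] := sb y.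
  have [mx' Ex] := fstE mx; have [my' Ey] := fstE my.
  exists (mx' + 'i *: my'); rewrite linearD linearZ /= -Ex -Ey.
  congr (_, _) => /=; rewrite ?scale0r ?scaler0 ?subr0 ?addr0 ?add0r ?scale1r
    //.
- move=> s c us; rewrite sumE => -[cr ci] i si.
  have := ib s _ us cr i si; have := ib s _ us ci i si.
  by case: (c i) => /= p q -> ->.
- have lb i j : lie (b' i) (b' j) = (ext b (n1_table eps i j), 0) :>
  complexification L.
    by rewrite -bt /lie /= ; congr (_, _); rewrite /= ?lie0r ?lie0l ?subr0
      ?addr0.
  move=> i j; rewrite lb; case: i j => [[p|p]|p] [[q|q]|q] /=;
    rewrite ?linear0 ?linearN ?linearZ /= ?extU //;
    by congr (_, _); rewrite /= ?oppr0 ?scale0r ?scaler0 ?subr0 ?addr0 ?oppr0.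
Qed.

End ComplexBasis.

(** * Invariants *)

Section Invariants.
Variable K : fieldType.
Implicit Types L M : lieAlgType K.

Definition derived_commutators_central L := forall u x y z t : L,
  lie u (lie (lie x y) (lie z t)) = 0.

Definition cross_product_identity L := forall x y : L,
  lie (lie x (lie x (lie x y))) (lie x y) = 0.

Definition centerless L := forall x : L, central x -> x = 0.

Definition has_ad_cube_zero L := exists2 x : L, x != 0 &
  forall y, lie x (lie x (lie x y)) = 0.

Fixpoint lcs L (n : nat) : set L :=
  if n is m.+1 then lie_product [set: L] (@lcs L m) else [set: L].

Arguments lcs : clear implicits.

Definition central_in_layer L n := exists z : L,
  [/\ central z, lcs L n z & ~ lcs L n.+1 z].

Lemma derived_commutators_central_iso L M : lie_iso L M ->
  derived_commutators_central M -> derived_commutators_central L.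
Proof.
move=> [f [fb fM]] HM u x y z t; apply: (bij_inj fb).
by rewrite !fM HM linear0.
Qed.

Lemma cross_product_identity_iso L M : lie_iso L M ->
  cross_product_identity M -> cross_product_identity L.
Proof.
move=> [f [fb fM]] HM x y; apply: (bij_inj fb).
by rewrite !fM HM linear0.
Qed.

Lemma central_iso L M (f : {linear L -> M}) z : bijective f ->
  (forall x y, f (lie x y) = lie (f x) (f y)) -> central z -> central (f z).
Proof.
by move=> [h fK hK] fM cz x; rewrite -[x]hK -fM cz linear0.
Qed.

Lemma centerless_iso L M : lie_iso L M -> centerless M -> centerless L.
Proof.
move=> [f [fb fM]] HM x cx; apply: (bij_inj fb).
by rewrite linear0; apply/HM/central_iso.
Qed.

Lemma has_ad_cube_zero_iso L M : lie_iso L M ->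
  has_ad_cube_zero L -> has_ad_cube_zero M.
Proof.
move=> [f [fb fM]] [x x0 xc]; exists (f x) => [|y].
  by apply: contraNneq x0 => fx; apply/eqP/(bij_inj fb); rewrite fx linear0.
by have [h fK hK] := fb; rewrite -[y]hK -!fM xc linear0.
Qed.

Lemma lcs_iso L M (f : {linear L -> M}) n z :
  (forall x y, f (lie x y) = lie (f x) (f y)) -> lcs L n z -> lcs M n (f z).
Proof.
move=> fM; elim: n z => // n IHn z.
apply: (lin_span_min (B := [set z | lcs M n.+1 (f z)])) => [|_ [x _ [y yn <-]]].
  have [S0 SD] := lin_span_subspace [set lie x y | x in [set: M] & y in lcs M
    n].
  split; first by rewrite /= linear0.
  by move=> a x y /= fx fy; rewrite linearP; apply: SD.
by rewrite /= fM; apply: sub_lin_span; exists (f x) => //; exists (f y);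
  [apply: IHn|].
Qed.

Lemma central_in_layer_iso L M n : lie_iso L M ->
  central_in_layer L n -> central_in_layer M n.
Proof.
move=> LM; have [h [hb hM]] := lie_iso_sym LM; have [f [fb fM]] := LM.
move=> [z [cz zn nz]]; have [f' fK f'K] := fb.
have f'M x y : f' (lie x y) = lie (f' x) (f' y).
  by apply: (bij_inj fb); rewrite f'K fM !f'K.
have f'_lin : linear f'.
  by move=> a x y; apply: (bij_inj fb); rewrite linearP /= !f'K.
pose f'L := GRing.isLinear.Build K M L *:%R f' f'_lin.
pose F' : {linear M -> L} := HB.pack f' f'L.
exists (f z); split; first exact: central_iso.
  exact: lcs_iso.
move=> /(lcs_iso (f := F') f'M) /=; by rewrite fK.
Qed.

Lemma lcs_subspace L n : subspace (lcs L n).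
Proof. by case: n => [|n] //; apply: lin_span_subspace. Qed.

Lemma lcs_lie L n x y : lcs L n y -> lcs L n.+1 (lie x y).
Proof. by move=> yn; apply: sub_lin_span; exists x => //; exists y. Qed.

Lemma lcsS L n : lcs L n.+1 `<=` lcs L n.
Proof.
elim: n => // n IHn; apply: lin_span_min; first exact: lcs_subspace.
by move=> _ [x _ [y /IHn yn <-]]; apply: lcs_lie.
Qed.

Lemma lcs_le L m n : (m <= n)%N -> lcs L n `<=` lcs L m.
Proof.
move=> /subnK<-; elim: (n - m)%N => // k IHk x /lcsS; exact: IHk.
Qed.

End Invariants.

Arguments lcs {K} L n _.

(** * Invariants of n_1 and its two real forms *)

Section CurrentInvariants.
Variables (K : fieldType) (eps : K).

(** The witness is [v_0, [[u_0, v_0], [w_0, u_0]]] = eps w_2. *)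
Lemma n1_derived L : eps != 0 -> has_table (n1_table eps) L ->
  ~ derived_commutators_central L.
Proof.
move=> eps0 [b [_ ib bt]] /(_ (b (inl (inr 0%N))) (b (inl (inl 0%N))) (b (inl
  (inr 0%N)))
  (b (inr 0%N)) (b (inl (inl 0%N)))).
rewrite !(bt, extU, linearN, linearZ) /= !(bt, extU, linearN, linearZ) /=.
rewrite !(bt, extU, linearN, linearZ) /= !(bt, extU, linearN, linearZ) /=.
move=> H; have := ib [:: inr 2%N] (fun=> eps) isT _ (inr 2%N).
rewrite big_seq1 inE eqxx; move: H; rewrite ?scalerN ?opprK => -> /(_ erefl
  isT) /eqP.
by rewrite (negPf eps0).
Qed.

(** On a three-dimensional cross product algebra over K[t], ad(x)^3 is ad(x) times a polynomial
    quadratic in x. *)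
Lemma n1_cross_product : cross_product_identity (n1 eps).
Proof.
move=> x y; apply: val_inj; rewrite [RHS](linear0 (\val : n1 eps -> _)).
rewrite /lie /= /lie /=; case: (subalgebra_val x) => [[P Q] T].
case: (subalgebra_val y) => [[P' Q'] T'].
by congr (_, _, _) => /=; rewrite -?mul_polyC; ring.
Qed.

End CurrentInvariants.

(** The values of [p] vanish by positivity, and [p] has more roots than its degree allows. *)
Lemma poly_sum3_sqr_eq0 (R : realFieldType) (p q r : {poly R}) :
  p ^+ 2 + q ^+ 2 + r ^+ 2 = 0 -> p = 0.
Proof.
move=> pqr; have px x : p.[x] = 0.
  apply/eqP; rewrite -sqrf_eq0; apply/eqP/le_anti; rewrite sqr_ge0 andbT.
  have := congr1 (horner^~ x) pqr; rewrite !hornerE => h.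
  by have := sqr_ge0 q.[x]; have := sqr_ge0 r.[x]; lra.
apply: (@roots_geq_poly_eq0 _ _ [seq n%:R | n <- iota 0 (size p)]).
- by apply/allP => _ /mapP[n _ ->]; apply/rootP.
- rewrite map_inj_uniq ?iota_uniq // => m n /eqP; rewrite eqr_nat.
  by move/eqP.
- by rewrite size_map size_iota.
Qed.

Section RealForms.
Variable R : realFieldType.

Lemma n1_mem (eps : R) (x : s_current eps) : n1_gens x ->
  x \in subalgebra_pred (n1_subalgebra eps).
Proof. by move=> gx; apply/subalgebra_predP/sub_lin_span. Qed.

Lemma n1_plus_ad_cube : ~ has_ad_cube_zero (n1 (1 : R)).
Proof.
move=> [x x0 xc]; case/eqP: x0; apply: val_inj.
have gu : n1_gens (('X^(2 * 0 + 1), 0, 0) : s_current (1 : R)) by exists 0%N;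
  apply: Or31.
have gv : n1_gens ((0, 'X^(2 * 0 + 1), 0) : s_current (1 : R)) by exists 0%N;
  apply: Or32.
have := congr1 val (xc (Subalgebra (n1_mem gu))).
have := congr1 val (xc (Subalgebra (n1_mem gv))).
rewrite /lie /= /lie /=; case: (subalgebra_val x) => [[P Q] T].
rewrite /s_lie !scale1r muln0 add0n expr1.
move=> [hv1 hv2 hv3] [hu1 hu2 hu3].
(* ad(x)^3 = - [kappa] ad(x). Applied to u t and v t this makes [kappa] annihilate all coordinates
   of x, and [kappa] itself vanishes only for x = 0. *)
pose kappa := P ^+ 2 + Q ^+ 2 + T ^+ 2.
have kP : kappa * (P * 'X) = 0.
  by apply: oppr_inj; rewrite oppr0 -hv3 /kappa; ring.
have kQ : kappa * (Q * 'X) = 0 by rewrite -hu3 /kappa; ring.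
have kT : kappa * (T * 'X) = 0.
  by apply: oppr_inj; rewrite oppr0 -hu2 /kappa; ring.
have [k0|k0] := eqVneq kappa 0; last first.
  have cancel S : kappa * (S * 'X) = 0 -> S = 0.
    by move=> /eqP; rewrite !mulf_eq0 (negPf k0) polyX_eq0 orbF => /eqP.
  by rewrite (cancel _ kP) (cancel _ kQ) (cancel _ kT).
have P0 : P = 0 by apply: poly_sum3_sqr_eq0 k0.
have Q0 : Q = 0.
  by apply: (@poly_sum3_sqr_eq0 _ _ P T); rewrite -[RHS]k0 /kappa; ring.
have T0 : T = 0.
  by apply: (@poly_sum3_sqr_eq0 _ _ P Q); rewrite -[RHS]k0 /kappa; ring.
by rewrite P0 Q0 T0.
Qed.

(** For eps = -1 the quadratic form is indefinite, and (u + v) t is isotropic. *)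
Lemma n1_minus_ad_cube : has_ad_cube_zero (n1 (-1 : R)).
Proof.
have gu : n1_gens (('X^(2 * 0 + 1), 0, 0) : s_current (-1 : R)) by exists 0%N;
  apply: Or31.
have gv : n1_gens ((0, 'X^(2 * 0 + 1), 0) : s_current (-1 : R)) by exists 0%N;
  apply: Or32.
exists (Subalgebra (n1_mem gu) + Subalgebra (n1_mem gv)).
  apply/eqP => /(congr1 (fun y => (\val y : s_current (-1 : R)).1.1)) /=.
  by rewrite addr0 => /eqP; rewrite expf_eq0 polyX_eq0.
move=> y; apply: val_inj; rewrite [RHS](linear0 (\val : n1 (-1 : R) -> _)).
rewrite /lie /= /lie /=; case: (subalgebra_val y) => [[P Q] T].
by congr (_, _, _) => /=; rewrite -?mul_polyC ?polyCN; ring.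
Qed.

End RealForms.

Lemma table_lie_coef (K : fieldType) (I : choiceType)
  (t : I -> I -> {malg K[I]}) i j k (c : K) x :
  (forall l, (t i l)@_k = c *+ (l == j)) -> (table_lie t << i >> x)@_k = x@_j
    * c.
Proof.
move=> tE; rewrite /table_lie msuppU oner_eq0 big_seq_fset1 raddf_sum /=.
rewrite mcoeffUU; under eq_bigr => l _ do rewrite mul1r mcoeffZ tE.
have [jx|/mcoeff_outdom xj] := boolP (j \in msupp x).
  rewrite (bigD1_seq j) ?fset_uniq //= eqxx big1 ?addr0 // => l /negPf->.
  by rewrite mulr0.
rewrite xj mul0r big1 // => l _; have [->|] := eqVneq l j; last by rewrite
  mulr0.
by rewrite xj mul0r.
Qed.

(** * Invariants of n_2, n_2^3 and m_0^S *)

Section TableInvariants.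
Variable K : fieldType.
Hypothesis K0 : [pchar K] =i pred0.

Lemma n2_lieE q l :
  lie (n2_e K q.+1 : n2 K) (n2_e K l.+1) = (n2_d q.+1 l.+1)%:~R *: n2_e K
    (q.+1 + l.+1).
Proof. exact: table_lieUU. Qed.

Lemma n2_e_neq0 q : n2_e K q != 0 :> n2 K.
Proof. by apply/eqP => /(congr1 (mcoeff q.-1)) /eqP; rewrite mcoeffUU mcoeff0
  oner_eq0. Qed.

Lemma n23_lieE q l : lie (n23_e K q.+1 : n23 K) (n23_e K l.+1) =
  n23_bracket K q.+1 l.+1.
Proof. exact: table_lieUU. Qed.

Lemma n23_e_neq0 q : n23_e K q != 0 :> n23 K.
Proof. by apply/eqP => /(congr1 (mcoeff (Some q.-1))) /eqP; rewrite mcoeffUU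
  mcoeff0 oner_eq0. Qed.

Lemma n23_z_neq0 : n23_z K != 0 :> n23 K.
Proof. by apply/eqP => /(congr1 (mcoeff None)) /eqP; rewrite mcoeffUU mcoeff0
  oner_eq0. Qed.

(** The witness is [e_1, [e_3, e_4]] = 3 e_8, with e_3 = [e_1, e_2] and e_4 = [e_1, e_3]. *)
Lemma n2_derived : ~ derived_commutators_central (n2 K).
Proof.
move=> /(_ (n2_e K 1) (n2_e K 1) (n2_e K 2) (n2_e K 1) (n2_e K 3)).
rewrite !(n2_lieE, lieZl, lieZr) => /eqP; rewrite !scaler_eq0 (negPf
  (n2_e_neq0 _)).
by rewrite !(negPf (int_neq0 K0 _)).
Qed.

Lemma n23_derived : ~ derived_commutators_central (n23 K).
Proof.
move=> /(_ (n23_e K 1) (n23_e K 1) (n23_e K 2) (n23_e K 1) (n23_e K 3)).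
rewrite !(n23_lieE, lieZl, lieZr) => /eqP; rewrite !scaler_eq0 (negPf
  (n23_e_neq0 _)).
by rewrite !(negPf (int_neq0 K0 _)).
Qed.

(** For x = e_1 and y = e_2 the left side is [[e_1, e_4], e_3] = - 3 e_8. *)
Lemma n2_cross_product : ~ cross_product_identity (n2 K).
Proof.
move=> /(_ (n2_e K 1) (n2_e K 2)).
rewrite !(n2_lieE, lieZl, lieZr) => /eqP; rewrite !scaler_eq0 (negPf
  (n2_e_neq0 _)).
by rewrite !(negPf (int_neq0 K0 _)).
Qed.

Lemma n23_cross_product : ~ cross_product_identity (n23 K).
Proof.
move=> /(_ (n23_e K 1) (n23_e K 2)).
rewrite !(n23_lieE, lieZl, lieZr) => /eqP; rewrite !scaler_eq0 (negPf
  (n23_e_neq0 _)).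
by rewrite !(negPf (int_neq0 K0 _)).
Qed.

Lemma n23_center : ~ centerless (n23 K).
Proof.
move=> /(_ (n23_z K)) H; move: n23_z_neq0; rewrite H ?eqxx // => x.
rewrite /lie /= /table_lie big1 // => i _; rewrite big1_seq // => j.
rewrite /n23_z msuppU oner_eq0 inE => /eqP->.
by case: i => [i|]; rewrite scaler0.
Qed.

(** Bracketing with e_1 or e_2 shifts each coordinate by a table entry, and rows 1 and 2 of the
    table have no common zero. *)
Lemma n2_center : centerless (n2 K).
Proof.
move=> x cx.
have coefE q i : (lie (n2_e K q.+1 : n2 K) x : {malg K[nat]})@_(q.+1 + i)%N =
    (x : {malg K[nat]})@_i * (n2_d q.+1 i.+1)%:~R.
  apply: table_lie_coef => l; rewrite /n2_bracket mcoeffZ mcoeffU addSn addnS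
    /=.
  rewrite -addSn eqn_add2l; have [->|_] := eqVneq l i; last by rewrite mulr0.
  by rewrite mulr1.
apply/malgP => i; rewrite mcoeff0.
have [d1|d1] := eqVneq (n2_d 1 i.+1) 0.
  have d2 : n2_d 2 i.+1 != 0.
    move/eqP in d1; apply: (implyP _ d1); move: i.+1 {d1}.
    by apply: n2_check => // q; rewrite !(n2_dE _ q).
  have := coefE 1%N i; rewrite cx mcoeff0 => /esym/eqP; rewrite mulf_eq0.
  by rewrite (negPf (int_neq0 K0 d2)) orbF => /eqP.
have := coefE 0%N i; rewrite cx mcoeff0 => /esym/eqP; rewrite mulf_eq0.
by rewrite (negPf (int_neq0 K0 d1)) orbF => /eqP.
Qed.

Variable S : oddSet.
Local Notation M := (m0S K S).
Local Notation "x @@ i" := ((x : {malg K[m0S_basis S]})@_i) (at level 2).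

Lemma m0S_lieE i j : lie (<< i >> : M) << j >> = m0S_fun K i j.
Proof. exact: table_lieUU. Qed.

Lemma m0S_funNr i r : m0S_fun K i (inr r : m0S_basis S) = 0.
Proof. by case: i. Qed.

Lemma m0S_coef_lie (x y : M) k :
  (forall i j, (m0S_fun K i j) @@ k != 0 -> x @@ i = 0 \/ y @@ j = 0) ->
  (lie x y) @@ k = 0.
Proof.
move=> H; rewrite /lie /= /table_lie raddf_sum /= big1 // => i _.
rewrite raddf_sum /= big1 // => j _; rewrite mcoeffZ.
have [->|/H[]->] := eqVneq ((m0S_fun K i j) @@ k) 0; by rewrite ?mulr0 ?mul0r.
Qed.

Lemma m0S_z_coef r k : (m0S_z K S r) @@ (inl k) = 0.
Proof.
rewrite /m0S_z; case: insub => [s|]; last by rewrite mcoeff0.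
by rewrite mcoeffU.
Qed.

Lemma m0S_fun_coef_inl i j k :
  (m0S_fun K (inl i.+1 : m0S_basis S) j) @@ (inl k) != 0 -> j = inl 0%N.
Proof.
case: j => [[|j]|r] //; last by rewrite m0S_funNr mcoeff0 eqxx.
by rewrite m0S_funSS mcoeffZ m0S_z_coef mulr0 eqxx.
Qed.

Lemma m0S_central (x : M) : (forall k, x @@ (inl k) = 0) -> central x.
Proof.
move=> x0 y; rewrite /lie /= /table_lie big1 // => i _; rewrite big1 // =>
  -[j|r] _.
  by rewrite x0 mulr0 scale0r.
by rewrite m0S_funNr scaler0.
Qed.

Lemma m0S_fun_deg i j k : (m0S_fun K i j) @@ k != 0 ->
  m0S_deg k = (@m0S_deg S i + m0S_deg j)%N.
Proof.
have U0 (l : nat) : << inl l.+2 >> @@ k != 0 -> m0S_deg k = l.+2.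
  by rewrite mcoeffU; have [<-|_] := eqVneq (inl l.+2) k; rewrite ?mulr0n ?eqxx.
case: i j => [[|p]|r] [[|q]|r'].
- by rewrite m0S_xx mcoeff0 eqxx.
- by rewrite m0S_fun_t0S => /U0.
- by rewrite m0S_funNr mcoeff0 eqxx.
- by rewrite m0S_C m0S_fun_t0S mcoeffN oppr_eq0 => /U0; rewrite addn1.
- rewrite m0S_funSS mcoeffZ mulf_eq0 negb_or => /andP[_].
  rewrite /m0S_z; case: insubP => [s _ sE|]; last by rewrite mcoeff0 eqxx.
  rewrite mcoeffU; have [<- _|_] := eqVneq (inr s) k; last by rewrite mulr0n
    eqxx.
  by rewrite /= sE addSn addnS.
- by rewrite m0S_funNr mcoeff0 eqxx.
all: by rewrite m0S_C m0S_funNr oppr0 mcoeff0 eqxx.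
Qed.

(** In m_0^S the lower central series is the filtration by degree, which makes degrees visible to
    isomorphisms; [m0S_basis_lcs] is the converse inclusion. *)
Lemma m0S_lcs_coef n (x : M) i : lcs M n x -> (m0S_deg i <= n)%N -> x @@ i = 0.
Proof.
elim: n x i => [|n IHn] x i; first by rewrite leqNgt m0S_deg_gt0.
move=> xn; move: x xn i.
apply: (lin_span_min (B := [set x : M | forall i, (m0S_deg i <= n.+1)%N -> x
  @@ i = 0])).
  split=> [i _|a x y x0 y0 i ni]; first exact: mcoeff0.
  by rewrite mcoeffD mcoeffZ x0 // y0 // mulr0 addr0.
move=> _ [x _ [y yn <-]] k kn; apply: m0S_coef_lie => i j /m0S_fun_deg kE.
right; apply: IHn yn _; have := m0S_deg_gt0 i; lia.
Qed.

(** Commutators have no component along e_1, and the other e_i bracket among themselves into the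
    central z_r. *)
Lemma m0S_derived : derived_commutators_central M.
Proof.
have low (x y : M) k : (k <= 1)%N -> (lie x y) @@ (inl k) = 0.
  move=> k1; apply: (m0S_lcs_coef (n := 1)); last by case: k k1 => [|[|]].
  exact: (lcs_lie (n := 0)).
move=> u x y z t; apply: m0S_central => k; apply: m0S_coef_lie => -[[|i]|r] j.
- by move=> _; left; apply: low.
- by move=> /m0S_fun_coef_inl->; right; apply: low.
- by rewrite m0S_C m0S_funNr oppr0 mcoeff0 eqxx.
Qed.

Lemma m0S_center_coef (x : M) k : central x -> x @@ (inl k) = 0.
Proof.
move=> cx; case: k => [|k].
  have := @table_lie_coef K _ (@m0S_fun K S) (inl 1%N) (inl 0%N) (inl 2) (-1) x.
  rewrite -[table_lie _ _ _]/(lie (<< inl 1%N >> : M) x) cx mcoeff0 => H.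
  have /esym/eqP : 0 = x @@ (inl 0%N) * -1.
    apply: H => -[[|l]|r].
    - by rewrite m0S_C m0S_fun_t0S mcoeffN mcoeffUU.
    - by rewrite m0S_funSS mcoeffZ m0S_z_coef mulr0.
    - by rewrite m0S_funNr mcoeff0.
  by rewrite mulrN1 oppr_eq0 => /eqP.
have := @table_lie_coef K _ (@m0S_fun K S) (inl 0%N) (inl k.+1) (inl k.+2) 1 x.
rewrite -[table_lie _ _ _]/(lie (<< inl 0%N >> : M) x) cx mcoeff0 mulr1 => ->
  //.
case=> [[|l]|r].
- by rewrite m0S_xx mcoeff0.
- by rewrite m0S_fun_t0S mcoeffU.
- by rewrite m0S_funNr mcoeff0.
Qed.

Lemma m0S_basis_lcs (i : m0S_basis S) :
  lcs M (m0S_deg i).-1 (<< i >> : {malg K[m0S_basis S]}).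
Proof.
have le k : lcs M k (<< inl k.+1 >> : {malg K[m0S_basis S]}).
  elim: k => // k IHk; have := lcs_lie (<< inl 0%N >> : M) IHk.
  by rewrite m0S_lieE.
case: i => [[|k]|r]; [exact: Logic.I | exact: le |].
have /andP[_ r3] := oset_ge3 (valP r).
have := lcs_lie (<< inl 1%N >> : M) (le (val r - 2)%N).
rewrite m0S_lieE m0S_funSS expr1 scaleN1r add0n.
have -> : (val r - 2).+2 = val r by lia.
rewrite /m0S_z valK => /(subspaceN (lcs_subspace _ _)); rewrite opprK.
by have -> : ((val r - 2).+1 = (val r).-1)%N by lia.
Qed.

(** The z_r span the center. The index is r - 1 for degree r because the series starts with
    [lcs M 0], the whole algebra. *)
Lemma m0S_layer r : r \in oset S <-> (3 <= r)%N /\ central_in_layer M r.-1.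
Proof.
split=> [rS|[r3 [z [cz zr nz]]]].
  have /andP[_ r3] := oset_ge3 rS; split=> //.
  pose s : m0S_basis S := inr (exist (fun r => r \in oset S) r rS).
  exists (<< s >> : {malg K[m0S_basis S]}); split.
  - by apply: m0S_central => k; rewrite mcoeffU.
  - exact: (m0S_basis_lcs s).
  - move=> /(m0S_lcs_coef (i := s)) => /(_ ltac:(rewrite /=; lia)) /eqP.
    by rewrite mcoeffUU oner_eq0.
apply: contrapT => rS; apply: nz.
rewrite [z](malg_ZE (z : {malg K[m0S_basis S]})).
apply: (subspace_sum (lcs_subspace M _)) => i iz _.
have [zi|zi] := eqVneq (z @@ i) 0.
  by rewrite zi scale0r; case: (lcs_subspace M r.-1.+1).
case: i iz zi => [k|s] _ zi; first by rewrite m0S_center_coef ?eqxx in zi.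
have sr : (val s > r.-1)%N.
  rewrite ltnNge; apply: contraNN zi => sr.
  by rewrite (m0S_lcs_coef zr).
have rs : (r.-1.+1 <= (val s).-1)%N.
  have : val s <> r by move=> Es; apply: rS; rewrite -Es (valP s).
  lia.
exact: (subspaceZ _ (lcs_subspace M _) (lcs_le rs (m0S_basis_lcs (inr s)))).
Qed.

End TableInvariants.

(** * Classification *)

Lemma m0S_has_table (K : fieldType) (S : oddSet) :
  has_table (@m0S_fun K S) (m0S K S).
Proof.
exact: (table_algebra_has_table
          (LieTable (@m0S_xx K S) (@m0S_C K S) (@m0S_jacobi K S))).
Qed.

Lemma n2_has_table (K : fieldType) :
  has_table (fun i j => n2_bracket K i.+1 j.+1) (n2 K).
Proof.
exact: (table_algebra_has_table (LieTable (@n2_xx K) (@n2_C K) (@n2_jacobi K))).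
Qed.

Lemma n23_has_table (K : fieldType) : has_table (n23_fun K) (n23 K).
Proof.
exact: (table_algebra_has_table
          (LieTable (@n23_xx K) (@n23_C K) (@n23_jacobi K))).
Qed.

Section Classification.
Variables (K : fieldType) (L : lieAlgType K) (g : nat -> set L).
Hypotheses (K0 : [pchar K] =i pred0) (g_graded : N_grading g).
Hypothesis g_gen :
  forall i, (0 < i)%N -> lie_product (g 1%N) (g i) = g i.+1.
Hypothesis L_inf : infinite_dimensional L.
Hypothesis g_width : forall i, (0 < i)%N -> exists d d' : nat,
  [/\ has_dim (g i) d, has_dim (g i.+1) d' & (d + d' <= 3)%N].

Lemma table_classification :
  [\/ exists2 eps, eps != 0 & lie_iso L (n1 eps),
      lie_iso L (n2 K), lie_iso L (n23 K)
    | exists S, lie_iso L (m0S K S)].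
Proof.
have [[X [a [Xa_gen c1]]]|[eps eps0 Lt]] :=
    first_step K0 g_graded g_gen L_inf g_width; last first.
  by apply: Or41; exists eps => //; apply: has_table_iso Lt (n1_has_table eps).
have [cc|[X' [X'a_gen {}c1 c2 e5]]] :=
    noncentral_step K0 g_graded g_gen L_inf g_width Xa_gen c1.
  apply: Or44; have [S Lt] := m0S_recognition g_graded g_gen L_inf g_width
    Xa_gen cc.
  by exists S; apply: has_table_iso Lt (m0S_has_table K S).
have [z0|z0] := eqVneq (fil_c X' a 1) 0.
  apply: Or42; apply: has_table_iso (n2_has_table K).
  exact: (n2_recognition K0 g_graded g_gen L_inf g_width X'a_gen c1 c2 e5 z0).
apply: Or43; apply: has_table_iso (n23_has_table K).
exact: (n23_recognition K0 g_graded g_gen L_inf g_width X'a_gen c1 c2 e5 z0).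
Qed.

End Classification.

Lemma oddSet_eq (S T : oddSet) : (forall r, r \in oset S <-> r \in oset T) ->
  S = T.
Proof.
move=> ST; have {ST} : oset S = oset T.
  by apply/seteqP; split=> r /mem_set /ST /set_mem.
case: S T => [S oS] [T oT] /= ET; subst T.
by congr OddSet; apply: Prop_irrelevance.
Qed.

Lemma m0S_eq (K : fieldType) (S T : oddSet) :
  lie_iso (m0S K S) (m0S K T) -> S = T.
Proof.
move=> ST; have TS := lie_iso_sym ST; apply: oddSet_eq => r.
rewrite !(m0S_layer K); split=> -[r3 H]; split=> //.
  exact: central_in_layer_iso H.
exact: central_in_layer_iso H.
Qed.

Lemma m0_iso (K : fieldType) : lie_iso (m0 K) (m0S K oddSet0).
Proof.
exact: has_table_iso (m0_has_table K) (m0S_has_table K oddSet0).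
Qed.

Lemma oddSet_empty (S : oddSet) : ~ (oset S !=set0) -> S = oddSet0.
Proof.
move=> S0; apply: oddSet_eq => r; split=> /set_mem rS //.
by case: S0; exists r.
Qed.

(** * The real classification *)

Section RealClassification.
Variable R : realType.

Let R0 : [pchar R] =i pred0 := @pchar_num R.

Definition real_oddSet (k : real_label) : oddSet :=
  if k is Rm0S A _ then A else oddSet0.

Lemma real_label_m0S (S : oddSet) : exists k, lie_iso (m0S R S) (real_algebra
  R k).
Proof.
have [S0|/oddSet_empty->] := pselect (oset S !=set0).
  by exists (Rm0S S0), idfun; split; [exists idfun|].
by exists Rm0; apply/lie_iso_sym/m0_iso.
Qed.

Lemma n1_scale (K : fieldType) (eps c : K) : c != 0 ->
  lie_iso (n1 eps) (n1 (eps * c ^+ 2)).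
Proof.
move=> c0; apply: has_table_iso (n1_has_table _).
exact: n1_table_scale (n1_has_table _).
Qed.

Lemma real_n1 (eps : R) : eps != 0 ->
  lie_iso (n1 eps) (n1 1) \/ lie_iso (n1 eps) (n1 (-1)).
Proof.
move=> eps0; pose c := (Num.sqrt `|eps|)^-1.
have c0 : c != 0 by rewrite invr_eq0 sqrtr_eq0 -ltNge normr_gt0.
have := n1_scale eps c0; rewrite exprVn sqr_sqrtr ?normr_ge0 //.
have [e_gt0|e_le0] := ltrP 0 eps.
  by rewrite gtr0_norm // divff //; left.
by rewrite ler0_norm // invrN mulrN divff //; right.
Qed.

Lemma real_existence (L : lieAlgType R) (g : nat -> set L) :
  infinite_dimensional L -> N_grading g ->
  (forall i, (0 < i)%N -> lie_product (g 1%N) (g i) = g i.+1) ->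
  (forall i, (0 < i)%N -> exists d d' : nat,
     [/\ has_dim (g i) d, has_dim (g i.+1) d' & (d + d' <= 3)%N]) ->
  exists k, lie_iso L (real_algebra R k).
Proof.
move=> L_inf g_graded g_gen g_width.
have [[eps eps0 Li]|Li|Li|[S Li]] :=
  table_classification R0 g_graded g_gen L_inf g_width.
- have [ni|ni] := real_n1 eps0; [exists Rn1plus | exists Rn1minus];
    exact: lie_iso_trans Li ni.
- by exists Rn2.
- by exists Rn23.
- have [k Sk] := real_label_m0S S; exists k; exact: lie_iso_trans Li Sk.
Qed.

(** The booleans name the branches of a decision tree: an invariant is computed only for the labels
    that the earlier ones leave together. *)
Definition real_is_m0 (k : real_label) : bool :=
  match k with Rm0 | Rm0S _ _ => true | _ => false end.

Definition real_is_n1 (k : real_label) : bool :=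
  match k with Rn1plus | Rn1minus => true | _ => false end.

Definition real_is_n1minus (k : real_label) : bool :=
  if k is Rn1minus then true else false.

Definition real_is_n2 (k : real_label) : bool := if k is Rn2 then true else
  false.

Lemma real_m0_iso k : real_is_m0 k ->
  lie_iso (real_algebra R k) (m0S R (real_oddSet k)).
Proof.
case: k => // [_|A hA _]; first exact: m0_iso.
by exists idfun; split; [exists idfun|].
Qed.

Lemma real_derivedE k :
  derived_commutators_central (real_algebra R k) <-> real_is_m0 k.
Proof.
split=> [H|/real_m0_iso/derived_commutators_central_iso]; last first.
  by apply; apply: m0S_derived.
have N0 : -1 != 0 :> R by rewrite oppr_eq0 oner_eq0.
case: k H => // H; exfalso; move: H.
- exact: n1_derived (oner_neq0 _) (n1_has_table _).
- exact: n1_derived N0 (n1_has_table _).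
- exact: n2_derived R0.
- exact: n23_derived R0.
Qed.

Lemma real_cross_productE k : ~~ real_is_m0 k ->
  cross_product_identity (real_algebra R k) <-> real_is_n1 k.
Proof.
case: k => // _; split=> // H.
- exact: n1_cross_product.
- exact: n1_cross_product.
- by case: (n2_cross_product R0 H).
- by case: (n23_cross_product R0 H).
Qed.

Lemma real_ad_cubeE k : real_is_n1 k ->
  has_ad_cube_zero (real_algebra R k) <-> real_is_n1minus k.
Proof.
case: k => // _; split=> // H; first by case: (n1_plus_ad_cube H).
exact: n1_minus_ad_cube.
Qed.

Lemma real_centerE k : ~~ real_is_m0 k -> ~~ real_is_n1 k ->
  centerless (real_algebra R k) <-> real_is_n2 k.
Proof.
case: k => // _ _; split=> // H; last by case: (n23_center H).
exact: n2_center.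
Qed.

Lemma real_uniqueness (k k' : real_label) :
  lie_iso (real_algebra R k) (real_algebra R k') -> k = k'.
Proof.
move=> kk; have k'k := lie_iso_sym kk.
have m0E : real_is_m0 k = real_is_m0 k'.
  by apply/idP/idP => /real_derivedE H; apply/real_derivedE;
     apply: derived_commutators_central_iso H.
have [mk|mk] := boolP (real_is_m0 k).
  have mk' : real_is_m0 k' by rewrite -m0E.
  have := lie_iso_trans (lie_iso_sym (real_m0_iso mk)) kk.
  move=> /lie_iso_trans/(_ (real_m0_iso mk')) /m0S_eq; clear kk k'k.
  case: k k' {m0E} mk mk' => // [|A hA] [|||||A' hA'] //= _ _ EA.
  - by case: hA' => r; rewrite -EA.
  - by case: hA => r; rewrite EA.
  - by subst A'; congr Rm0S; exact: Prop_irrelevance.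
have mk' : ~~ real_is_m0 k' by rewrite -m0E.
have n1E : real_is_n1 k = real_is_n1 k'.
  apply/idP/idP => [/(real_cross_productE mk)|/(real_cross_productE mk')] H.
    exact/(real_cross_productE mk')/(cross_product_identity_iso k'k H).
  exact/(real_cross_productE mk)/(cross_product_identity_iso kk H).
have [nk|nk] := boolP (real_is_n1 k).
  have nk' : real_is_n1 k' by rewrite -n1E.
  have : real_is_n1minus k = real_is_n1minus k'.
    apply/idP/idP => [/(real_ad_cubeE nk)|/(real_ad_cubeE nk')] H.
      exact/(real_ad_cubeE nk')/(has_ad_cube_zero_iso kk H).
    exact/(real_ad_cubeE nk)/(has_ad_cube_zero_iso k'k H).
  by clear - nk nk'; case: k k' nk nk' => // [] [].
have nk' : ~~ real_is_n1 k' by rewrite -n1E.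
have : real_is_n2 k = real_is_n2 k'.
  apply/idP/idP => [/(real_centerE mk nk)|/(real_centerE mk' nk')] H.
    exact/(real_centerE mk' nk')/(centerless_iso k'k H).
  exact/(real_centerE mk nk)/(centerless_iso kk H).
by clear - mk mk' nk nk'; case: k k' mk mk' nk nk' => // [] [].
Qed.

End RealClassification.

(** * The complex classification *)

Section ComplexClassification.
Variable R : realType.
Local Notation C := R[i].

Let C0 : [pchar C] =i pred0 := @pchar_num C.

Lemma complexification_n1 (eps : R) :
  lie_iso (complexification (n1 eps)) (n1 (eps%:C : C)).
Proof.
apply: has_table_iso (n1_has_table _).
exact: complexification_n1_table (n1_has_table _).
Qed.

Lemma complex_n1 (eps : C) : eps != 0 -> lie_iso (n1 eps) (n1 (1 : C)).
Proof.
move=> eps0; pose c := (sqrtC eps)^-1.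
have c0 : c != 0 by rewrite invr_eq0 sqrtC_eq0.
by have := n1_scale eps c0; rewrite exprVn sqrtCK divff.
Qed.

Lemma complexification_n1_one (eps : R) : eps != 0 ->
  lie_iso (complexification (n1 eps)) (n1 (1 : C)).
Proof.
move=> eps0; apply: lie_iso_trans (complexification_n1 eps) (complex_n1 _).
by apply: contraNneq eps0 => -[->].
Qed.

Lemma complex_existence (L : lieAlgType C) (g : nat -> set L) :
  infinite_dimensional L -> N_grading g ->
  (forall i, (0 < i)%N -> lie_product (g 1%N) (g i) = g i.+1) ->
  (forall i, (0 < i)%N -> exists d d' : nat,
     [/\ has_dim (g i) d, has_dim (g i.+1) d' & (d + d' <= 3)%N]) ->
  exists k, lie_iso L (complex_algebra R k).
Proof.
move=> L_inf g_graded g_gen g_width.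
have [[eps eps0 Li]|Li|Li|[S Li]] :=
  table_classification C0 g_graded g_gen L_inf g_width.
- exists Cn1; apply: lie_iso_trans Li _.
  apply: lie_iso_trans (complex_n1 eps0) _.
  exact: lie_iso_sym (complexification_n1_one (oner_neq0 R)).
- by exists Cn2.
- by exists Cn23.
- have [S0|S0] := pselect (oset S !=set0); first by exists (Cm0S S0).
  exists Cm0; rewrite (oddSet_empty S0) in Li.
  exact: lie_iso_trans Li (lie_iso_sym (m0_iso _)).
Qed.

Definition complex_is_m0 (k : complex_label) : bool :=
  match k with Cm0 | Cm0S _ _ => true | _ => false end.

Definition complex_is_n1 (k : complex_label) : bool :=
  if k is Cn1 then true else false.

Definition complex_is_n2 (k : complex_label) : bool :=
  if k is Cn2 then true else false.

Definition complex_oddSet (k : complex_label) : oddSet :=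
  if k is Cm0S A _ then A else oddSet0.

Lemma complex_m0_iso k : complex_is_m0 k ->
  lie_iso (complex_algebra R k) (m0S C (complex_oddSet k)).
Proof.
case: k => // [_|A hA _]; first exact: m0_iso.
by exists idfun; split; [exists idfun|].
Qed.

Lemma complex_derivedE k :
  derived_commutators_central (complex_algebra R k) <-> complex_is_m0 k.
Proof.
split=> [H|/complex_m0_iso/derived_commutators_central_iso]; last first.
  by apply; apply: m0S_derived.
have n1C := lie_iso_sym (complexification_n1_one (oner_neq0 R)).
case: k H => // H; exfalso; move: H.
- move=> /(derived_commutators_central_iso n1C).
  exact: n1_derived (oner_neq0 _) (n1_has_table _).
- exact: n2_derived C0.
- exact: n23_derived C0.
Qed.

Lemma complex_cross_productE k : ~~ complex_is_m0 k ->
  cross_product_identity (complex_algebra R k) <-> complex_is_n1 k.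
Proof.
have n1C := complexification_n1_one (oner_neq0 R).
case: k => // _; split=> // H.
- exact: cross_product_identity_iso n1C (@n1_cross_product _ _).
- by case: (n2_cross_product C0 H).
- by case: (n23_cross_product C0 H).
Qed.

Lemma complex_centerE k : ~~ complex_is_m0 k -> ~~ complex_is_n1 k ->
  centerless (complex_algebra R k) <-> complex_is_n2 k.
Proof.
case: k => // _ _; split=> // H; last by case: (n23_center H).
exact: n2_center.
Qed.

Lemma complex_uniqueness (k k' : complex_label) :
  lie_iso (complex_algebra R k) (complex_algebra R k') -> k = k'.
Proof.
move=> kk; have k'k := lie_iso_sym kk.
have m0E : complex_is_m0 k = complex_is_m0 k'.
  by apply/idP/idP => /complex_derivedE H; apply/complex_derivedE;
     apply: derived_commutators_central_iso H.
have [mk|mk] := boolP (complex_is_m0 k).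
  have mk' : complex_is_m0 k' by rewrite -m0E.
  have := lie_iso_trans (lie_iso_sym (complex_m0_iso mk)) kk.
  move=> /lie_iso_trans/(_ (complex_m0_iso mk')) /m0S_eq; clear kk k'k.
  case: k k' {m0E} mk mk' => // [|A hA] [||||A' hA'] //= _ _ EA.
  - by case: hA' => r; rewrite -EA.
  - by case: hA => r; rewrite EA.
  - by subst A'; congr Cm0S; exact: Prop_irrelevance.
have mk' : ~~ complex_is_m0 k' by rewrite -m0E.
have n1E : complex_is_n1 k = complex_is_n1 k'.
  apply/idP/idP => [/(complex_cross_productE mk)|/(complex_cross_productE
    mk')] H.
    exact/(complex_cross_productE mk')/(cross_product_identity_iso k'k H).
  exact/(complex_cross_productE mk)/(cross_product_identity_iso kk H).
have [nk|nk] := boolP (complex_is_n1 k).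
  have nk' : complex_is_n1 k' by rewrite -n1E.
  by clear - nk nk'; case: k k' nk nk' => // [] [].
have nk' : ~~ complex_is_n1 k' by rewrite -n1E.
have : complex_is_n2 k = complex_is_n2 k'.
  apply/idP/idP => [/(complex_centerE mk nk)|/(complex_centerE mk' nk')] H.
    exact/(complex_centerE mk' nk')/(centerless_iso k'k H).
  exact/(complex_centerE mk nk)/(centerless_iso kk H).
by clear - mk mk' nk nk'; case: k k' mk mk' nk nk' => // [] [].
Qed.

End ComplexClassification.

Theorem theorem2p1 (R : realType) :
  [/\ (forall (L : lieAlgType R) (g : nat -> set L),
         infinite_dimensional L ->
         N_grading g ->
         (forall i, (0 < i)%N -> lie_product (g 1%N) (g i) = g i.+1) ->
         (forall i, (0 < i)%N -> exists d d' : nat,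
            [/\ has_dim (g i) d, has_dim (g i.+1) d' & (d + d' <= 3)%N]) ->
         exists! k : real_label, lie_iso L (real_algebra R k)),
      (forall k k' : real_label,
         lie_iso (real_algebra R k) (real_algebra R k') -> k = k'),
      lie_iso (complexification (n1 (1 : R)) : lieAlgType R[i])
              (complexification (n1 (-1 : R)) : lieAlgType R[i]),
      (forall (L : lieAlgType R[i]) (g : nat -> set L),
         infinite_dimensional L ->
         N_grading g ->
         (forall i, (0 < i)%N -> lie_product (g 1%N) (g i) = g i.+1) ->
         (forall i, (0 < i)%N -> exists d d' : nat,
            [/\ has_dim (g i) d, has_dim (g i.+1) d' & (d + d' <= 3)%N]) ->
         exists! k : complex_label, lie_iso L (complex_algebra R k))
    & (forall k k' : complex_label,
         lie_iso (complex_algebra R k) (complex_algebra R k') -> k = k')].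
Proof.
split.
- move=> L g L_inf g_graded g_gen g_width.
  have [k Lk] := real_existence L_inf g_graded g_gen g_width.
  exists k; split=> // k' Lk'; apply: real_uniqueness.
  exact: lie_iso_trans (lie_iso_sym Lk) Lk'.
- exact: real_uniqueness.
- have N0 : -1 != 0 :> R by rewrite oppr_eq0 oner_eq0.
  apply: lie_iso_trans (complexification_n1_one (oner_neq0 R)) _.
  exact: lie_iso_sym (complexification_n1_one N0).
- move=> L g L_inf g_graded g_gen g_width.
  have [k Lk] := complex_existence L_inf g_graded g_gen g_width.
  exists k; split=> // k' Lk'; apply: complex_uniqueness.
  exact: lie_iso_trans (lie_iso_sym Lk) Lk'.
- exact: complex_uniqueness.
Qed.
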